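(* Let $\varphi,\psi\in H^2(\mathbb{T})$ be outer functions satisfying the following condition: there exist $\epsilon>0$ and $n_0$ such that for all $n\ge n_0$ and all $S\in \mathrm{Poly}_n$ there exists $T\in \mathrm{Poly}_n\setminus\{0\}$ with $$(\varphi S,\psi T)_\lambda \ge \epsilon\,\|\varphi S\|_\lambda\,\|\psi T\|_\lambda .$$ Let $\mu := \psi\overline{\varphi}\,\lambda$ (a complex measure). Let $r\ge 0$ be an integer. Given any functions $f_0,\ldots,f_r,g_0,\ldots,g_r\in L^2(|\varphi|^2+|\psi|^2)$, let $F_j := P_{H^2}(f_j\overline{\varphi})$ and $G_j := P_{H^2}(g_j\overline{\psi})$ for $0\le j\le r$. For $n\ge 1$ and $-n\le j\le r$ define $$p_j := \begin{cases} f_j & \text{if } 0\le j\le r,\\ e_j & \text{if } -n\le j\le -1,\end{cases}\qquad q_j := \begin{cases} g_j & \text{if } 0\le j\le r,\\ e_j & \text{if } -n\le j\le -1.\end{cases}$$ Then $$\lim_{n\to\infty} D_{n-1}(\mu)^{-1}\det\left[\int p_j\overline{q_k}\,d\mu\right]_{-n\le j,k\le r} = \det\left[\int F_j\overline{G_k}\,d\lambda\right]_{0\le j,k\le r}.$$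
   Context: $\lambda$ is Lebesgue measure on the unit-length circle $\mathbb{T}=\mathbb{R}/\mathbb{Z}$, and $e_n(t) := e^{2\pi i n t}$ for $n\in\mathbb{Z}$. $\mathrm{Poly}_n$ is the (complex) linear span of $\{e_0,e_1,\ldots,e_n\}$. $(u,v)_\lambda := \int_{\mathbb{T}} u\overline v\,d\lambda$ and $\|\cdot\|_\lambda$ is the norm of $L^2(\lambda)$; an inequality $(u,v)_\lambda\ge c$ with $c$ real means that $(u,v)_\lambda$ is real and at least $c$. For a weight $w\ge 0$, $L^2(w)$ means $L^2(w\lambda)$. For a complex measure $\mu$, $\widehat\mu(n) := \int_{\mathbb{T}} e^{-2\pi i n t}\,d\mu(t)$ and $D_n(\mu) := \det[\widehat\mu(k-j)]_{0\le j,k\le n}$ for $n\ge0$. The limit is taken over those large $n$ for which $D_{n-1}(\mu)\neq 0$ (under the hypotheses this is the case for all sufficiently large $n$). $H^2(\mathbb{T})$ is the Hardy space of those $g\in L^2(\lambda)$ with $\widehat g(n) := \int g\,\overline{e_n}\,d\lambda=0$ for all $n<0$, and $P_{H^2}$ is the orthogonal projection from $L^2(\lambda)$ onto $H^2(\mathbb{T})$. Outer functions: for $f\ge 0$ with $\log f\in L^1(\lambda)$, put $\Phi_f(z) := \exp\left(\frac12\int_{\mathbb{T}}\frac{e_1(t)+z}{e_1(t)-z}\log f(t)\,d\lambda(t)\right)$ for $|z|<1$, and $\varphi_f(t) := \lim_{r\uparrow1}\Phi_f(re_1(t))$, which exists for $\lambda$-a.e. $t$ and satisfies $|\varphi_f|^2=f$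 a.e. An outer function is a function of the form $\varphi_f$ for such an $f$; it belongs to $H^2(\mathbb{T})$ iff $f\in L^1(\lambda)$. *)

(* Defs.v *)
From mathcomp Require Import all_boot all_order all_algebra.
From mathcomp Require Import complex.
From mathcomp Require Import all_classical all_reals all_analysis.

Set Implicit Arguments.
Unset Strict Implicit.
Unset Printing Implicit Defensive.

Import Order.TTheory GRing.Theory Num.Theory.
Import numFieldNormedType.Exports.
Import ComplexField.Normc.

Local Open Scope classical_set_scope.
Local Open Scope ring_scope.
Local Open Scope complex_scope.

(* The circle R/Z is represented by its fundamental domain [0, 1[: a function
   on the circle is a function R -> R[i] of which only the values on [0, 1[
   matter.  Elements of L^2 spaces are represented by functions, and equalities
   between them are understood almost everywhere. *)
Definition circle (R : realType) : set R := `[0%R, 1%R[%classic.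
Arguments circle R : clear implicits.

Definition cint (R : realType) (u : R -> R[i]) : R[i] :=
  Rintegral lebesgue_measure (circle R) (fun t => complex.Re (u t)) +i*
  Rintegral lebesgue_measure (circle R) (fun t => complex.Im (u t)).

Definition cmeasurable (R : realType) (u : R -> R[i]) : Prop :=
  measurable_fun (circle R) (fun t => complex.Re (u t)) /\
  measurable_fun (circle R) (fun t => complex.Im (u t)).

(* L^2 with respect to the weighted measure w * lambda. *)
Definition L2w (R : realType) (w : R -> R) (u : R -> R[i]) : Prop :=
  cmeasurable u /\
  lebesgue_measure.-integrable (circle R)
    (fun t => (normc (u t) ^+ 2 * w t)%:E).

Definition L2 (R : realType) (u : R -> R[i]) : Prop := L2w (fun=> 1) u.

Definition cconj (R : realType) (u : R -> R[i]) : R -> R[i] :=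
  fun t => conjc (u t).

Definition inner (R : realType) (u v : R -> R[i]) : R[i] :=
  cint (u \* cconj v).

Definition norm2 (R : realType) (u : R -> R[i]) : R :=
  Num.sqrt (Rintegral lebesgue_measure (circle R)
              (fun t => normc (u t) ^+ 2)).

Definition cexp (R : realType) (z : R[i]) : R[i] :=
  (expR (complex.Re z))%:C * (cos (complex.Im z) +i* sin (complex.Im z)).

Definition efun (R : realType) (n : int) (t : R) : R[i] :=
  cexp (0 +i* (2 * pi * n%:~R * t)).

Definition trigpoly (R : realType) (n : nat) : set (R -> R[i]) :=
  [set S | exists c : 'I_n.+1 -> R[i],
     S = fun t => \sum_(k < n.+1) c k * efun (Posz k) t].

Definition H2 (R : realType) (u : R -> R[i]) : Prop :=
  L2 u /\ forall n : int, (n < 0)%R -> inner u (efun n) = 0.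

(* v is (a representative of) the orthogonal projection of u onto H^2. *)
Definition is_projH2 (R : realType) (u v : R -> R[i]) : Prop :=
  H2 v /\ forall h, H2 h -> inner (u \- v) h = 0.

(* [ln] is the real-valued logarithm, with ln 0 = 0 by convention; this is
   harmless because [outer] below forces f > 0 almost everywhere. *)
Definition outer_ext (R : realType) (f : R -> R) (z : R[i]) : R[i] :=
  cexp (2^-1 *
    cint (fun t => (efun 1 t + z) / (efun 1 t - z) * (ln (f t))%:C)).

(* [lne] is the extended logarithm, with lne 0 = -oo, so that the integrability
   condition is the usual log f \in L^1.  The type R[i]^o carries the topology
   of the modulus. *)
Definition outer (R : realType) (phi : R -> R[i]) : Prop :=
  exists f : R -> R,
    [/\ forall t, circle R t -> 0 <= f t,
        lebesgue_measure.-integrable (circle R) (fun t => lne (f t)%:E) &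
        {ae lebesgue_measure, forall t, circle R t ->
          (outer_ext f (r%:C * efun 1 t) : R[i]^o) @[r --> 1^'-]
            --> (phi t : R[i]^o)}].

(* A complex measure h * lambda is represented by its density h. *)
Definition dint (R : realType) (h u : R -> R[i]) : R[i] := cint (u \* h).

Definition mhat (R : realType) (h : R -> R[i]) (n : int) : R[i] :=
  dint h (efun (- n)).

Definition toeplitz_det (R : realType) (h : R -> R[i]) (n : nat) : R[i] :=
  \det (\matrix_(j < n.+1, k < n.+1) mhat h (Posz k - Posz j)).

(* The family p_{-n}, ..., p_r listed in increasing order: the position i < n
   stands for the index i - n < 0 and the position n + b for the index b. *)
Definition extfam (R : realType) (r n : nat) (f : 'I_r.+1 -> R -> R[i])
    (i : 'I_(n + r.+1)) : R -> R[i] :=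
  match fintype.split i with
  | inl a => efun (Posz a - Posz n)
  | inr b => f b
  end.

(* Main.v *)
Require Import Defs.
From mathcomp Require Import all_boot all_order all_algebra.
From mathcomp Require Import complex.
From mathcomp Require Import all_classical all_reals all_analysis.
From mathcomp Require Import perm measurable_realfun ring lra.
Import Order.TTheory GRing.Theory Num.Theory.
Import numFieldNormedType.Exports.
Import ComplexField.Normc.
Local Open Scope classical_set_scope.
Local Open Scope ring_scope.
Local Open Scope complex_scope.

(** The Schur complement of the block of negative indices turns
    D_{n-1}(mu)^{-1} det[...] into det[((I - Q_n) u_j, v_k)], where
    u_j = f_j conj(phi), v_k = g_k conj(psi), and Q_n is the projection onto
    conj(phi) span(e_{-n}, ..., e_{-1}) along the orthogonal complement of
    conj(psi) span(e_{-n}, ..., e_{-1}).  The angle condition bounds Q_n by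
    1/eps uniformly in n and makes the Gram matrix invertible.  Q_n vanishes on
    H^2 because psi is in H^2, and on the complement of H^2 it converges
    strongly to the identity as soon as phi times polynomials is dense in H^2.
    Hence (I - Q_n) u_j tends to the projection of u_j onto H^2.

    The density is Szego's theorem: with u = log |phi|^2, cut off below to
    v = max(u, -K), the function 1/Phi_v is analytic and bounded in the disc,
    and for its dilations h_r one has |phi h_r|_2 -> |e^{(u-v)/2}|_2 <= 1, while
    (phi h_r, 1) = exp((int u - int v)/2) is close to 1; so phi h_r is close
    to 1.  That phi has mean exp(int u / 2) follows from the
    convergence of the dilations of Phi_u to phi in L^2, for which Jensen's
    inequality gives |Phi_u(r .)|_2 <= |phi|_2. *)

Set Implicit Arguments.
Unset Strict Implicit.
Unset Printing Implicit Defensive.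

(** * Integration on the circle *)

(** The angle condition is one-sided: every S has a partner T. The two spans have the same finite
    dimension, so the injectivity that it yields is already invertibility of the square Gram matrix.
    The same inequality makes the oblique projection Q_n quasi-optimal, with constant 1 + 1/eps,
    among all elements of its range; convergence then reduces to density of the union of these
    ranges. Analyticity enters only through the Herglotz kernel, whose expansion is a geometric
    series with an explicit tail. For a fixed radius, the exponential of kappa times a Herglotz
    integral is a uniform limit on the circle of polynomials (1 + kappa P / n)^n in e_1, with P a
    partial sum, and their values at 0 tend to exp(kappa int v). For polynomials, mean values are
    read off the coefficients. The definition of an outer function provides a radial limit, while
    |phi|^2 = exp u is proved from it, by the L^1 convergence of Poisson integrals. Radii run
    through one sequence tending to 1, so that limit theorems for sequences of integrals apply. *)

Lemma measurable_circle {R : realType} :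
  measurable (circle R : set (measurableTypeR R)).
Proof. exact: measurable_itv. Qed.
#[local] Hint Resolve measurable_circle : core.

Section RealIntegral.
Context {R : realType}.
Implicit Types (h g : R -> R) (M : R).
Local Notation mu := (@lebesgue_measure R).

Definition rint h : R := Rintegral mu (circle R) h.
Definition rintegrable h : Prop := mu.-integrable (circle R) (EFin \o h).
Definition rmeas h : Prop := measurable_fun (circle R) h.

Lemma lebesgue_circle : mu (circle R) = 1%E.
Proof. by rewrite /circle lebesgue_measure_itv/= lte_fin ltr01 -EFinB subr0. Qed.

Lemma rmeas_cst M : rmeas (fun=> M).
Proof. exact: measurable_cst. Qed.

Lemma rmeasD h g : rmeas h -> rmeas g -> rmeas (fun t => h t + g t).
Proof. exact: measurable_funD. Qed.

Lemma rmeasB h g : rmeas h -> rmeas g -> rmeas (fun t => h t - g t).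
Proof. exact: measurable_funB. Qed.

Lemma rmeasM h g : rmeas h -> rmeas g -> rmeas (fun t => h t * g t).
Proof. exact: measurable_funM. Qed.

Lemma rmeas_comp k h : continuous k -> rmeas h -> rmeas (fun t => k (h t)).
Proof. 
move=> ck mh; apply: measurableT_comp => //; exact: continuous_measurable_fun.
Qed.

Lemma rmeas_min h g : rmeas h -> rmeas g -> rmeas (fun t => Num.min (h t) (g t)).
Proof. exact: measurable_minr. Qed.

Lemma rmeas_max h g : rmeas h -> rmeas g -> rmeas (fun t => Num.max (h t) (g t)).
Proof. exact: measurable_maxr. Qed.

Lemma rmeasN h : rmeas h -> rmeas (fun t => - h t).
Proof. by move=> mh; exact: measurableT_comp. Qed.

Lemma rmeas_sqrt h : rmeas h -> rmeas (fun t => Num.sqrt (h t)).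
Proof. by apply: rmeas_comp; exact: sqrt_continuous. Qed.

Lemma rmeas_exp h : rmeas h -> rmeas (fun t => expR (h t)).
Proof. by apply: rmeas_comp; exact: continuous_expR. Qed.

Lemma rmeas_abs h : rmeas h -> rmeas (fun t => `|h t|).
Proof. by apply: rmeas_comp; exact: norm_continuous. Qed.

Lemma rint_cst M : rint (fun=> M) = M.
Proof. by rewrite /rint Rintegral_cst// [X in fine X]lebesgue_circle/= mulr1. Qed.

Lemma rintegrable_meas h : rintegrable h -> rmeas h.
Proof. by move/(measurable_int mu)/measurable_EFinP. Qed.

Lemma rintegrable_dom h g : rmeas h -> rintegrable g ->
  (forall t, circle R t -> `|h t| <= g t) -> rintegrable h.
Proof.
move=> mh ig hg; apply: (@le_integrable _ _ R mu _ measurable_circle _ (EFin \o g)) => //.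
  exact/measurable_EFinP.
move=> t It /=; rewrite lee_fin; apply: le_trans (hg t It) _; exact: ler_norm.
Qed.

Lemma rintegrable_cst M : rintegrable (fun=> M).
Proof.
apply: measurable_bounded_integrable => //.
- by have := lebesgue_circle; rewrite /= => ->; rewrite ltry.
- by exists `|M|; split; rewrite ?num_real// => x Mx y _ /=; exact: ltW.
Qed.

Lemma rintegrable_bdd h M : rmeas h ->
  (forall t, circle R t -> `|h t| <= M) -> rintegrable h.
Proof. by move=> mh; apply: rintegrable_dom => //; exact: rintegrable_cst. Qed.

Lemma rintegrableD h g : rintegrable h -> rintegrable g ->
  rintegrable (fun t => h t + g t).
Proof. by move=> ih ig; have := integrableD measurable_circle ih ig. Qed.

Lemma rintegrableZ M h : rintegrable h -> rintegrable (fun t => M * h t).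
Proof. by move=> ih; have := integrableZl measurable_circle M ih. Qed.

Lemma rintegrableN h : rintegrable h -> rintegrable (fun t => - h t).
Proof. by move=> ih; have := integrableN ih. Qed.

Lemma rintegrableB h g : rintegrable h -> rintegrable g ->
  rintegrable (fun t => h t - g t).
Proof. by move=> ih ig; have := integrableB measurable_circle ih ig. Qed.

Lemma rintegrable_abs h : rintegrable h -> rintegrable (fun t => `|h t|).
Proof. by move=> ih; have := integrable_norm ih. Qed.

Lemma eq_rintegrable h g : (forall t, circle R t -> h t = g t) ->
  rintegrable h -> rintegrable g.
Proof.
move=> hg; apply: eq_integrable => //.
by move=> t /set_mem It /=; rewrite hg.
Qed.

Lemma rintegrableMbdd h g M : rmeas h -> rintegrable g ->
  (forall t, circle R t -> `|h t| <= M) -> rintegrable (fun t => h t * g t).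
Proof.
move=> mh ig hM; apply: (@rintegrable_dom _ (fun t => M * `|g t|)).
- apply: measurable_funM => //; exact: rintegrable_meas.
- exact/rintegrableZ/rintegrable_abs.
- by move=> t It; rewrite normrM ler_wpM2r// hM.
Qed.

Lemma eq_rint h g : (forall t, circle R t -> h t = g t) -> rint h = rint g.
Proof. by move=> hg; apply: eq_Rintegral => t /set_mem /hg. Qed.

Lemma rintD h g : rintegrable h -> rintegrable g ->
  rint (fun t => h t + g t) = rint h + rint g.
Proof. by move=> ih ig; exact: (@RintegralD _ _ _ mu _ h g measurable_circle). Qed.

Lemma rintB h g : rintegrable h -> rintegrable g ->
  rint (fun t => h t - g t) = rint h - rint g.
Proof. by move=> ih ig; exact: RintegralB. Qed.

Lemma rintZ M h : rintegrable h -> rint (fun t => M * h t) = M * rint h.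
Proof. by move=> ih; exact: RintegralZl. Qed.

Lemma rintN h : rintegrable h -> rint (fun t => - h t) = - rint h.
Proof.
move=> ih; rewrite -mulN1r -rintZ//; by apply: eq_rint => t _; rewrite mulN1r.
Qed.

Lemma le_rint h g : rintegrable h -> rintegrable g ->
  (forall t, circle R t -> h t <= g t) -> rint h <= rint g.
Proof. by move=> ih ig; exact: (@le_Rintegral _ _ _ mu _ h g measurable_circle). Qed.

Lemma rint_ge0 h : (forall t, circle R t -> 0 <= h t) -> 0 <= rint h.
Proof. exact: (@Rintegral_ge0 _ _ _ mu). Qed.

Lemma le_abs_rint h : rintegrable h -> `|rint h| <= rint (fun t => `|h t|).
Proof. by move=> ih; exact: (@le_normr_Rintegral _ _ _ mu _ h measurable_circle). Qed.

Lemma EFin_rint h : rintegrable h ->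
  (rint h)%:E = (\int[mu]_(t in circle R) (h t)%:E)%E.
Proof. by move=> ih; rewrite /rint /Rintegral fineK// integrable_fin_num. Qed.

Definition aec (P : R -> Prop) := {ae mu, forall t, circle R t -> P t}.
Lemma aec_mono (P Q : R -> Prop) : (forall t, circle R t -> P t -> Q t) -> aec P -> aec Q.
Proof. move=> PQ. 
apply: (@filterS _ _ (ae_filter_ringOfSetsType _)).
move=> t PQt It; exact/PQ/PQt. Qed.

Lemma aec_and (P Q : R -> Prop) : aec P -> aec Q -> aec (fun t => P t /\ Q t).
Proof.
rewrite /aec; apply: (@filterS2 _ _ (ae_filter_ringOfSetsType _)).
by move=> t Pt Qt It; split; [exact: Pt|exact: Qt].
Qed.

Lemma aec_forall (P : nat -> R -> Prop) :
  (forall n, aec (P n)) -> aec (fun t => forall n, P n t).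
Proof.
move=> /ae_foralln; rewrite /aec; apply: (@filterS _ _ (ae_filter_ringOfSetsType _)).
by move=> t aPt It n; exact: aPt.
Qed.

Lemma aecW (P : R -> Prop) : (forall t, circle R t -> P t) -> aec P.
Proof. by move=> PI; rewrite /aec; exact: (@aeW _ _ _ mu). Qed.

Lemma ae_eq_rint h g : rmeas h -> rmeas g ->
  aec (fun t => h t = g t) -> rint h = rint g.
Proof.
move=> mh mg hg; rewrite /rint /Rintegral; congr fine.
apply: (@ae_eq_integral _ _ _ mu _ (EFin \o g) (EFin \o h) measurable_circle);
  [exact/measurable_EFinP..|].
by apply: aec_mono hg => t _ /= ->.
Qed.

Lemma ae_eq_rintegrable h g : rmeas g -> rintegrable h ->
  aec (fun t => h t = g t) -> rintegrable g.
Proof.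
move=> mg ih hg; apply/integrableP; split; first exact/measurable_EFinP.
have /integrableP[mh] := ih.
rewrite (@ae_eq_integral _ _ _ mu _ (fun x => `|(EFin \o g) x|%E) _ measurable_circle)//.
- by apply/measurable_EFinP; apply: rmeas_abs; exact: rintegrable_meas.
- by apply/measurable_EFinP; apply: rmeas_abs.
- by apply: aec_mono hg => t _ /= ->.
Qed.

Lemma rint_eq0_ae h : rintegrable h -> (forall t, circle R t -> 0 <= h t) ->
  rint h = 0 -> aec (fun t => h t = 0).
Proof.
move=> ih h0 h00.
have mh := rintegrable_meas ih.
have : (\int[mu]_(x in circle R) `|(EFin \o h) x| = 0)%E.
  rewrite -[RHS]/(0%:E) -h00 EFin_rint//; apply: eq_integral => t /set_mem It /=.
  by rewrite ger0_norm// h0.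
have mh' : measurable_fun (circle R) (EFin \o h) by exact/measurable_EFinP.
move/(ae_eq_integral_abs mu measurable_circle mh').1.
by apply: aec_mono => t _ [].
Qed.

End RealIntegral.

(** * Limit theorems for integrals of sequences *)

Section Convergence.
Context {R : realType}.
Implicit Types (h g : R -> R).
Local Notation mu := (@lebesgue_measure R).

Lemma rint_cvg_dom (h_ : nat -> R -> R) h g :
  (forall n, rmeas (h_ n)) -> rmeas h -> rintegrable g ->
  (forall n t, circle R t -> `|h_ n t| <= g t) ->
  aec (fun t => h_ ^~ t @ \oo --> h t) ->
  rint (h_ n) @[n --> \oo] --> rint h.
Proof.
move=> mh_ mh ig hg hh.
have [|||||ih _ cvgh] := @dominated_convergence _ _ R mu _ measurable_circle
   (fun n t => (h_ n t)%:E) (EFin \o h) (EFin \o g).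
- by move=> n; apply/measurable_EFinP; exact: mh_.
- by apply/measurable_EFinP; exact: mh.
- by apply: aec_mono hh => t _ ht; apply/fine_cvgP; split => //; exact: nearW.
- exact: ig.
- by apply: aeW => t n It /=; rewrite lee_fin hg.
have ih_ n : rintegrable (h_ n).
  by apply: (rintegrable_dom _ ig) => // t It; exact: hg.
move: cvgh; rewrite -EFin_rint// => /fine_cvgP[_]; apply: cvg_trans.
by apply: near_eq_cvg; apply: nearW => n /=; rewrite -EFin_rint.
Qed.

(* Dominated convergence for [min (h_ n) h]. *)
Lemma rint_fatou (h_ : nat -> R -> R) h :
  (forall n, rintegrable (h_ n)) -> rintegrable h ->
  (forall t, circle R t -> 0 <= h t) ->
  (forall n t, circle R t -> 0 <= h_ n t) ->
  aec (fun t => h_ ^~ t @ \oo --> h t) ->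
  forall e, 0 < e -> \forall n \near \oo, rint h - e <= rint (h_ n).
Proof.
move=> ih_ ih h0 h_0 hh e e0.
have mb n t : circle R t -> `|Num.min (h_ n t) (h t)| <= h t.
  move=> It; rewrite ger0_norm; first by rewrite ge_min lexx orbT.
  by rewrite le_min (h_0 _ _ It) (h0 _ It).
have im n : rintegrable (fun t => Num.min (h_ n t) (h t)).
  apply: (rintegrable_dom _ ih).
    by apply: rmeas_min; [exact: (rintegrable_meas (ih_ n))|exact: (rintegrable_meas ih)].
  exact: mb.
have cm : rint (fun t => Num.min (h_ n t) (h t)) @[n --> \oo] --> rint h.
  apply: (rint_cvg_dom _ _ ih) => //.
  - by move=> n; exact: (rintegrable_meas (im n)).
  - exact: (rintegrable_meas ih).
  - apply: aec_mono hh => t _ ht.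
    apply/cvgrPdist_le => d d0; move/cvgrPdist_le : ht => /(_ _ d0).
    apply: filterS => n; apply: le_trans.
    rewrite minElt; case: ifPn => // _.
    by rewrite subrr normr0.
move/cvgrPdist_le : cm => /(_ _ e0); apply: filterS => n.
rewrite ler_norml => /andP[_]; rewrite lerBlDr -lerBlDl => /le_trans; apply.
by apply: le_rint => // t It; rewrite ge_min lexx.
Qed.

(** Markov's inequality: if E is the set where [h_ n] is at least eta for all n >= N, then eta |E|
    is at most every such integral, hence E is null. This plays the role of an a.e. convergent
    subsequence, with indices that depend on the point. *)
Lemma aec_liminf0 (h_ : nat -> R -> R) :
  (forall n, rintegrable (h_ n)) ->
  (forall n t, circle R t -> 0 <= h_ n t) ->
  rint (h_ n) @[n --> \oo] --> (0 : R) ->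
  aec (fun t => forall N k : nat, exists2 n, (N <= n)%N & h_ n t < k.+1%:R^-1).
Proof.
move=> ih_ h_0 ch; apply: aec_forall => N; apply: aec_forall => k.
set eta := k.+1%:R^-1 : R.
have eta0 : 0 < eta by rewrite invr_gt0.
pose E := \bigcap_m (circle R `&` h_ (N + m)%N @^-1` `[eta, +oo[).
have mE : measurable (E : set (measurableTypeR R)).
  apply: bigcapT_measurable => m.
  by apply: (rintegrable_meas (ih_ _)) => //; exact: measurable_itv.
have iE : rintegrable (\1_E : R -> R).
  apply: (@rintegrable_bdd _ _ 1); first exact: measurable_indic.
  by move=> t _; rewrite indicE; case: (_ \in _); rewrite ?normr0 ?normr1.
have E0 : rint (\1_E : R -> R) = 0.
  apply/eqP; rewrite eq_le rint_ge0// andbT.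
  rewrite -(pmulr_rle0 _ eta0) -rintZ//.
  rewrite leNgt; apply/negP => c0.
  move/cvgrPdist_lt : ch => /(_ _ c0) [M _ /(_ (N + M)%N (leq_addl _ _))].
  have g0 : 0 <= rint (h_ (N + M)%N) by apply: rint_ge0; exact: h_0.
  rewrite /= sub0r normrN ger0_norm// ltNge => /negP; apply.
  apply: le_rint => //; first exact: rintegrableZ.
  move=> t It; rewrite indicE; case: (boolP (t \in E)) => [|_].
    by rewrite inE mulr1 => /(_ M I) [_] /=; rewrite in_itv/= andbT.
  by rewrite mulr0 h_0.
apply: aec_mono (rint_eq0_ae iE _ E0) => // t It /eqP.
rewrite indicE pnatr_eq0 eqb0 => /negP tE; apply: contrapT => tN.
apply: tE; rewrite inE => m _; split => //=; rewrite in_itv/= andbT leNgt.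
by apply/negP => htk; apply: tN; exists (N + m)%N => //; exact: leq_addr.
Qed.

End Convergence.

(** * Convolution with a bounded continuous kernel *)

Section Convolution.
Context {R : realType}.
Implicit Types (h g a b k : R -> R).
Local Notation mu := (@lebesgue_measure R).

(** The kernel lives on the whole line and [s - t] ranges over ]-1, 1[; the Poisson kernels put in
    later are 1-periodic, which makes this the convolution of the circle. *)
Definition kconv k b (t : R) : R := rint (fun s => k (s - t) * b s).

Lemma rmeas_patch a : rmeas a -> measurable_fun setT (a \_ (circle R)).
Proof. by move=> ma; exact/(measurable_restrictT _ measurable_circle). Qed.

Lemma continuous_rmeas k t : continuous k -> rmeas (fun s => k (s - t)).
Proof.
move=> ck; apply: rmeas_comp => //; apply: measurable_funB => //.
Qed.

Lemma rintegrable_kconv k b (M : R) t : continuous k -> (forall x, `|k x| <= M) ->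
  rintegrable b -> rintegrable (fun s => k (s - t) * b s).
Proof.
move=> ck kM ib; apply: (rintegrableMbdd (M := M)) => //.
exact: continuous_rmeas.
Qed.

Section kernel.
Variables (k : R -> R) (M : R).
Hypotheses (ck : continuous k) (k0 : forall x, 0 <= k x) (kM : forall x, k x <= M).

Let kM' x : `|k x| <= M.
Proof. by rewrite ger0_norm. Qed.

(** Extension of a and b by zero moves both integrals to the whole line, where Tonelli's theorem is
    applied to this integrand. *)
Let F a b (z : R * R) : \bar R :=
  ((a \_ (circle R)) z.1 * (k (z.2 - z.1) * (b \_ (circle R)) z.2))%:E.

Let mF a b : rmeas a -> rmeas b ->
  measurable_fun [set: measurableTypeR R * measurableTypeR R] (F a b).
Proof.
move=> ma mb; apply/measurable_EFinP.
apply: measurable_funM.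
  by apply: (measurableT_comp (rmeas_patch ma)); exact: measurable_fst.
apply: measurable_funM; last first.
  by apply: (measurableT_comp (rmeas_patch mb)); exact: measurable_snd.
apply: measurableT_comp; first exact: continuous_measurable_fun.
by apply: measurable_funB; [exact: measurable_snd|exact: measurable_fst].
Qed.

Let F0 a b : (forall t, circle R t -> 0 <= a t) ->
  (forall t, circle R t -> 0 <= b t) -> forall z, (0 <= F a b z)%E.
Proof.
move=> a0 b0 z; rewrite lee_fin !patchE.
by apply: mulr_ge0; last apply: mulr_ge0 => //; case: ifPn => // /set_mem; auto.
Qed.

Lemma int_patch h : rintegrable h ->
  (\int[mu]_(t in setT) ((h \_ (circle R)) t)%:E = (rint h)%:E)%E.
Proof.
move=> ih; rewrite EFin_rint// [RHS]integral_mkcond.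
by apply: eq_integral => t _; rewrite /= !patchE; case: ifPn.
Qed.

Let intF2 a b t : rintegrable b ->
  (\int[mu]_s F a b (t, s) = ((a \_ (circle R)) t * kconv k b t)%:E)%E.
Proof.
move=> ib.
have ikb := rintegrable_kconv t ck kM' ib.
rewrite -rintZ// -int_patch; last exact: rintegrableZ.
apply: eq_integral => s _; rewrite /F/= !(patchE _ _ s); congr _%:E.
by case: ifPn => //; rewrite !mulr0.
Qed.

(** By Tonelli, with a = 1, the integrals over sections form a measurable function. The signed case
    follows by splitting b into positive and negative parts. *)
Let kconv_meas0 b : rintegrable b -> (forall t, circle R t -> 0 <= b t) ->
  rmeas (kconv k b).
Proof.
move=> ib b0.
have mone : rmeas (fun=> 1 : R) by exact: rmeas_cst.
have one0 t : circle R t -> 0 <= (1 : R) by [].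
have := @measurable_fun_fubini_tonelli_F _ _ _ _ R mu (F (fun=> 1) b)
  (mF mone (rintegrable_meas ib)) (F0 one0 b0).
have -> : fubini_F mu (F (fun=> 1) b) =
    EFin \o (fun t => (((fun=> 1) : R -> R) \_ (circle R)) t * kconv k b t).
  by apply/funext => t; rewrite /fubini_F intF2.
move/measurable_EFinP => mc; apply: eq_measurable_fun (measurable_funTS mc).
by move=> t It /=; rewrite patchE It mul1r.
Qed.

Lemma rmeas_kconv b : rintegrable b -> rmeas (kconv k b).
Proof.
move=> ib.
have bE : b = fun t => Num.max (b t) 0 - Num.max (- b t) 0.
  apply/funext => t; rewrite !maxEle oppr_le0.
  case: (leP (b t) 0) => [b0|/ltW b0]; case: (leP 0 (b t)) => [b0'|b0'];
    rewrite ?subr0 ?sub0r ?opprK ?subrr//.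
    by apply/eqP; rewrite eq_le b0 b0'.
  by move: b0'; rewrite ltNge b0.
have ip : rintegrable (fun t => Num.max (b t) 0).
  apply: (rintegrable_dom _ (rintegrable_abs ib)).
    by apply: rmeas_max; [exact: (rintegrable_meas ib)|exact: rmeas_cst].
  move=> t _; rewrite ger0_norm; last by rewrite le_max lexx orbT.
  by rewrite ge_max ler_norm normr_ge0.
have im : rintegrable (fun t => Num.max (- b t) 0).
  apply: (rintegrable_dom _ (rintegrable_abs ib)).
    by apply: rmeas_max; [apply: rmeasN; exact: (rintegrable_meas ib)|exact: rmeas_cst].
  move=> t _; rewrite ger0_norm; last by rewrite le_max lexx orbT.
  rewrite ge_max normr_ge0 andbT.
  by rewrite -normrN ler_norm.
have -> : kconv k b = fun t => kconv k (fun t => Num.max (b t) 0) t -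
                              kconv k (fun t => Num.max (- b t) 0) t.
  apply/funext => t; rewrite /kconv -rintB; [|exact: rintegrable_kconv..].
  by apply: eq_rint => s _; rewrite {1}bE mulrBr.
by apply: rmeasB; apply: kconv_meas0 => // t _; rewrite le_max lexx orbT.
Qed.

Lemma kconv_norm_le b t : rintegrable b ->
  `|kconv k b t| <= M * rint (fun s => `|b s|).
Proof.
move=> ib; apply: le_trans (le_abs_rint _) _; first exact: rintegrable_kconv.
rewrite -rintZ; last exact: rintegrable_abs.
apply: le_rint; first exact/rintegrable_abs/rintegrable_kconv.
  exact/rintegrableZ/rintegrable_abs.
by move=> s _; rewrite normrM ler_wpM2r.
Qed.

Lemma rintegrableMkconv a b : rintegrable a -> rintegrable b ->
  rintegrable (fun t => a t * kconv k b t).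
Proof.
move=> ia ib; under eq_fun do rewrite mulrC.
apply: (rintegrableMbdd (M := M * rint (fun s => `|b s|))) => //.
  exact: rmeas_kconv.
by move=> t _; exact: kconv_norm_le.
Qed.

(** Tonelli and the evenness of k: convolution by k is self-adjoint. This is how a kernel is later
    moved from one factor to the other. *)
Lemma kconv_sym (kN : forall x, k (- x) = k x) a b :
  rintegrable a -> rintegrable b ->
  (forall t, circle R t -> 0 <= a t) -> (forall t, circle R t -> 0 <= b t) ->
  rint (fun t => a t * kconv k b t) = rint (fun t => b t * kconv k a t).
Proof.
move=> ia ib a0 b0; apply: EFin_inj.
have E x y : rintegrable x -> rintegrable y ->
  ((rint (fun t => x t * kconv k y t))%:E = \int[mu]_t \int[mu]_s F x y (t, s))%E.
  move=> ix iy; rewrite -int_patch; last exact: rintegrableMkconv.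
  apply: eq_integral => t _; rewrite intF2// !patchE.
  by case: ifPn => //; rewrite mul0r.
rewrite !E//.
have := @fubini_tonelli _ _ _ _ R mu mu (F a b)
  (mF (rintegrable_meas ia) (rintegrable_meas ib)) (F0 a0 b0).
move=> ->; apply: eq_integral => s _; apply: eq_integral => t _.
rewrite /F /= -(kN (t - s)) opprB; congr (_%:E); ring.
Qed.

End kernel.
End Convolution.

(** * Complex-valued functions and the space L2 *)

Section ComplexNorm.
Context {R : realType}.
Implicit Types (x y z : R[i]) (a b : R).

Lemma sqr_normc_ReIm z : normc z ^+ 2 = complex.Re z ^+ 2 + complex.Im z ^+ 2.
Proof. by case: z => a b /=; rewrite sqr_sqrtr// addr_ge0 ?sqr_ge0. Qed.

Lemma normc_ge0 z : 0 <= normc z.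
Proof. by case: z => a b /=; rewrite sqrtr_ge0. Qed.

Lemma normc_conjc z : normc (conjc z) = normc z.
Proof. by case: z => a b /=; rewrite sqrrN. Qed.

Lemma normc_real a : normc a%:C = `|a|.
Proof. by rewrite /= expr0n/= addr0 sqrtr_sqr. Qed.

Lemma normcX z n : normc (z ^+ n) = normc z ^+ n.
Proof. by elim: n => [|n IH]; rewrite ?expr0 ?normc1// !exprS normcM IH. Qed.

Lemma abs_Re_le z : `|complex.Re z| <= normc z.
Proof.
rewrite -ler_sqr ?nnegrE ?normc_ge0// sqr_normc_ReIm real_normK ?num_real//.
by rewrite lerDl sqr_ge0.
Qed.

Lemma abs_Im_le z : `|complex.Im z| <= normc z.
Proof.
rewrite -ler_sqr ?nnegrE ?normc_ge0// sqr_normc_ReIm real_normK ?num_real//.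
by rewrite lerDr sqr_ge0.
Qed.

Lemma normc_le_ReIm z : normc z <= `|complex.Re z| + `|complex.Im z|.
Proof.
rewrite -ler_sqr ?nnegrE ?normc_ge0 ?addr_ge0//.
rewrite sqr_normc_ReIm sqrrD !real_normK ?num_real// -addrA lerD2l lerDr.
by rewrite mulrn_wge0// mulr_ge0.
Qed.

Lemma normcD_le x y : normc (x + y) <= normc x + normc y.
Proof. exact: le_normcD. Qed.

Lemma normcB_le x y : normc (x - y) <= normc x + normc y.
Proof. by rewrite -(normcN y); exact: le_normcD. Qed.

Lemma normcBC x y : normc (x - y) = normc (y - x).
Proof. by rewrite -normcN opprB. Qed.

Lemma normc_sum (I : Type) (r : seq I) (P : pred I) (F : I -> R[i]) :
  normc (\sum_(i <- r | P i) F i) <= \sum_(i <- r | P i) normc (F i).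
Proof.
elim/big_rec2 : _ => [|i u v _ h]; first by rewrite normc0.
by apply: le_trans (normcD_le _ _) _; rewrite lerD2l.
Qed.

Lemma mulc_conjc z : z * conjc z = (normc z ^+ 2)%:C.
Proof.
rewrite sqr_normc_ReIm; case: z => a b /=; apply/eqP; rewrite eq_complex /=.
by apply/andP; split; apply/eqP; ring.
Qed.

Lemma Re_cM x y : complex.Re (x * y) =
  complex.Re x * complex.Re y - complex.Im x * complex.Im y.
Proof. by case: x; case: y. Qed.

Lemma Im_cM x y : complex.Im (x * y) =
  complex.Re x * complex.Im y + complex.Im x * complex.Re y.
Proof. by case: x => a b; case: y => c d /=. Qed.

Lemma Re_cD x y : complex.Re (x + y) = complex.Re x + complex.Re y.
Proof. by case: x; case: y. Qed.

Lemma Im_cD x y : complex.Im (x + y) = complex.Im x + complex.Im y.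
Proof. by case: x; case: y. Qed.

Lemma Re_cN x : complex.Re (- x) = - complex.Re x. Proof. by case: x. Qed.

Lemma Im_cN x : complex.Im (- x) = - complex.Im x. Proof. by case: x. Qed.

Lemma Re_cJ x : complex.Re (conjc x) = complex.Re x. Proof. by case: x. Qed.

Lemma Im_cJ x : complex.Im (conjc x) = - complex.Im x. Proof. by case: x. Qed.

Lemma conjcM x y : conjc (x * y) = conjc x * conjc y.
Proof. exact: rmorphM. Qed.

Lemma conjcD x y : conjc (x + y) = conjc x + conjc y.
Proof. exact: rmorphD. Qed.

Lemma conjcB x y : conjc (x - y) = conjc x - conjc y.
Proof. exact: rmorphB. Qed.

Lemma eq_ReIm x y : complex.Re x = complex.Re y -> complex.Im x = complex.Im y -> x = y.
Proof. by case: x y => a b [c d] /= -> ->. Qed.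

End ComplexNorm.

(** * Integration of complex-valued functions *)

Section ComplexIntegral.
Context {R : realType}.
Implicit Types (u v : R -> R[i]) (c : R[i]) (h : R -> R).

Definition cintegrable u : Prop :=
  rintegrable (fun t => complex.Re (u t)) /\ rintegrable (fun t => complex.Im (u t)).

Lemma cintegrable_meas u : cintegrable u -> cmeasurable u.
Proof. by case=> *; split; exact: rintegrable_meas. Qed.

Lemma cmeasurableD u v : cmeasurable u -> cmeasurable v -> cmeasurable (u \+ v).
Proof.
move=> [u1 u2] [v1 v2]; split => /=.
  by under eq_fun do rewrite Re_cD; exact: rmeasD.
by under eq_fun do rewrite Im_cD; exact: rmeasD.
Qed.

Lemma cmeasurableM u v : cmeasurable u -> cmeasurable v -> cmeasurable (u \* v).
Proof.
move=> [u1 u2] [v1 v2]; split => /=.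
  by under eq_fun do rewrite Re_cM; apply: rmeasB; exact: rmeasM.
by under eq_fun do rewrite Im_cM; apply: rmeasD; exact: rmeasM.
Qed.

Lemma cmeasurableJ u : cmeasurable u -> cmeasurable (cconj u).
Proof.
move=> [u1 u2]; split; rewrite /cconj/=.
  by under eq_fun do rewrite Re_cJ.
by under eq_fun do rewrite Im_cJ; exact: rmeasN.
Qed.

Lemma cmeasurableN u : cmeasurable u -> cmeasurable (fun t => - u t).
Proof.
move=> [u1 u2]; split => /=.
  by under eq_fun do rewrite Re_cN; exact: rmeasN.
by under eq_fun do rewrite Im_cN; exact: rmeasN.
Qed.

Lemma cmeasurable_cst c : cmeasurable (fun=> c : R[i]).
Proof. by split; exact: rmeas_cst. Qed.

Lemma cmeasurable_real h : rmeas h -> cmeasurable (fun t => (h t)%:C).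
Proof. by move=> mh; split => //=; exact: rmeas_cst. Qed.

Lemma cmeasurable_sum (I : Type) (r : seq I) (P : pred I) (F : I -> R -> R[i]) :
  (forall i, P i -> cmeasurable (F i)) ->
  cmeasurable (fun t => \sum_(i <- r | P i) F i t).
Proof.
move=> mF; elim: r => [|i r IH].
  rewrite (_ : (fun t => _) = fun=> 0); first exact: cmeasurable_cst.
  by apply/funext => t; rewrite big_nil.
rewrite (_ : (fun t => _) = fun t => if P i then F i t + \sum_(j <- r | P j) F j t
    else \sum_(j <- r | P j) F j t); last by apply/funext => t; rewrite big_cons.
by case: (P i) (mF i) => [/(_ isT) Pi|_]; [exact: (cmeasurableD Pi IH)|exact: IH].
Qed.

Lemma rmeas_normc u : cmeasurable u -> rmeas (fun t => normc (u t)).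
Proof.
move=> [u1 u2].
have -> : (fun t => normc (u t)) =
    fun t => Num.sqrt (complex.Re (u t) * complex.Re (u t) +
                       complex.Im (u t) * complex.Im (u t)).
  by apply/funext => t; case: (u t).
by apply: rmeas_sqrt; apply: rmeasD; exact: rmeasM.
Qed.

Lemma cintegrable_dom u h : cmeasurable u -> rintegrable h ->
  (forall t, circle R t -> normc (u t) <= h t) -> cintegrable u.
Proof.
move=> [u1 u2] ih uh; split; apply: (rintegrable_dom _ ih) => // t It.
  exact: le_trans (abs_Re_le _) (uh _ It).
exact: le_trans (abs_Im_le _) (uh _ It).
Qed.

Lemma rintegrable_normc u : cintegrable u -> rintegrable (fun t => normc (u t)).
Proof.
move=> iu; have [i1 i2] := iu.
apply: (rintegrable_dom _ (rintegrableD (rintegrable_abs i1) (rintegrable_abs i2))).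
  by apply: rmeas_normc; exact: cintegrable_meas.
by move=> t _; rewrite ger0_norm ?normc_ge0// normc_le_ReIm.
Qed.

Lemma cintegrableD u v : cintegrable u -> cintegrable v -> cintegrable (u \+ v).
Proof.
move=> iu iv.
apply: (cintegrable_dom _ (rintegrableD (rintegrable_normc iu) (rintegrable_normc iv))).
  by apply: cmeasurableD; exact: cintegrable_meas.
by move=> t _; exact: normcD_le.
Qed.

Lemma cintegrableN u : cintegrable u -> cintegrable (fun t => - u t).
Proof.
move=> iu; apply: (cintegrable_dom _ (rintegrable_normc iu)).
  by apply: cmeasurableN; exact: cintegrable_meas.
by move=> t _; rewrite normcN.
Qed.

Lemma cintegrableMbdd u v (M : R) : cmeasurable v -> cintegrable u ->
  (forall t, circle R t -> normc (v t) <= M) -> cintegrable (v \* u).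
Proof.
move=> mv iu vM.
apply: (cintegrable_dom _ (rintegrableZ M (rintegrable_normc iu))).
  by apply: cmeasurableM => //; exact: cintegrable_meas.
by move=> t It /=; rewrite normcM ler_wpM2r ?normc_ge0// vM.
Qed.

Lemma cintegrableZ c u : cintegrable u -> cintegrable (fun t => c * u t).
Proof.
move=> iu; apply: (@cintegrableMbdd u (fun=> c) (normc c)) => //.
Qed.

Lemma cintegrable_real h : rintegrable h -> cintegrable (fun t => (h t)%:C).
Proof. by move=> ih; split => //=; exact: rintegrable_cst. Qed.

Lemma cintegrable_sum (I : Type) (r : seq I) (P : pred I) (F : I -> R -> R[i]) :
  (forall i, P i -> cintegrable (F i)) ->
  cintegrable (fun t => \sum_(i <- r | P i) F i t).
Proof.
move=> mF; elim: r => [|i r IH].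
  rewrite (_ : (fun t => _) = fun=> (0 : R)%:C).
    exact: (cintegrable_real (rintegrable_cst 0)).
  by apply/funext => t; rewrite big_nil.
rewrite (_ : (fun t => _) = fun t => if P i then F i t + \sum_(j <- r | P j) F j t
    else \sum_(j <- r | P j) F j t); last by apply/funext => t; rewrite big_cons.
by case: (P i) (mF i) => [/(_ isT) Pi|_]; [exact: (cintegrableD Pi IH)|exact: IH].
Qed.

Lemma eq_cint u v : (forall t, circle R t -> u t = v t) -> cint u = cint v.
Proof.
by move=> uv; congr Complex; apply: eq_rint => t It; rewrite uv.
Qed.

Lemma cint_real h : cint (fun t => (h t)%:C) = (rint h)%:C.
Proof. by rewrite /cint/= -[X in _ +i* X]/(rint (fun=> 0)) rint_cst. Qed.

Lemma cintD u v : cintegrable u -> cintegrable v ->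
  cint (fun t => u t + v t) = cint u + cint v.
Proof.
move=> [u1 u2] [v1 v2]; apply: eq_ReIm => /=.
  rewrite -[LHS]/(rint _); under eq_fun do rewrite Re_cD; exact: rintD.
rewrite -[LHS]/(rint _); under eq_fun do rewrite Im_cD; exact: rintD.
Qed.

Lemma cintZ c u : cintegrable u -> cint (fun t => c * u t) = c * cint u.
Proof.
move=> [u1 u2]; apply: eq_ReIm.
  rewrite Re_cM /= -[LHS]/(rint _); under eq_fun do rewrite Re_cM.
  by rewrite rintB ?rintZ//; exact: rintegrableZ.
rewrite Im_cM /= -[LHS]/(rint _); under eq_fun do rewrite Im_cM.
by rewrite rintD ?rintZ//; exact: rintegrableZ.
Qed.

Lemma cintN u : cintegrable u -> cint (fun t => - u t) = - cint u.
Proof. by move=> iu; rewrite -mulN1r -cintZ//; under eq_fun do rewrite -mulN1r. Qed.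

Lemma cintB u v : cintegrable u -> cintegrable v ->
  cint (fun t => u t - v t) = cint u - cint v.
Proof. by move=> iu iv; rewrite cintD ?cintN//; exact: cintegrableN. Qed.

Lemma cintJ u : cintegrable u -> cint (cconj u) = conjc (cint u).
Proof.
move=> [u1 u2]; apply: eq_ReIm => /=; rewrite -[LHS]/(rint _) /cconj.
  by under eq_fun do rewrite Re_cJ.
by under eq_fun do rewrite Im_cJ; exact: rintN.
Qed.

Lemma cint_sum (I : Type) (r : seq I) (P : pred I) (F : I -> R -> R[i]) :
  (forall i, P i -> cintegrable (F i)) ->
  cint (fun t => \sum_(i <- r | P i) F i t) = \sum_(i <- r | P i) cint (F i).
Proof.
move=> mF; elim: r => [|i r IH].
  rewrite big_nil -[RHS]/((0 : R)%:C) -[in RHS](rint_cst 0) -cint_real.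
  by apply: eq_cint => t _; rewrite big_nil.
rewrite (_ : (fun t => _) = fun t => if P i then F i t + \sum_(j <- r | P j) F j t
    else \sum_(j <- r | P j) F j t); last by apply/funext => t; rewrite big_cons.
rewrite big_cons; case: (P i) (mF i) => [/(_ isT) Pi|_]; last exact: IH.
by rewrite cintD ?IH//; exact: cintegrable_sum.
Qed.

Lemma Re_cint u : complex.Re (cint u) = rint (fun t => complex.Re (u t)).
Proof. by []. Qed.

Lemma Im_cint u : complex.Im (cint u) = rint (fun t => complex.Im (u t)).
Proof. by []. Qed.

(** With z the integral of u, |z|^2 is the integral of the real part of conj(z) u, hence at most |z|
    times the integral of |u|. *)
Lemma normc_cint u : cintegrable u -> normc (cint u) <= rint (fun t => normc (u t)).
Proof.
move=> iu.
have inu := rintegrable_normc iu.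
have [z0|z0] := eqVneq (normc (cint u)) 0.
  by rewrite z0; apply: rint_ge0 => t _; exact: normc_ge0.
have zp : 0 < normc (cint u) by rewrite lt_def z0 normc_ge0.
rewrite -(ler_pM2l zp) -expr2.
have : normc (cint u) ^+ 2 = complex.Re (cint (fun t => conjc (cint u) * u t)).
  by rewrite cintZ// mulrC mulc_conjc.
move=> ->; rewrite Re_cint -rintZ//.
have [j1 _] := cintegrableZ (conjc (cint u)) iu.
apply: le_rint => //; first exact: rintegrableZ.
move=> t _; apply: le_trans (ler_norm _) _; apply: le_trans (abs_Re_le _) _.
by rewrite normcM normc_conjc.
Qed.

End ComplexIntegral.

#[local] Arguments normc : simpl never.

(** * Inner product and norm of L^2 *)

Section HilbertSpace.
Context {R : realType}.
Implicit Types (u v w : R -> R[i]) (c : R[i]) (h : R -> R).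

Lemma L2P u : L2 u <-> cmeasurable u /\ rintegrable (fun t => normc (u t) ^+ 2).
Proof.
by split=> -[mu iu]; split => //; apply: eq_rintegrable iu => t _; rewrite mulr1.
Qed.

Definition nsq u : R := rint (fun t => normc (u t) ^+ 2).

Lemma nsq_ge0 u : 0 <= nsq u.
Proof. by apply: rint_ge0 => t _; exact: sqr_ge0. Qed.

Lemma norm2E u : norm2 u = Num.sqrt (nsq u).
Proof. by []. Qed.

Lemma norm2_ge0 u : 0 <= norm2 u.
Proof. exact: sqrtr_ge0. Qed.

Lemma sqr_norm2 u : norm2 u ^+ 2 = nsq u.
Proof. by rewrite sqr_sqrtr// nsq_ge0. Qed.

Lemma L2_dom u h : cmeasurable u -> rintegrable h ->
  (forall t, circle R t -> normc (u t) ^+ 2 <= h t) -> L2 u.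
Proof.
move=> mu ih uh; apply/L2P; split => //.
apply: (rintegrable_dom _ ih).
  by under eq_fun do rewrite expr2; apply: rmeasM; exact: rmeas_normc.
by move=> t It; rewrite ger0_norm ?sqr_ge0// uh.
Qed.

Lemma L2_meas u : L2 u -> cmeasurable u.
Proof. by case. Qed.

Lemma L2_sqr u : L2 u -> rintegrable (fun t => normc (u t) ^+ 2).
Proof. by case/L2P. Qed.

Lemma L2_bdd u (M : R) : cmeasurable u -> (forall t, circle R t -> normc (u t) <= M) -> L2 u.
Proof.
move=> mu uM; apply: (L2_dom mu (rintegrable_cst (M ^+ 2))) => t It.
by rewrite lerXn2r ?nnegrE ?normc_ge0 ?uM// (le_trans (normc_ge0 _) (uM _ It)).
Qed.

Lemma L2D u v : L2 u -> L2 v -> L2 (fun t => u t + v t).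
Proof.
move=> hu hv.
apply: (L2_dom (cmeasurableD (L2_meas hu) (L2_meas hv))
  (rintegrableZ 2 (rintegrableD (L2_sqr hu) (L2_sqr hv)))) => t _.
apply: (@le_trans _ _ ((normc (u t) + normc (v t)) ^+ 2)).
  by rewrite lerXn2r ?nnegrE ?addr_ge0 ?normc_ge0 ?normcD_le.
have := sqr_ge0 (normc (u t) - normc (v t)); nra.
Qed.

Lemma L2Mbdd u v (M : R) : cmeasurable v -> L2 u ->
  (forall t, circle R t -> normc (v t) <= M) -> L2 (fun t => v t * u t).
Proof.
move=> mv hu vM.
apply: (L2_dom (cmeasurableM mv (L2_meas hu))
  (rintegrableZ (M ^+ 2) (L2_sqr hu))) => t It.
rewrite normcM exprMn ler_wpM2r ?sqr_ge0//.
by rewrite lerXn2r ?nnegrE ?normc_ge0 ?vM// (le_trans (normc_ge0 _) (vM _ It)).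
Qed.

Lemma L2Z c u : L2 u -> L2 (fun t => c * u t).
Proof.
by move=> hu; apply: (@L2Mbdd u (fun=> c) (normc c)) => //; exact: cmeasurable_cst.
Qed.

Lemma L2N u : L2 u -> L2 (fun t => - u t).
Proof. by move=> /(L2Z (-1)); under eq_fun do rewrite mulN1r. Qed.

Lemma L2B u v : L2 u -> L2 v -> L2 (fun t => u t - v t).
Proof. by move=> hu hv; apply: L2D => //; exact: L2N. Qed.

Lemma L2J u : L2 u -> L2 (cconj u).
Proof.
move=> hu; apply: (L2_dom (cmeasurableJ (L2_meas hu)) (L2_sqr hu)) => t _.
by rewrite /cconj normc_conjc.
Qed.

Lemma L2_cst c : L2 (fun=> c : R[i]).
Proof. by apply: (@L2_bdd _ (normc c)) => //; exact: cmeasurable_cst. Qed.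

Lemma L2_cintM u v : L2 u -> L2 v -> cintegrable (u \* cconj v).
Proof.
move=> hu hv.
apply: (cintegrable_dom (cmeasurableM (L2_meas hu) (cmeasurableJ (L2_meas hv)))
   (rintegrableD (L2_sqr hu) (L2_sqr hv))) => t _.
rewrite /= normcM /cconj normc_conjc.
have := sqr_ge0 (normc (u t) - normc (v t)).
by have := normc_ge0 (u t); have := normc_ge0 (v t); nra.
Qed.

Lemma L2_cint u : L2 u -> cintegrable u.
Proof.
move=> hu; have := L2_cintM hu (L2_cst 1).
by congr cintegrable; apply/funext => t /=; rewrite /cconj conjc1 mulr1.
Qed.

Lemma innerJ u v : L2 u -> L2 v -> inner v u = conjc (inner u v).
Proof.
move=> hu hv; rewrite /inner -cintJ; last exact: L2_cintM.
by apply: eq_cint => t _; rewrite /cconj/= conjcM conjcK mulrC.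
Qed.

Lemma innerDl u v w : L2 u -> L2 v -> L2 w ->
  inner (fun t => u t + v t) w = inner u w + inner v w.
Proof.
move=> hu hv hw; rewrite /inner -cintD; [|exact: L2_cintM..].
by apply: eq_cint => t _ /=; rewrite mulrDl.
Qed.

Lemma innerZl c u w : L2 u -> L2 w -> inner (fun t => c * u t) w = c * inner u w.
Proof.
move=> hu hw; rewrite /inner -cintZ; last exact: L2_cintM.
by apply: eq_cint => t _ /=; rewrite mulrA.
Qed.

Lemma innerBl u v w : L2 u -> L2 v -> L2 w ->
  inner (fun t => u t - v t) w = inner u w - inner v w.
Proof.
move=> hu hv hw; rewrite /inner -cintB; [|exact: L2_cintM..].
by apply: eq_cint => t _ /=; rewrite mulrBl.
Qed.

Lemma innerDr u v w : L2 u -> L2 v -> L2 w ->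
  inner w (fun t => u t + v t) = inner w u + inner w v.
Proof.
move=> hu hv hw; rewrite /inner -cintD; [|exact: L2_cintM..].
by apply: eq_cint => t _ /=; rewrite /cconj conjcD mulrDr.
Qed.

Lemma innerZr c u w : L2 u -> L2 w ->
  inner w (fun t => c * u t) = conjc c * inner w u.
Proof.
move=> hu hw; rewrite /inner -cintZ; last exact: L2_cintM.
by apply: eq_cint => t _ /=; rewrite /cconj conjcM mulrCA.
Qed.

Lemma inner_suml (I : Type) (r : seq I) (P : pred I) (F : I -> R -> R[i]) w :
  (forall i, P i -> L2 (F i)) -> L2 w ->
  inner (fun t => \sum_(i <- r | P i) F i t) w = \sum_(i <- r | P i) inner (F i) w.
Proof.
move=> mF hw; rewrite /inner -cint_sum; last by move=> i Pi; apply: L2_cintM => //; exact: mF.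
by apply: eq_cint => t _ /=; rewrite mulr_suml.
Qed.

Lemma inner_sumr (I : Type) (r : seq I) (P : pred I) (F : I -> R -> R[i]) w :
  (forall i, P i -> L2 (F i)) -> L2 w ->
  inner w (fun t => \sum_(i <- r | P i) F i t) = \sum_(i <- r | P i) inner w (F i).
Proof.
move=> mF hw; rewrite /inner -cint_sum; last by move=> i Pi; apply: L2_cintM => //; exact: mF.
apply: eq_cint => t _ /=; rewrite /cconj -mulr_sumr; congr (_ * _).
exact: rmorph_sum.
Qed.

Lemma eq_inner u u' v v' : (forall t, circle R t -> u t = u' t) ->
  (forall t, circle R t -> v t = v' t) -> inner u v = inner u' v'.
Proof. by move=> uu vv; apply: eq_cint => t It; rewrite /= /cconj uu ?vv. Qed.

Lemma eq_nsq u v : (forall t, circle R t -> normc (u t) = normc (v t)) ->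
  nsq u = nsq v.
Proof. by move=> uv; apply: eq_rint => t It; rewrite uv. Qed.

Lemma eq_norm2 u v : (forall t, circle R t -> normc (u t) = normc (v t)) ->
  norm2 u = norm2 v.
Proof. by move=> uv; congr Num.sqrt; exact: eq_nsq. Qed.

Lemma inner_self u : inner u u = (nsq u)%:C.
Proof. by rewrite -cint_real; apply: eq_cint => t _ /=; rewrite /cconj mulc_conjc. Qed.

Lemma nsqD u v : L2 u -> L2 v ->
  nsq (fun t => u t + v t) = nsq u + nsq v + 2 * complex.Re (inner u v).
Proof.
move=> hu hv; apply: complexI; rewrite -inner_self.
rewrite innerDl ?innerDr//; [|exact: L2D].
rewrite !inner_self (innerJ hu hv); case: (inner u v) => a b.
by apply/eqP; rewrite eq_complex /=; apply/andP; split; apply/eqP; ring.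
Qed.

Lemma nsqZ c u : L2 u -> nsq (fun t => c * u t) = normc c ^+ 2 * nsq u.
Proof.
move=> hu; rewrite -rintZ; last exact: L2_sqr.
by apply: eq_rint => t _; rewrite normcM exprMn.
Qed.

Lemma nsqN u : nsq (fun t => - u t) = nsq u.
Proof. by apply: eq_nsq => t _; rewrite normcN. Qed.

Lemma norm2N u : norm2 (fun t => - u t) = norm2 u.
Proof. by apply: eq_norm2 => t _; rewrite normcN. Qed.

Lemma nsq_eq0 u : L2 u -> nsq u = 0 -> aec (fun t => u t = 0).
Proof.
move=> hu; move=> /(rint_eq0_ae (L2_sqr hu)) => /(_ (fun _ _ => sqr_ge0 _)).
by apply: aec_mono => t _ /eqP; rewrite expf_eq0/= => /eqP /eq0_normc.
Qed.

(** The pointwise inequality 2 |u| |v| <= a |u|^2 + |v|^2 / a, integrated. The free parameter a is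
    what later yields Cauchy-Schwarz. *)
Lemma inner_le u v (a : R) : 0 < a -> L2 u -> L2 v ->
  normc (inner u v) * 2 <= a * nsq u + a^-1 * nsq v.
Proof.
move=> a0 hu hv.
have h1 := rintegrableZ a (L2_sqr hu); have h2 := rintegrableZ a^-1 (L2_sqr hv).
rewrite -!rintZ; [|exact: L2_sqr..]; rewrite -rintD//.
have iuv := L2_cintM hu hv.
apply: (@le_trans _ _ (rint (fun t => 2 * normc ((u \* cconj v) t)))).
  by rewrite mulrC rintZ ?ler_wpM2l ?normc_cint//; exact: rintegrable_normc.
apply: le_rint; first exact/rintegrableZ/rintegrable_normc.
  exact: rintegrableD.
move=> t _ /=; rewrite normcM /cconj normc_conjc.
rewrite -subr_ge0.
have -> : a * normc (u t) ^+ 2 + a^-1 * normc (v t) ^+ 2 -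
   2 * (normc (u t) * normc (v t)) = a * (normc (u t) - a^-1 * normc (v t)) ^+ 2.
  by field; rewrite gt_eqF.
by rewrite mulr_ge0 ?sqr_ge0// ltW.
Qed.

Lemma cauchy_schwarz u v : L2 u -> L2 v ->
  normc (inner u v) <= norm2 u * norm2 v.
Proof.
move=> hu hv; set z := normc _.
have z0 : 0 <= z by exact: normc_ge0.
have [A0|A0] := eqVneq (norm2 u) 0.
  rewrite A0 mul0r leNgt; apply/negP => zp.
  (* With |u| = 0 and this value of a, the bound reads 2 z <= z nsq v / (nsq v + 1), which is less
     than z; so z > 0 is impossible. *)
  have b0 : 0 < (nsq v + 1) / z by rewrite divr_gt0// ltr_wpDl ?nsq_ge0.
  have := inner_le b0 hu hv.
  rewrite -(sqr_norm2 u) A0 expr2 mul0r mulr0 add0r invf_div -/z.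
  have nv := nsq_ge0 v.
  rewrite mulrAC ler_pdivlMr ?ltr_wpDl// => h.
  have : z * (nsq v + 2) <= 0 by nra.
  by rewrite pmulr_rle0//; lra.
have [B0|B0] := eqVneq (norm2 v) 0.
  rewrite B0 mulr0 leNgt; apply/negP => zp.
  have b0 : 0 < z / (nsq u + 1) by rewrite divr_gt0// ltr_wpDl ?nsq_ge0.
  have := inner_le b0 hu hv.
  rewrite -(sqr_norm2 v) B0 expr2 mul0r mulr0 addr0 -/z.
  have nv := nsq_ge0 u.
  rewrite mulrAC ler_pdivlMr ?ltr_wpDl// => h.
  have : z * (nsq u + 2) <= 0 by nra.
  by rewrite pmulr_rle0//; lra.
have Ap : 0 < norm2 u by rewrite lt_def A0 norm2_ge0.
have Bp : 0 < norm2 v by rewrite lt_def B0 norm2_ge0.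
(* The optimal parameter a = |v| / |u| makes both terms equal to |u| |v|. *)
have := inner_le (divr_gt0 Bp Ap) hu hv.
rewrite -!sqr_norm2 invf_div -/z.
have -> : norm2 v / norm2 u * norm2 u ^+ 2 + norm2 u / norm2 v * norm2 v ^+ 2 =
  norm2 u * norm2 v * 2 by field; rewrite A0 B0.
by rewrite ler_pM2r.
Qed.

Lemma norm2D u v : L2 u -> L2 v -> norm2 (fun t => u t + v t) <= norm2 u + norm2 v.
Proof.
move=> hu hv; rewrite -ler_sqr ?nnegrE ?addr_ge0 ?norm2_ge0//.
rewrite sqr_norm2 nsqD// -!sqr_norm2.
have : complex.Re (inner u v) <= norm2 u * norm2 v.
  apply: le_trans (ler_norm _) _; apply: le_trans (abs_Re_le _) _.
  exact: cauchy_schwarz.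
nra.
Qed.

Lemma norm2B u v : L2 u -> L2 v -> norm2 (fun t => u t - v t) <= norm2 u + norm2 v.
Proof. by move=> hu hv; rewrite -(norm2N v); apply: norm2D => //; exact: L2N. Qed.

Lemma norm2Z c u : L2 u -> norm2 (fun t => c * u t) = normc c * norm2 u.
Proof.
move=> hu; rewrite !norm2E nsqZ// sqrtrM ?sqr_ge0// sqrtr_sqr.
by rewrite ger0_norm// normc_ge0.
Qed.

Lemma norm2J u : norm2 (cconj u) = norm2 u.
Proof. by apply: eq_norm2 => t _; rewrite /cconj normc_conjc. Qed.

Lemma norm2_bdd u (M : R) : 0 <= M -> (forall t, circle R t -> normc (u t) <= M) ->
  cmeasurable u -> norm2 u <= M.
Proof.
move=> M0 uM mu; rewrite -ler_sqr ?nnegrE ?norm2_ge0// sqr_norm2.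
rewrite -[leRHS]rint_cst.
apply: le_rint; [exact/L2_sqr/(L2_bdd mu uM)|exact: rintegrable_cst|].
by move=> t It; rewrite lerXn2r ?nnegrE ?normc_ge0 ?uM.
Qed.

Lemma norm2Mbdd u v (M : R) : 0 <= M -> cmeasurable v -> L2 u ->
  (forall t, circle R t -> normc (v t) <= M) ->
  norm2 (fun t => v t * u t) <= M * norm2 u.
Proof.
move=> M0 mv hu vM; rewrite -ler_sqr ?nnegrE ?mulr_ge0 ?norm2_ge0//.
rewrite sqr_norm2 exprMn sqr_norm2 -rintZ; last exact: L2_sqr.
apply: le_rint; [exact: (L2_sqr (L2Mbdd mv hu vM))|exact/rintegrableZ/L2_sqr|].
move=> t It; rewrite normcM exprMn ler_wpM2r ?sqr_ge0//.
by rewrite lerXn2r ?nnegrE ?normc_ge0 ?vM.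
Qed.

End HilbertSpace.

(** * Exponentials and the Poisson kernel *)

Section Exponentials.
Context {R : realType}.
Implicit Types (z w : R[i]) (s t a : R) (m n : int).

Lemma cexpD z w : cexp (z + w) = cexp z * cexp w.
Proof.
case: z => a b; case: w => c d; rewrite /cexp/= expRD cosD sinD.
by apply/eqP; rewrite eq_complex/=; apply/andP; split; apply/eqP; ring.
Qed.

Lemma cexp0 : cexp (0 : R[i]) = 1.
Proof.
rewrite /cexp/= expR0 cos0 sin0.
by apply/eqP; rewrite eq_complex/=; apply/andP; split; apply/eqP; ring.
Qed.

Lemma normc_cexp z : normc (cexp z) = expR (complex.Re z).
Proof.
rewrite /cexp normcM normc_real ger0_norm ?expR_ge0//.
by rewrite /normc/= cos2Dsin2 sqrtr1 mulr1.
Qed.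

Lemma cexp_real a : cexp a%:C = (expR a)%:C.
Proof.
rewrite /cexp/= cos0 sin0.
by apply/eqP; rewrite eq_complex/=; apply/andP; split; apply/eqP; ring.
Qed.

Lemma cexpMn z (k : nat) : cexp (z *+ k) = cexp z ^+ k.
Proof. by elim: k => [|k IH]; rewrite ?mulr0n ?cexp0// mulrS cexpD exprS IH. Qed.

Lemma efunE n t : efun n t = cos (2 * pi * n%:~R * t) +i* sin (2 * pi * n%:~R * t).
Proof.
rewrite /efun /cexp/= expR0.
by apply/eqP; rewrite eq_complex/=; apply/andP; split; apply/eqP; ring.
Qed.

Lemma efunD m n t : efun (m + n) t = efun m t * efun n t.
Proof.
rewrite /efun -cexpD; congr cexp.
by apply/eqP; rewrite eq_complex/= intrD; apply/andP; split; apply/eqP; ring.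
Qed.

Lemma efun0 t : efun 0 t = 1 :> R[i].
Proof. by rewrite efunE mulr0 mul0r cos0 sin0. Qed.

Lemma efunN n t : efun (- n) t = conjc (efun n t) :> R[i].
Proof. by rewrite !efunE/= intrN mulrN mulNr cosN sinN. Qed.

Lemma normc_efun n t : normc (efun n t : R[i]) = 1.
Proof. by rewrite /efun normc_cexp expR0. Qed.

Lemma efunX (k : nat) t : efun 1 t ^+ k = efun k%:Z t :> R[i].
Proof.
elim: k => [|k IH]; first by rewrite efun0.
by rewrite exprS IH -efunD -[in RHS](add1n k).
Qed.

Lemma efun_conjM n t : efun n t * conjc (efun n t) = 1 :> R[i].
Proof. by rewrite mulc_conjc normc_efun expr1n. Qed.

Lemma cmeasurable_efun n : cmeasurable (efun n : R -> R[i]).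
Proof.
have mid : rmeas (fun t : R => 2 * pi * n%:~R * t) by exact: measurable_funM.
split; under eq_fun do rewrite efunE/=.
  by apply: rmeas_comp => //; exact: continuous_cos.
by apply: rmeas_comp => //; exact: continuous_sin.
Qed.

Lemma L2_efun n : L2 (efun n : R -> R[i]).
Proof.
apply: (@L2_bdd _ _ 1); first exact: cmeasurable_efun.
by move=> t _; rewrite normc_efun.
Qed.

Lemma rint_FTC (h F : R -> R) : continuous h ->
  (forall x : R, is_derive x 1 F (h x)) -> rint h = F 1 - F 0.
Proof.
move=> ch dF.
have cF : continuous F.
  by move=> x; apply/differentiable_continuous/derivable1_diffP; have [] := dF x.
(* The circle is half-open; adding the null point 1 gives the segment on which the fundamental
   theorem of calculus is applied. *)
rewrite /rint Rintegral_itv_bndo_bndc; last first.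
  have : lebesgue_measure.-integrable `[0, 1]%classic (EFin \o h).
    apply: continuous_compact_integrable; first exact: segment_compact.
    exact: continuous_subspaceT.
  apply: integrableS => //; exact: subset_itv_co_cc.
rewrite /Rintegral (@continuous_FTC2 _ h F)//.
- exact: continuous_subspaceT.
- split.
  + by move=> x _; have [] := dF x.
  + by apply: cvg_at_right_filter; exact: cF.
  + by apply: cvg_at_left_filter; exact: cF.
- by move=> x _; rewrite derive1E; exact: derive_val.
Qed.

Lemma efun_at1 n : efun n 1 = 1 :> R[i].
Proof.
have h : efun 1 1 = 1 :> R[i].
  by rewrite efunE !mulr1 mulrC mulr_natr cos2pi sin2pi.
have hk k : efun (Posz k) 1 = 1 :> R[i] by rewrite -efunX h expr1n.
case: n => k; first exact: hk.
by rewrite NegzE efunN hk conjc1.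
Qed.

Lemma cint_efun n : cint (efun n : R -> R[i]) = (n == 0)%:R.
Proof.
have [->|n0] := eqVneq n 0.
  rewrite (eq_cint (v := fun=> (1:R)%:C)); first by rewrite cint_real rint_cst.
  by move=> t _; rewrite efun0.
have c0 : 2 * pi * n%:~R != 0 :> R.
  by rewrite !mulf_neq0 ?intr_eq0// gt_eqF// pi_gt0.
set c := 2 * pi * n%:~R in c0 *.
have [c1 s1] : cos c = 1 /\ sin c = 0.
  have := efun_at1 n; rewrite efunE mulr1 -/c => -[-> ->] //.
have ds (x : R) : is_derive x 1 (fun t : R => c^-1 * sin (c * t)) (cos (c * x)).
  apply: is_derive_eq.
  by rewrite -[_%:A]/(c * 1) mulr1 -[_ *: _]/(_ * _) mulrCA mulVf// mulr1.
have dc (x : R) : is_derive x 1 (fun t : R => - c^-1 * cos (c * t)) (sin (c * x)).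
  apply: is_derive_eq.
  by rewrite -[_%:A]/(c * 1) -[_ *: _]/(_ * _); field.
have cl : continuous (fun t : R => c * t) by exact: mulrl_continuous.
apply: eq_ReIm.
  rewrite Re_cint; under eq_fun do rewrite efunE/= -/c.
  rewrite (@rint_FTC _ (fun t => c^-1 * sin (c * t)))//.
    by rewrite mulr1 mulr0 sin0 s1 mulr0 subrr.
  by move=> x; apply: continuous_comp; [exact: cl|exact: continuous_cos].
rewrite Im_cint; under eq_fun do rewrite efunE/= -/c.
rewrite (@rint_FTC _ (fun t => - c^-1 * cos (c * t)))//.
  by rewrite mulr1 mulr0 cos0 c1 subrr.
by move=> x; apply: continuous_comp; [exact: cl|exact: continuous_sin].
Qed.

End Exponentials.

#[local] Arguments efun : simpl never.

(** * The Herglotz kernel, its real part and its expansion *)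

Section Poisson.
Context {R : realType}.
Implicit Types (s t x : R) (v : R -> R).

Lemma efunDr (n : int) s t : efun n (s + t) = efun n s * efun n t :> R[i].
Proof.
rewrite /efun -cexpD; congr cexp.
by apply/eqP; rewrite eq_complex/= mulrDr addr0 !eqxx.
Qed.

Lemma efunNr (n : int) t : efun n (- t) = conjc (efun n t) :> R[i].
Proof. by rewrite !efunE/= mulrN cosN sinN. Qed.

(** This is |1 - r e^{2 pi i x}|^2, arranged so that the lower bound (1 - r)^2 is visible. *)
Definition pden (r x : R) : R := (1 - r) ^+ 2 + 2 * r * (1 - cos (2 * pi * x)).
Definition poisson (r x : R) : R := (1 - r ^+ 2) / pden r x.
(** The conjugate Poisson kernel; the sign is due to its evaluation at [s - t] instead of
    [t - s]. *)
Definition cpoisson (r x : R) : R := - (2 * r * sin (2 * pi * x)) / pden r x.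

(** The Herglotz kernel (e_1(s) + z) / (e_1(s) - z) at the point z = r e_1(t). *)
Definition hker (r s t : R) : R[i] :=
  (efun 1 s + r%:C * efun 1 t) / (efun 1 s - r%:C * efun 1 t).

Lemma exists_geom_lt (r A e : R) : 0 <= r < 1 -> 0 < e ->
  exists N : nat, A * r ^+ N.+1 < e.
Proof.
move=> /andP[r0 r1] e0.
have c : (A * r ^+ n) @[n --> \oo] --> A * 0.
  by apply: cvgMr; apply: cvg_expr; rewrite ger0_norm.
rewrite mulr0 in c.
move/cvgrPdist_lt : c => /(_ _ e0) [N _ /(_ N.+1 (leqnSn N))] /=.
by rewrite sub0r normrN => /(le_lt_trans (ler_norm _)); exists N.
Qed.

Section fixed_radius.
Variable r : R.
Hypothesis r01 : 0 <= r < 1.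

Let r0 : 0 <= r. Proof. by case/andP: r01. Qed.
Let r1 : 0 < 1 - r. Proof. by case/andP: r01 => _; rewrite subr_gt0. Qed.

Lemma pden_ge x : (1 - r) ^+ 2 <= pden r x.
Proof. by rewrite /pden lerDl !mulr_ge0// subr_ge0 cos_le1. Qed.

Lemma pden_gt0 x : 0 < pden r x.
Proof. by apply: lt_le_trans (pden_ge x); rewrite exprn_gt0. Qed.

Lemma poisson_ge0 x : 0 <= poisson r x.
Proof.
rewrite divr_ge0 ?(ltW (pden_gt0 x))//.
by have := r0; have := r1; nra.
Qed.

Lemma poisson_le x : poisson r x <= (1 - r ^+ 2) / (1 - r) ^+ 2.
Proof.
rewrite ler_wpM2l//; first by have := r0; have := r1; nra.
by rewrite lef_pV2 ?pden_ge// posrE ?pden_gt0// exprn_gt0.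
Qed.

Lemma poissonN x : poisson r (- x) = poisson r x.
Proof. by rewrite /poisson /pden mulrN cosN. Qed.

Lemma continuous_pden : continuous (pden r).
Proof.
have cl : continuous (fun t : R => 2 * pi * t) by exact: mulrl_continuous.
move=> x; apply: cvgD; first exact: cvg_cst.
apply: cvgMr; apply: cvgB; first exact: cvg_cst.
by apply: continuous_comp; [exact: cl|exact: continuous_cos].
Qed.

Lemma continuous_poisson : continuous (poisson r).
Proof.
move=> x; apply: cvgMr; apply: cvgV; first by rewrite gt_eqF// pden_gt0.
exact: continuous_pden.
Qed.

Lemma continuous_cpoisson : continuous (cpoisson r).
Proof.
have cl : continuous (fun t : R => 2 * pi * t) by exact: mulrl_continuous.
move=> x; apply: cvgM; last first.
  apply: cvgV; first by rewrite gt_eqF// pden_gt0.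
  exact: continuous_pden.
apply: cvgN; apply: cvgMr.
by apply: continuous_comp; [exact: cl|exact: continuous_sin].
Qed.

Let normc_re t : normc (r%:C * efun 1 t) = r.
Proof. by rewrite normcM normc_efun normc_real mulr1 ger0_norm. Qed.

Let den_ge t : 1 - r <= normc (1 - r%:C * efun 1 t).
Proof.
rewrite lerBlDr -[leLHS](normc1 R) -{2}(normc_re t).
by apply: le_trans (normcD_le _ _); rewrite subrK.
Qed.

Let den_neq0 t : 1 - r%:C * efun 1 t != 0.
Proof.
apply/eqP => h; have := den_ge t; rewrite h normc0.
by have := r1; rewrite ltNge => /negP.
Qed.

Lemma hker_moebius s t :
  hker r s t = (1 + r%:C * efun 1 (t - s)) / (1 - r%:C * efun 1 (t - s)).
Proof.
have e0 : efun 1 s != 0 :> R[i].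
  by apply/eqP => h; have := normc_efun 1 s; rewrite h normc0 => /eqP; rewrite eq_sym oner_eq0.
have E : efun 1 t = efun 1 s * efun 1 (t - s) :> R[i] by rewrite -efunDr addrC subrK.
rewrite /hker E.
have -> : efun 1 s + r%:C * (efun 1 s * efun 1 (t - s)) =
  efun 1 s * (1 + r%:C * efun 1 (t - s)) by ring.
have -> : efun 1 s - r%:C * (efun 1 s * efun 1 (t - s)) =
  efun 1 s * (1 - r%:C * efun 1 (t - s)) by ring.
by rewrite -mulf_div divff// mul1r.
Qed.

Lemma hkerE s t : hker r s t = poisson r (s - t) +i* cpoisson r (s - t).
Proof.
rewrite hker_moebius -(opprB s t) efunNr; set x := s - t.
have d0 : 1 - r%:C * conjc (efun 1 x) != 0 by rewrite -efunNr.
apply: (mulIf d0); rewrite divfK//.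
have p0 := gt_eqF (pden_gt0 x).
rewrite /poisson /cpoisson efunE mulr1.
have cs := cos2Dsin2 (2 * pi * x).
rewrite /pden in p0 *.
set c := cos _ in cs p0 *; set sn := sin _ in cs *.
have sE : sn ^+ 2 = 1 - c ^+ 2 by rewrite -cs addrC addKr.
apply: eq_ReIm => /=.
  by field: sE; rewrite p0.
by field: sE; rewrite p0.
Qed.

Lemma cmeasurable_hker t : cmeasurable (fun s => hker r s t).
Proof.
split; under eq_fun do rewrite hkerE//=.
  exact: continuous_rmeas continuous_poisson.
exact: continuous_rmeas continuous_cpoisson.
Qed.

Lemma normc_hker s t : normc (hker r s t) <= 2 / (1 - r).
Proof.
rewrite hker_moebius normcM normcV ler_pM ?invr_ge0 ?normc_ge0//.
  apply: le_trans (normcD_le _ _) _; rewrite normc_re normc1.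
  by rewrite -[2]/(1 + 1) lerD2l ltW// -subr_gt0.
by rewrite lef_pV2 ?den_ge// posrE// (lt_le_trans r1)// den_ge.
Qed.

(** The Herglotz integral of v at r e_1(t): for v = log f, the exponential of its half is Phi_f(r
    e_1(t)). *)
Definition herg v (t : R) : R[i] := cint (fun s => hker r s t * (v s)%:C).

Lemma cintegrable_herg v t : rintegrable v ->
  cintegrable (fun s => hker r s t * (v s)%:C).
Proof.
move=> iv; apply: (@cintegrableMbdd _ _ (fun s => hker r s t) (2 / (1 - r))).
- exact: cmeasurable_hker.
- exact: cintegrable_real.
- by move=> s _; exact: normc_hker.
Qed.

Lemma Re_herg v t : complex.Re (herg v t) = kconv (poisson r) v t.
Proof.
rewrite Re_cint; apply: eq_rint => s _.
by rewrite hkerE/= mulr0 subr0.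
Qed.

(* Expansion of the kernel: (1 + z) / (1 - z) = 1 + 2 z + 2 z^2 + ... with
   z = r e(t - s). *)
Definition herg_coef v (n : nat) : R[i] :=
  (if n == 0%N then 1 else 2) * r%:C ^+ n * cint (fun s => (v s)%:C * conjc (efun n%:Z s)).

Definition herg_sum v (N : nat) (t : R) : R[i] :=
  \sum_(n < N.+1) herg_coef v n * efun (n : nat)%:Z t.

Let hker_sum (N : nat) (s t : R) : R[i] :=
  \sum_(n < N.+1) ((if n == 0%N :> nat then 1 else 2) * r%:C ^+ n) *
     (efun (n : nat)%:Z t * conjc (efun (n : nat)%:Z s)).

(** The sum is 2 (1 + z + ... + z^N) - 1 with z = r e_1(t - s), so the remainder is exactly 2
    z^{N+1} / (1 - z), bounded uniformly in s and t. *)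
Let hker_sum_err N s t :
  normc (hker r s t - hker_sum N s t) <= 2 / (1 - r) * r ^+ N.+1.
Proof.
set z := r%:C * efun 1 (t - s).
have zX n : r%:C ^+ n * (efun n%:Z t * conjc (efun n%:Z s)) = z ^+ n.
  by rewrite /z exprMn efunX efunDr efunNr.
have -> : hker_sum N s t = 2 * (\sum_(n < N.+1) z ^+ n) - 1.
  rewrite /hker_sum big_ord_recl [in RHS]big_ord_recl.
  have -> : 2 * (z ^+ @ord0 N + \sum_(i < N) z ^+ lift ord0 i) - 1 =
    1 + \sum_(i < N) 2 * z ^+ lift ord0 i by rewrite -mulr_sumr expr0; ring.
  congr (_ + _); first by rewrite -mulrA zX expr0 mulr1.
  by apply: eq_bigr => n _ /=; rewrite -mulrA zX.
have d0 : 1 - z != 0 by exact: den_neq0.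
have gs : \sum_(n < N.+1) z ^+ n = (1 - z ^+ N.+1) / (1 - z).
  apply: (mulIf d0); rewrite divfK// mulrC -opprB mulNr -subrX1 opprB//.
have -> : hker r s t - (2 * \sum_(n < N.+1) z ^+ n - 1) = 2 / (1 - z) * z ^+ N.+1.
  by rewrite hker_moebius -/z gs; field.
rewrite !normcM normcX normcV normc_re ler_wpM2r ?exprn_ge0//.
have -> : normc (2 : R[i]) = 2.
  by rewrite -[2]/(2%:R) -(rmorph_nat (real_complex R)) normc_real ger0_norm.
by rewrite ler_wpM2l// lef_pV2 ?den_ge// posrE// (lt_le_trans r1)// den_ge.
Qed.

Lemma herg_err v N t : rintegrable v ->
  normc (herg v t - herg_sum v N t) <=
    2 / (1 - r) * rint (fun s => `|v s|) * r ^+ N.+1.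
Proof.
move=> iv.
have icn n c : cintegrable (fun s => c * ((v s)%:C * conjc (efun n%:Z s))).
  apply: cintegrableZ.
  have := @cintegrableMbdd _ _ _ 1 (cmeasurableJ (cmeasurable_efun n%:Z))
    (cintegrable_real iv).
  have h : forall t : R, circle R t -> normc (cconj (efun n%:Z) t : R[i]) <= 1.
    by move=> ? _; rewrite normc_conjc normc_efun.
  by move=> /(_ h); congr cintegrable; apply/funext => s; rewrite /= mulrC.
have sE s : hker_sum N s t * (v s)%:C = \sum_(n < N.+1)
    ((if n == 0%N :> nat then 1 else 2) * r%:C ^+ n * efun (n : nat)%:Z t) *
    ((v s)%:C * conjc (efun (n : nat)%:Z s)).
  by rewrite mulr_suml; apply: eq_bigr => n _; ring.
have -> : herg_sum v N t = cint (fun s => hker_sum N s t * (v s)%:C).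
  under [in RHS]eq_fun do rewrite sE.
  rewrite cint_sum; last by move=> n _; exact: icn.
  apply: eq_bigr => n _; rewrite cintZ; last first.
    by have := icn n 1; congr cintegrable; apply/funext => s; rewrite mul1r.
  by rewrite /herg_coef; ring.
have ih := cintegrable_herg t iv.
have isu : cintegrable (fun s => hker_sum N s t * (v s)%:C).
  under eq_fun do rewrite sE.
  by apply: cintegrable_sum => n _; exact: icn.
rewrite -cintB//; apply: le_trans (normc_cint _) _.
  exact: (cintegrableD ih (cintegrableN isu)).
rewrite mulrAC -rintZ; last exact: rintegrable_abs.
apply: le_rint.
- exact: (rintegrable_normc (cintegrableD ih (cintegrableN isu))).
- exact/rintegrableZ/rintegrable_abs.
- move=> s _; rewrite -mulrBl normcM normc_real ler_wpM2r//.
Qed.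

Lemma herg_coef0 v : herg_coef v 0 = (rint v)%:C.
Proof.
rewrite /herg_coef eqxx expr0 !mul1r -cint_real; apply: eq_cint => s _.
by rewrite (efun0 s : efun (Posz 0) s = 1) conjc1 mulr1.
Qed.

(** For v = 1 all Herglotz coefficients but the zeroth vanish, so every partial sum equals 1; the
    remainder estimate passes this to the Herglotz integral, whose real part is the integral in
    question. *)
Lemma poisson_mean t : rint (fun s => poisson r (s - t)) = 1.
Proof.
have i1 : rintegrable (fun=> 1 : R) by exact: rintegrable_cst.
have sE N : herg_sum (fun=> 1) N t = 1.
  rewrite /herg_sum big_ord_recl /= herg_coef0 rint_cst efun0 mulr1.
  rewrite big1 ?addr0// => n _; rewrite /herg_coef/=.
  rewrite (eq_cint (v := efun (- (lift ord0 n : nat)%:Z))); last first.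
    by move=> s _; rewrite mul1r efunN.
  by rewrite cint_efun mulr0 mul0r.
have h1 : herg (fun=> 1) t = 1.
  apply/eqP; rewrite -subr_eq0; apply/eqP/eq0_normc/eqP.
  rewrite eq_le normc_ge0 andbT leNgt; apply/negP => h0.
  have [N] := exists_geom_lt (2 / (1 - r) * rint (fun=> `|1 : R|)) r01 h0.
  by rewrite ltNge -(sE N) herg_err.
have := Re_herg (fun=> 1) t; rewrite h1 /= => ->.
by apply: eq_rint => s _; rewrite mulr1.
Qed.

End fixed_radius.
End Poisson.

#[local] Arguments cexp : simpl never.

(** * The Poisson kernel as an approximate identity *)

Section PoissonApprox.
Context {R : realType}.
Implicit Types (s t x : R) (h c : R -> R).

(** The shift by 2 keeps the radius at least 1/2, so that 2 r >= 1 when [pden] is bounded below away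
    from the pole. *)
Definition radius (m : nat) : R := 1 - m.+2%:R^-1.

Lemma radius_ge m : 2^-1 <= radius m.
Proof.
rewrite /radius lerBrDr -lerBrDl.
have -> : 1 - 2^-1 = 2^-1 :> R by field.
by rewrite lef_pV2 ?posrE// ler_nat.
Qed.

Lemma radius_lt1 m : radius m < 1.
Proof. by rewrite /radius ltrBlDr ltrDl invr_gt0. Qed.

Lemma radius01 m : 0 <= radius m < 1.
Proof. by rewrite radius_lt1 andbT (le_trans _ (radius_ge m))// invr_ge0. Qed.

Lemma cvg_radius : radius m @[m --> \oo] --> (1 : R).
Proof.
rewrite -[X in _ --> X](subr0 1); apply: cvgB; first exact: cvg_cst.
by have := @cvg_harmonic R; rewrite -(cvg_shiftS).
Qed.

Definition pconv (m : nat) h (t : R) : R := kconv (poisson (radius m)) h t.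

Let P_ge0 m x : 0 <= poisson (radius m) x.
Proof. exact: poisson_ge0 (radius01 m) x. Qed.
Let P_le m x : poisson (radius m) x <= (1 - radius m ^+ 2) / (1 - radius m) ^+ 2.
Proof. exact: poisson_le (radius01 m) x. Qed.
Let P_cont m : continuous (poisson (radius m)).
Proof. exact: continuous_poisson (radius01 m). Qed.
Let P_abs m x : `|poisson (radius m) x| <= (1 - radius m ^+ 2) / (1 - radius m) ^+ 2.
Proof. by rewrite ger0_norm. Qed.

Lemma rintegrable_poisson m t h : rintegrable h ->
  rintegrable (fun s => poisson (radius m) (s - t) * h s).
Proof. by move=> ih; exact: (rintegrable_kconv t (@P_cont m) (P_abs m) ih). Qed.

Lemma rmeas_pconv m h : rintegrable h -> rmeas (pconv m h).
Proof. by move=> ih; exact: (rmeas_kconv (@P_cont m) (P_ge0 m) (P_le m) ih). Qed.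

Lemma rintegrableMpconv m a h : rintegrable a -> rintegrable h ->
  rintegrable (fun t => a t * pconv m h t).
Proof. by move=> ia ih; exact: (rintegrableMkconv (@P_cont m) (P_ge0 m) (P_le m)). Qed.

Lemma rintegrable_pconv m h : rintegrable h -> rintegrable (pconv m h).
Proof.
move=> ih; apply: eq_rintegrable (rintegrableMpconv m (rintegrable_cst 1) ih).
by move=> t _; rewrite mul1r.
Qed.

Lemma pconv_cst m a t : pconv m (fun=> a) t = a.
Proof.
rewrite /pconv /kconv; under eq_fun do rewrite mulrC.
rewrite rintZ; first by rewrite (poisson_mean (radius01 m)) mulr1.
apply: eq_rintegrable (rintegrable_poisson m t (rintegrable_cst 1)).
by move=> s _; rewrite mulr1.
Qed.

Lemma pconv_sym m a b : rintegrable a -> rintegrable b ->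
  (forall t, circle R t -> 0 <= a t) -> (forall t, circle R t -> 0 <= b t) ->
  rint (fun t => a t * pconv m b t) = rint (fun t => b t * pconv m a t).
Proof.
by move=> *; apply: (kconv_sym (@P_cont m) (P_ge0 m) (P_le m)) => // x;
  exact: poissonN.
Qed.

(** Symmetry of the kernel against the constant 1, which Poisson integration fixes. *)
Lemma rint_pconv m b : rintegrable b -> (forall t, circle R t -> 0 <= b t) ->
  rint (pconv m b) = rint b.
Proof.
move=> ib b0.
rewrite (eq_rint (g := fun t => 1 * pconv m b t)); last by move=> t _; rewrite mul1r.
rewrite pconv_sym//; first by apply: eq_rint => t _; rewrite pconv_cst mulr1.
exact: rintegrable_cst.
Qed.

Lemma pconvD m a b t : rintegrable a -> rintegrable b ->
  pconv m (fun s => a s + b s) t = pconv m a t + pconv m b t.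
Proof.
move=> ia ib; rewrite /pconv /kconv -rintD; [|exact: rintegrable_poisson..].
by apply: eq_rint => s _; rewrite mulrDr.
Qed.

Lemma pconvB m a b t : rintegrable a -> rintegrable b ->
  pconv m (fun s => a s - b s) t = pconv m a t - pconv m b t.
Proof.
move=> ia ib; rewrite /pconv /kconv -rintB; [|exact: rintegrable_poisson..].
by apply: eq_rint => s _; rewrite mulrBr.
Qed.

Lemma le_pconv m a b t : rintegrable a -> rintegrable b ->
  (forall t, circle R t -> a t <= b t) -> pconv m a t <= pconv m b t.
Proof.
move=> ia ib ab; apply: le_rint; [exact: rintegrable_poisson..|].
by move=> s Is; rewrite ler_wpM2l// ab.
Qed.

Lemma pconv_abs m h t : rintegrable h -> `|pconv m h t| <= pconv m (fun s => `|h s|) t.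
Proof.
move=> ih; apply: le_trans (le_abs_rint _) _; first exact: rintegrable_poisson.
by rewrite le_eqVlt; apply/orP; left; apply/eqP/eq_rint => s _; rewrite normrM ger0_norm.
Qed.

Lemma pconv_contract m h : rintegrable h ->
  rint (fun t => `|pconv m h t|) <= rint (fun t => `|h t|).
Proof.
move=> ih; rewrite -(rint_pconv m (rintegrable_abs ih))//.
apply: le_rint; [exact/rintegrable_abs/rintegrable_pconv|
  exact/rintegrable_pconv/rintegrable_abs|].
by move=> t _; exact: pconv_abs.
Qed.

(** The cosine decreases over half a period, and x -> 1 - x folds the other half onto it. *)
Lemma cos_away (d x : R) : 0 < d -> d <= x -> x <= 1 - d ->
  cos (2 * pi * x) <= cos (2 * pi * d).
Proof.
have p0 := @pi_gt0 R.
move=> d0 dx xd.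
have key y : d <= y -> y <= 2^-1 -> cos (2 * pi * y) <= cos (2 * pi * d).
  move=> dy y2; rewrite le_eqVlt; have [->|] := eqVneq y d; first by rewrite eqxx.
  move=> yd; rewrite ltr_cos ?in_itv/= ?orbT//.
  - by rewrite ltr_pM2l ?mulr_gt0// lt_def yd dy orbT.
  - by apply/andP; split; nra.
  - by apply/andP; split; nra.
have [x2|x2] := leP x 2^-1; first exact: key.
have -> : cos (2 * pi * x) = cos (2 * pi * (1 - x)).
  rewrite -cosN -(cosD2pi (- _)); congr cos; rewrite -mulr_natl; ring.
by apply: key; lra.
Qed.

Lemma cos_lt1 (d : R) : 0 < d -> d <= 2^-1 -> cos (2 * pi * d) < 1.
Proof.
have p0 := @pi_gt0 R.
move=> d0 d2; rewrite -[ltRHS]cos0 ltr_cos ?in_itv/=; first by rewrite !mulr_gt0.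
  by apply/andP; split; nra.
by apply/andP; split; nra.
Qed.

(** Near t the continuity of c is used, away from t the kernel is O(1 - r^2). The endpoint t = 0 is
    left out because c is not periodic: the values of c near 1 would count there as well. *)
Lemma poisson_cvg_pt c (M t : R) : continuous c ->
  (forall s, circle R s -> `|c s| <= M) -> 0 < t < 1 ->
  pconv m c t @[m --> \oo] --> c t.
Proof.
move=> cc cM /andP[t0 t1].
have mc : rmeas c by apply: measurable_funTS; exact: continuous_measurable_fun.
have ic : rintegrable c by exact: (rintegrable_bdd mc cM).
have It : circle R t by rewrite /circle/= in_itv/= (ltW t0) t1.
have M0 : 0 <= M by exact: le_trans (normr_ge0 _) (cM _ It).
apply/cvgrPdist_le => e e0.
have /cvgrPdist_le/(_ (e / 2)) := cc t.
rewrite divr_gt0// => /(_ isT) [d /= d0 dP].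
(* The bounds by t and 1 - t give |s - t| <= 1 - d' for every s of the circle, as [cos_away]
   requires. *)
pose d' := Num.min (d / 2) (Num.min t (1 - t)).
have d'0 : 0 < d' by rewrite !lt_min t0 subr_gt0 t1 divr_gt0.
have d't : d' <= t by rewrite !ge_min lexx orbT.
have d't1 : d' <= 1 - t by rewrite !ge_min lexx !orbT.
have d'd : d' < d.
  by apply: (@le_lt_trans _ _ (d / 2)); [rewrite ge_min lexx|lra].
pose K := 1 - cos (2 * pi * d').
have K0 : 0 < K by rewrite subr_gt0 cos_lt1//; lra.
have far s : circle R s -> d' <= `|s - t| -> K <= 1 - cos (2 * pi * (s - t)).
  rewrite /circle/= in_itv/= => /andP[s0 s1] ds.
  rewrite /K lerD2l lerN2.
  have -> : cos (2 * pi * (s - t)) = cos (2 * pi * `|s - t|).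
    by case: (ger0P (s - t)) => // _; rewrite mulrN cosN.
  apply: cos_away => //.
  by case: (ger0P (s - t)) => _; lra.
have bound m s : circle R s -> poisson (radius m) (s - t) * `|c s - c t| <=
    e / 2 * poisson (radius m) (s - t) + 2 * M * ((1 - radius m ^+ 2) / K).
  move=> Is; have p0 := P_ge0 m (s - t).
  have rr : 0 <= 1 - radius m ^+ 2.
    by have /andP[? ?] := radius01 m; nra.
  have [ds|ds] := leP d' `|s - t|.
    have h1 : `|c s - c t| <= 2 * M.
      apply: le_trans (ler_normB _ _) _.
      by have := cM _ Is; have := cM _ It; lra.
    have h2 : poisson (radius m) (s - t) <= (1 - radius m ^+ 2) / K.
      rewrite ler_wpM2l// lef_pV2 ?posrE// ?(pden_gt0 (radius01 m))//.
      rewrite /pden; have := far _ Is ds; have := radius_ge m.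
      have := sqr_ge0 (1 - radius m); move: (1 - cos _) => z; nra.
    apply: (@le_trans _ _ (2 * M * ((1 - radius m ^+ 2) / K))).
      by rewrite mulrC ler_pM.
    by rewrite lerDr mulr_ge0// divr_ge0// ltW.
  have h1 : `|c s - c t| <= e / 2.
    by rewrite distrC; apply: dP => /=; rewrite distrC (lt_trans ds).
  apply: (@le_trans _ _ (e / 2 * poisson (radius m) (s - t))).
    by rewrite mulrC ler_wpM2r.
  by rewrite lerDl !mulr_ge0// invr_ge0 ltW.
have ip m : rintegrable (fun s => poisson (radius m) (s - t)).
  apply: eq_rintegrable (rintegrable_poisson m t (rintegrable_cst 1)).
  by move=> s _; rewrite mulr1.
have main m : `|c t - pconv m c t| <= e / 2 + 2 * M * ((1 - radius m ^+ 2) / K).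
  rewrite -[in leLHS](pconv_cst m (c t) t) distrC -pconvB//; last exact: rintegrable_cst.
  have icc : rintegrable (fun s => c s - c t).
    by apply: rintegrableB => //; exact: rintegrable_cst.
  apply: le_trans (pconv_abs _ _ icc) _.
  apply: (@le_trans _ _ (rint (fun s => e / 2 * poisson (radius m) (s - t) +
      2 * M * ((1 - radius m ^+ 2) / K)))).
    apply: le_rint.
    - exact/rintegrable_poisson/rintegrable_abs.
    - by apply: rintegrableD; [exact: rintegrableZ|exact: rintegrable_cst].
    - by move=> s Is; exact: bound.
  rewrite rintD; [|exact: rintegrableZ|exact: rintegrable_cst].
  by rewrite (rintZ (e / 2) (ip m)) (poisson_mean (radius01 m)) mulr1 rint_cst.
have : (2 * M * ((1 - radius m ^+ 2) / K)) @[m --> \oo] --> (2 * M * ((1 - 1 ^+ 2) / K)).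
  apply: cvgMr; apply: cvgMl; apply: cvgB; first exact: cvg_cst.
  exact: (cvgM cvg_radius cvg_radius).
rewrite expr1n subrr mul0r mulr0 => /cvgrPdist_le /(_ (e / 2)).
rewrite divr_gt0// => /(_ isT); apply: filterS => m; rewrite sub0r normrN => h.
apply: le_trans (main m) _; apply: (@le_trans _ _ (e / 2 + e / 2)); last by lra.
by rewrite lerD2l; apply: le_trans h; exact: ler_norm.
Qed.

(** Approximation of h in L^1 by a continuous c: Poisson integration contracts the L^1 norm, so h -
    c costs at most e/3 twice, and for c pointwise convergence is dominated by a constant. *)
Lemma poisson_L1 h : rintegrable h ->
  rint (fun t => `|pconv m h t - h t|) @[m --> \oo] --> (0 : R).
Proof.
move=> ih; apply/cvgrPdist_le => e e0.
have muI : (lebesgue_measure (circle R) < +oo)%E.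
  by rewrite [X in (X < _)%E]lebesgue_circle ltry.
have [g [cg ig /fine_cvgP [_ gh]]] := @approximation_continuous_integrable R
  (circle R) h measurable_circle muI ih.
move/cvgrPdist_lt : gh => /(_ (e / 3)); rewrite divr_gt0// => /(_ isT) [N _].
move=> /(_ N (leqnn N)) /=; rewrite sub0r normrN; set c := g N => hc.
have cc : continuous c by exact: cg.
have ic : rintegrable c by exact: ig.
have {}hc : rint (fun t => `|h t - c t|) < e / 3.
  apply: le_lt_trans hc; exact: ler_norm.
have [M cM] : exists M : R, forall s, circle R s -> `|c s| <= M.
  have /compact_bounded[M [_ mrt]] := continuous_compact
    (continuous_subspaceT cc) (@segment_compact R 0 1).
  exists (`|M| + 1) => s Is; apply: mrt; first by rewrite ltr_pwDr// ler_norm.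
  by exists s => //; exact: subset_itv_co_cc Is.
have M0 : 0 <= M.
  by apply: le_trans (normr_ge0 _) (cM 0 _); rewrite /circle/= in_itv/= lexx ltr01.
have pcM m t : `|pconv m c t| <= M.
  apply: le_trans (pconv_abs _ _ ic) _; rewrite -[leRHS](pconv_cst m M t).
  by apply: le_pconv => //; [exact: rintegrable_abs|exact: rintegrable_cst].
have c0 : rint (fun t => `|pconv m c t - c t|) @[m --> \oo] --> rint (fun=> 0 : R).
  apply: (rint_cvg_dom _ _ (rintegrable_cst (M + M))).
  - move=> m; apply: rmeas_abs; apply: rmeasB.
      exact: rmeas_pconv.
    exact: rintegrable_meas.
  - exact: rmeas_cst.
  - move=> m t It; rewrite normr_id; apply: le_trans (ler_normB _ _) _.
    by rewrite lerD// cM.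
  (* The excluded endpoint of the pointwise statement is a null set. *)
  - have z0 : aec (fun t : R => t != 0).
      exists [set 0]; split; [exact: measurable_set1|exact: lebesgue_measure_set1|].
      move=> t /= /not_implyP [_]; case: (eqVneq t 0) => //.
    apply: aec_mono z0 => t It t0.
    have t01 : 0 < t < 1.
      by move: It; rewrite /circle/= in_itv/= => /andP[tp ->]; rewrite lt_def t0 tp.
    rewrite -[X in _ --> X](normr0 R) -(subrr (c t)); apply: cvg_norm; apply: cvgB.
      exact: (poisson_cvg_pt cc cM t01).
    exact: cvg_cst.
rewrite rint_cst in c0.
move/cvgrPdist_le : c0 => /(_ (e / 3)); rewrite divr_gt0// => /(_ isT).
apply: filterS => m; rewrite !sub0r !normrN => hm.
have ihc : rintegrable (fun t => h t - c t) by exact: rintegrableB.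
have i1 := rintegrable_abs (rintegrable_pconv m ihc).
have i2 := rintegrable_abs (rintegrableB (rintegrable_pconv m ic) ic).
have i3 := rintegrable_abs ihc.
have i0 := rintegrable_abs (rintegrableB (rintegrable_pconv m ih) ih).
rewrite ger0_norm; last by apply: rint_ge0.
apply: (@le_trans _ _ (rint (fun t => `|pconv m (fun t => h t - c t) t| +
   `|pconv m c t - c t| + `|h t - c t|))).
  apply: le_rint => //; first by apply: rintegrableD => //; exact: rintegrableD.
  move=> t _; rewrite pconvB//.
  have -> : pconv m h t - h t = (pconv m h t - pconv m c t) + (pconv m c t - c t) -
    (h t - c t) by ring.
  apply: le_trans (ler_normB _ _) _; rewrite lerD2r; exact: ler_normD.
rewrite rintD//; last exact: rintegrableD.
rewrite rintD//.
have h1 := pconv_contract m ihc.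
have h2 := le_trans (ler_norm _) hm.
lra.
Qed.

End PoissonApprox.

(** * Outer functions *)

Section ExpLimit.
Context {R : realType}.
Implicit Types (a b x y : R) (z w : R[i]).

Let sin_mvt x : 0 <= x -> exists2 c, 0 <= c <= x & sin x = cos c * x.
Proof.
move=> x0; have [c] := @MVT_segment R sin cos 0 x x0 (fun y _ => is_derive_sin y)
  (continuous_subspaceT (@continuous_sin R)).
by rewrite in_itv/= sin0 !subr0 => cx ->; exists c.
Qed.

Lemma abs_sin_le x : `|sin x| <= `|x|.
Proof.
wlog x0 : x / 0 <= x.
  move=> H; have [/H//|/ltW x0] := leP 0 x.
  by rewrite -normrN -sinN -[leRHS]normrN H// oppr_ge0.
have [c _ ->] := sin_mvt x0.
by rewrite normrM ler_piMl// ler_norml cos_le1 cos_geN1.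
Qed.

Lemma one_sub_cos_le x : 1 - cos x <= x ^+ 2 / 2.
Proof.
have -> : cos x = cos (x / 2 + x / 2) by congr cos; field.
rewrite cosD.
have := cos2Dsin2 (x / 2).
have : sin (x / 2) ^+ 2 <= (x / 2) ^+ 2.
  by rewrite -[leLHS]real_normK ?num_real// -[leRHS]real_normK ?num_real//
    lerXn2r ?nnegrE// abs_sin_le.
move: (sin _) (cos _) => s c; nra.
Qed.

Lemma abs_sin_sub_le x : `|sin x - x| <= `|x| ^+ 3 / 2.
Proof.
wlog x0 : x / 0 <= x.
  move=> H; have [/H//|/ltW x0] := leP 0 x.
  have := H (- x); rewrite oppr_ge0 => /(_ x0).
  by rewrite sinN -opprD !normrN.
have [c /andP[c0 cx] ->] := sin_mvt x0.
rewrite -[X in _ - X]mul1r -mulrBl normrM (ger0_norm x0) distrC ger0_norm; last first.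
  by rewrite subr_ge0 cos_le1.
have := one_sub_cos_le c.
have : c ^+ 2 <= x ^+ 2 by rewrite lerXn2r.
move=> h1 h2; have -> : x ^+ 3 / 2 = x ^+ 2 / 2 * x by ring.
by rewrite ler_wpM2r//; lra.
Qed.

Lemma expR_taylor1 a : `|a| <= 2^-1 -> 0 <= expR a - 1 - a <= 2 * a ^+ 2.
Proof.
rewrite ler_norml => /andP[a1 a2].
apply/andP; split; first by have := expR_ge1Dx a; lra.
have h : expR a * (1 - a) <= 1.
  rewrite -[leRHS](expRxMexpNx_1 a) ler_wpM2l ?expR_ge0//.
  exact: (expR_ge1Dx (- a)).
have := expR_ge0 a; have := sqr_ge0 a; nra.
Qed.

(** The real and the imaginary part each contribute at most 3 |w|^2, since the exponential of Re w
    is at most 2. *)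
Lemma cexp_taylor1 w : normc w <= 2^-1 -> normc (cexp w - 1 - w) <= 6 * normc w ^+ 2.
Proof.
move=> w2; have na := abs_Re_le w; have nb := abs_Im_le w.
have n0 := normc_ge0 w.
apply: le_trans (normc_le_ReIm _) _.
move: na nb w2 n0; move: (normc w) => n; case: w => a b /= na nb w2 n0.
rewrite /cexp /= !mul0r subr0 addr0 !oppr0 !addr0.
have a2 : `|a| <= 2^-1 by exact: le_trans na w2.
have /andP[e1 e2] := expR_taylor1 a2.
have e3 : expR a <= 2.
  have : a ^+ 2 <= (2^-1) ^+ 2 by rewrite -[leLHS]real_normK ?num_real// lerXn2r ?nnegrE.
  move: a2; rewrite ler_norml => /andP[_ a2]; lra.
have an : a ^+ 2 <= n ^+ 2 by rewrite -[leLHS]real_normK ?num_real// lerXn2r ?nnegrE.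
have bn : b ^+ 2 <= n ^+ 2 by rewrite -[leLHS]real_normK ?num_real// lerXn2r ?nnegrE.
have c1 := one_sub_cos_le b; have c2 := cos_le1 b.
have s1 := abs_sin_sub_le b.
have e0 := expR_ge0 a.
have -> : 6 * n ^+ 2 = 3 * n ^+ 2 + 3 * n ^+ 2 by ring.
apply: lerD.
  have -> : expR a * cos b - 1 - a = (expR a - 1 - a) - expR a * (1 - cos b) by ring.
  apply: le_trans (ler_normB _ _) _; rewrite (ger0_norm e1) ger0_norm; last first.
    by rewrite mulr_ge0// subr_ge0.
  have : expR a * (1 - cos b) <= 2 * (b ^+ 2 / 2) by rewrite ler_pM// subr_ge0.
  lra.
have -> : expR a * sin b - b = expR a * (sin b - b) + (expR a - 1) * b by ring.
apply: le_trans (ler_normD _ _) _; rewrite !normrM (ger0_norm e0).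
have h1 : expR a * `|sin b - b| <= 2 * (n ^+ 2 * 2^-1 / 2).
  rewrite ler_pM//; apply: le_trans s1 _; rewrite ler_wpM2r//.
  by rewrite exprSr ler_pM// ?sqr_ge0 ?(le_trans nb)// lerXn2r ?nnegrE.
have h2 : `|expR a - 1| * `|b| <= 2 * n * n.
  rewrite ler_pM//; have -> : expR a - 1 = (expR a - 1 - a) + a by ring.
  apply: le_trans (ler_normD _ _) _; rewrite (ger0_norm e1).
  by have : a ^+ 2 <= n * 2^-1; [nra|lra].
by have := sqr_ge0 n; rewrite -mulrA -expr2 in h2; lra.
Qed.

Lemma normc_subX w z (A : R) n : 1 <= A -> normc w <= A -> normc z <= A ->
  normc (w ^+ n - z ^+ n) <= n%:R * A ^+ n * normc (w - z).
Proof.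
move=> A1 wA zA; have A0 : 0 <= A by lra.
elim: n => [|n IH]; first by rewrite !expr0 subrr normc0 !mul0r.
have -> : w ^+ n.+1 - z ^+ n.+1 = w * (w ^+ n - z ^+ n) + (w - z) * z ^+ n.
  by rewrite !exprS; ring.
apply: le_trans (normcD_le _ _) _; rewrite !normcM normcX.
have zn : normc z ^+ n <= A ^+ n.+1.
  apply: (@le_trans _ _ (A ^+ n)); first by rewrite lerXn2r ?nnegrE ?normc_ge0.
  by rewrite ler_weXn2l.
have h1 : normc w * normc (w ^+ n - z ^+ n) <= A * (n%:R * A ^+ n * normc (w - z)).
  by rewrite ler_pM ?normc_ge0.
have h2 : normc (w - z) * normc z ^+ n <= normc (w - z) * A ^+ n.+1.
  by rewrite ler_wpM2l ?normc_ge0.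
apply: le_trans (lerD h1 h2) _.
by rewrite -natr1 exprS le_eqVlt; apply/orP; left; apply/eqP; ring.
Qed.

(** With w = z / N, both e^w and 1 + w have modulus at most e^{K/N} and differ by at most 6 |w|^2;
    taking N-th powers multiplies the difference by at most N e^K. The bound being uniform, the
    exponential of a polynomial in e_1 is replaced by a polynomial. *)
Lemma cexp_limit (K e : R) : 0 <= K -> 0 < e -> exists n : nat, forall z,
  normc z <= K -> normc (cexp z - (1 + (n.+1%:R^-1)%:C * z) ^+ n.+1) <= e.
Proof.
move=> K0 e0.
pose B := 6 * expR K * K ^+ 2.
have B0 : 0 <= B by rewrite !mulr_ge0 ?expR_ge0.
(* The term 2 K makes |z / N| <= 1/2, and B / e makes the final error B / N at most e. *)
pose n := Num.bound (2 * K + B / e).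
have nb : 2 * K + B / e < n.+1%:R.
  have := archi_boundP (addr_ge0 (mulr_ge0 (ler0n R 2) K0) (divr_ge0 B0 (ltW e0))).
  by move=> /lt_trans; apply; rewrite ltr_nat.
exists n => z zK; set N := n.+1%:R : R in nb *.
have N0 : 0 < N by rewrite ltr0n.
set w := (N^-1)%:C * z.
have wE : normc w = normc z / N.
  by rewrite /w normcM normc_real ger0_norm ?invr_ge0 ?ltW// mulrC.
have wK : normc w <= K / N by rewrite wE ler_wpM2r// invr_ge0 ltW.
have Be : 0 <= B / e by rewrite divr_ge0// ltW.
have w2 : normc w <= 2^-1.
  by apply: le_trans wK _; rewrite ler_pdivrMr//; lra.
have zE : cexp z = cexp w ^+ n.+1.
  rewrite -cexpMn; congr cexp; rewrite /w -mulrnAl -[X in X * z]rmorphMn/=.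
  by rewrite -mulr_natr mulVf ?gt_eqF// mul1r.
rewrite zE.
have KN0 : 0 <= K / N by rewrite divr_ge0// ltW.
have A1 : 1 <= expR (K / N) by apply: le_trans (expR_ge1Dx _); rewrite lerDl.
have c1 : normc (cexp w) <= expR (K / N).
  rewrite normc_cexp ler_expR; apply: le_trans wK; apply: le_trans (ler_norm _) _.
  exact: abs_Re_le.
have c2 : normc (1 + w) <= expR (K / N).
  apply: le_trans (expR_ge1Dx _); apply: le_trans (normcD_le _ _) _.
  by rewrite normc1 lerD2l.
apply: le_trans (normc_subX n.+1 A1 c1 c2) _.
rewrite -expRM_natr divfK ?gt_eqF//.
have := cexp_taylor1 w2; rewrite -addrA -opprD => h.
apply: (@le_trans _ _ (N * expR K * (6 * (K / N) ^+ 2))).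
  apply: ler_wpM2l; first by rewrite mulr_ge0 ?expR_ge0 ?(ltW N0).
  apply: le_trans h _.
  by rewrite ler_wpM2l// lerXn2r ?nnegrE ?normc_ge0.
have -> : N * expR K * (6 * (K / N) ^+ 2) = B / N.
  by rewrite /B; field; rewrite gt_eqF.
rewrite ler_pdivrMr//.
have : B / e <= N by lra.
by rewrite ler_pdivrMr// mulrC.
Qed.

End ExpLimit.

(** * Polynomial approximation of exponentials of Herglotz integrals *)

Section HerglotzPoly.
Context {R : realType}.
Implicit Types (a b x y : R) (z w : R[i]) (v : R -> R) (p : {poly R[i]}).

Lemma cexp_lip (K : R) z w : normc w <= K -> normc (z - w) <= 2^-1 ->
  normc (cexp z - cexp w) <= 4 * expR K * normc (z - w).
Proof.
move=> wK zw.
have -> : cexp z - cexp w = cexp w * ((cexp (z - w) - 1 - (z - w)) + (z - w)).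
  by rewrite addrNK mulrBr mulr1 -cexpD [w + _]addrC subrK.
rewrite normcM normc_cexp.
have h1 : expR (complex.Re w) <= expR K.
  by rewrite ler_expR (le_trans (ler_norm _))// (le_trans (abs_Re_le _)).
have h2 := cexp_taylor1 zw.
have n0 := normc_ge0 (z - w).
(* As |z - w| <= 1/2, the remainder 6 |z - w|^2 is at most 3 |z - w|. *)
have h3 : normc (cexp (z - w) - 1 - (z - w) + (z - w)) <= 4 * normc (z - w).
  by apply: le_trans (normcD_le _ _) _; nra.
have -> : 4 * expR K * normc (z - w) = expR K * (4 * normc (z - w)) by ring.
by rewrite ler_pM ?expR_ge0 ?normc_ge0.
Qed.

Definition pol p (t : R) : R[i] := p.[efun 1 t].

Lemma polE p t : pol p t = \sum_(k < size p) p`_k * efun (k : nat)%:Z t.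
Proof. by rewrite /pol horner_coef; apply: eq_bigr => k _; rewrite efunX. Qed.

Lemma cmeasurable_pol p : cmeasurable (pol p).
Proof.
rewrite (_ : pol p = fun t => \sum_(k < size p) p`_k * efun (k : nat)%:Z t).
  apply: cmeasurable_sum => k _; apply: (cmeasurableM (cmeasurable_cst _)).
  exact: cmeasurable_efun.
by apply/funext => t; exact: polE.
Qed.

Lemma pol_bdd p : exists2 M : R, 0 <= M & forall t, normc (pol p t) <= M.
Proof.
exists (\sum_(k < size p) normc p`_k); first by apply: sumr_ge0 => k _; exact: normc_ge0.
move=> t; rewrite polE; apply: le_trans (normc_sum _ _ _) _.
by apply: ler_sum => k _; rewrite normcM normc_efun mulr1.
Qed.

Lemma L2_pol p : L2 (pol p).
Proof. by have [M _ pM] := pol_bdd p; apply: (L2_bdd (cmeasurable_pol p)) => t _; exact: pM. Qed.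

Lemma L2Mpol u p : L2 u -> L2 (fun t => u t * pol p t).
Proof.
move=> hu; have [M _ pM] := pol_bdd p.
have := L2Mbdd (cmeasurable_pol p) hu (fun t _ => pM t).
by congr L2; apply/funext => t; rewrite mulrC.
Qed.

(** For u in H^2 and k >= 1 the product u e_k has mean zero, so only the constant term of p
    survives: evaluation at 0 is multiplicative. *)
Lemma cint_H2Mpol u p : H2 u -> cint (fun t => u t * pol p t) = p.[0] * cint u.
Proof.
move=> [hu u0].
have E k : cint (fun t => u t * efun (k : nat)%:Z t) = (k == 0%N)%:R * cint u.
  case: k => [|k].
    by rewrite mul1r; apply: eq_cint => t _; rewrite (efun0 t : efun (Posz 0) t = 1) mulr1.
  rewrite mul0r -(u0 (- (k.+1)%:Z)) ?oppr_lt0//.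
  by apply: eq_cint => t _; rewrite /= /cconj efunN conjcK.
have ik k : cintegrable (fun t => u t * efun (k : nat)%:Z t).
  have ek : forall t, circle R t -> normc (efun k%:Z t : R[i]) <= 1.
    by move=> t _; rewrite normc_efun.
  have := cintegrableMbdd (cmeasurable_efun k%:Z) (L2_cint hu) ek.
  by congr cintegrable; apply/funext => t /=; rewrite mulrC.
rewrite (eq_cint (v := fun t => \sum_(k < size p) p`_k * (u t * efun (k : nat)%:Z t))).
  rewrite cint_sum; last by move=> k _; exact: cintegrableZ.
  under eq_bigr do rewrite cintZ// E mulrA.
  rewrite -mulr_suml; congr (_ * _); rewrite horner_coef0.
  case sp: (size p) => [|n].
    by rewrite big_ord0 nth_default// sp.
  by rewrite big_ord_recl /= mulr1 big1 ?addr0// => k _; rewrite mulr0.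
by move=> t _; rewrite polE mulr_sumr; apply: eq_bigr => k _; rewrite mulrCA.
Qed.

Lemma H2_cst1 : H2 (fun=> 1 : R[i]).
Proof.
split; first exact: L2_cst.
move=> n n0; rewrite /inner (eq_cint (v := efun (- n))).
  by rewrite cint_efun oppr_eq0 lt_eqF.
by move=> t _; rewrite /= mul1r /cconj efunN.
Qed.

Lemma cint_cst (c : R[i]) : cint (fun=> c) = c.
Proof. by apply: eq_ReIm; rewrite ?Re_cint ?Im_cint rint_cst. Qed.

Lemma cint_pol p : cint (pol p) = p.[0].
Proof.
rewrite -[RHS]mulr1 -[X in _ * X](cint_cst 1) -(cint_H2Mpol _ H2_cst1).
by apply: eq_cint => t _; rewrite mul1r.
Qed.

(** The polynomial is (1 + kappa P / (n+1))^{n+1}, with P a partial sum of the Herglotz expansion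
    and P(0) = int v. One polynomial controls the values on the circle and the value at 0 together,
    which stands in for the mean value property of the exponential. *)
Lemma herg_poly (r kappa e : R) v : 0 <= r < 1 -> rintegrable v -> 0 < e ->
  exists p, (forall t, normc (cexp (kappa%:C * herg r v t) - pol p t) <= e) /\
    normc ((expR (kappa * rint v))%:C - p.[0]) <= e.
Proof.
move=> r01 iv e0.
pose V := rint (fun s => `|v s|).
have V0 : 0 <= V by exact: rint_ge0.
have r0 : 0 < 1 - r by case/andP: r01 => _; rewrite subr_gt0.
pose A := 2 / (1 - r) * V.
have A0 : 0 <= A by rewrite mulr_ge0// divr_ge0// ltW.
(* K bounds both exponents to which [cexp_limit] is applied: kappa times the partial sum, and kappa
   times int v. *)
pose K := `|kappa| * (V + A + 1) + 1.
have K0 : 0 <= K by rewrite addr_ge0// mulr_ge0// !addr_ge0.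
have hA t : normc (herg r v t) <= A.
  apply: le_trans (normc_cint (cintegrable_herg r01 t iv)) _.
  rewrite /A /V -rintZ; last exact: rintegrable_abs.
  apply: le_rint.
  - exact: rintegrable_normc (cintegrable_herg r01 t iv).
  - exact/rintegrableZ/rintegrable_abs.
  - by move=> s _; rewrite normcM normc_real ler_wpM2r// normc_hker.
(* An error d in the Herglotz integral moves the exponent by at most the minimum: 1/2 is the range
   of [cexp_lip], the other term makes the resulting error e/2. *)
pose d := Num.min 2^-1 (e / 2 / (4 * expR K)) / (`|kappa| + 1).
have k1 : 0 < `|kappa| + 1 by rewrite ltr_wpDl.
have eK : 0 < 4 * expR K by rewrite mulr_gt0// expR_gt0.
have d0 : 0 < d by rewrite divr_gt0// lt_min !divr_gt0// invr_gt0 ltr0n.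
have [N hN] := exists_geom_lt A r01 d0.
have [n hn] := cexp_limit K0 (divr_gt0 e0 (ltr0n R 2)).
pose P := \poly_(k < N.+1) herg_coef r v k.
have PE t : pol P t = herg_sum r v N t.
  by rewrite /pol horner_poly; apply: eq_bigr => k _; rewrite efunX.
have P0 : P.[0] = (rint v)%:C.
  by rewrite horner_coef0 coef_poly/= herg_coef0.
exists ((1 + ((n.+1%:R^-1)%:C * kappa%:C) *: P) ^+ n.+1); split => [t|]; last first.
  rewrite horner_exp !hornerE/= P0 -cexp_real rmorphM/= -mulrA.
  apply: le_trans (hn _ _) _; last by lra.
  rewrite normcM !normc_real; apply: (@le_trans _ _ (`|kappa| * (V + A + 1))); last by rewrite lerDl.
  rewrite ler_wpM2l// -addrA ler_wpDr// ?addr_ge0//; exact: le_abs_rint.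
set z := kappa%:C * herg r v t; set w := kappa%:C * herg_sum r v N t.
have zw : normc (z - w) <= Num.min 2^-1 (e / 2 / (4 * expR K)).
  rewrite -mulrBr normcM normc_real.
  have h := le_trans (herg_err r01 N t iv) (ltW hN).
  have : `|kappa| * normc (herg r v t - herg_sum r v N t) <= (`|kappa| + 1) * d.
    by rewrite ler_pM ?normc_ge0// lerDl.
  by rewrite /d [X in _ <= X]mulrC divfK// gt_eqF.
have /andP[zw1 zw2] : (normc (z - w) <= 2^-1) && (normc (z - w) <= e / 2 / (4 * expR K)).
  by rewrite -le_min.
have zA : normc z <= `|kappa| * A by rewrite normcM normc_real ler_wpM2l.
have wK : normc w <= K.
  have -> : w = z - (z - w) by ring.
  apply: le_trans (normcB_le _ _) _; rewrite /K lerD//; last by lra.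
  by apply: le_trans zA _; rewrite ler_wpM2l//; lra.
have h1 : normc (cexp z - cexp w) <= e / 2.
  apply: le_trans (cexp_lip wK zw1) _.
  by rewrite mulrC -ler_pdivlMr.
have h2 := hn w wK.
have -> : pol ((1 + ((n.+1%:R^-1)%:C * kappa%:C) *: P) ^+ n.+1) t =
    (1 + (n.+1%:R^-1)%:C * w) ^+ n.+1.
  by rewrite /pol horner_exp !hornerE -/(pol P t) PE.
have -> : cexp z - (1 + (n.+1%:R^-1)%:C * w) ^+ n.+1 =
  (cexp z - cexp w) + (cexp w - (1 + (n.+1%:R^-1)%:C * w) ^+ n.+1) by ring.
by apply: le_trans (normcD_le _ _) _; lra.
Qed.

End HerglotzPoly.

(** * Limits of complex-valued functions *)

Section ComplexLimits.
Context {R : realType}.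

Lemma cvgC_near (T : Type) (F : set_system T) (FF : Filter F) (u : T -> R[i]) (l : R[i]) :
  ((u t : R[i]^o) @[t --> F] --> (l : R[i]^o)) <->
  (forall e : R, 0 < e -> \forall t \near F, normc (l - u t) < e).
Proof.
have nE (z : R[i]) : `|z| = (normc z)%:C by case: z.
split=> [/cvgrPdist_lt h e e0|h].
  have := h e%:C; rewrite ltcR => /(_ e0); apply: filterS => t.
  by rewrite nE ltcR.
apply/cvgrPdist_lt => e e0.
have [eR] : exists2 x : R, e = x%:C & 0 < x.
  by move: e0; rewrite ltcE => /andP[/eqP ei er]; exists (complex.Re e) => //; case: e ei er => a b /= ->.
move=> -> x0; apply: filterS (h _ x0) => t.
by rewrite nE ltcR.
Qed.

(** Meant for the exponentials of Herglotz integrals, whose measurability in t follows from that of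
    the approximating polynomials. *)
Lemma cmeasurable_unif_lim (F : R -> R[i]) :
  (forall e : R, 0 < e -> exists2 G : R -> R[i], cmeasurable G &
     forall t, normc (F t - G t) <= e) -> cmeasurable F.
Proof.
move=> h.
have /choice [G hG] : forall n : nat, exists G : R -> R[i],
    cmeasurable G /\ forall t, normc (F t - G t) <= n.+1%:R^-1.
  by move=> n; have [|G mG FG] := h n.+1%:R^-1; [rewrite invr_gt0|exists G].
have lim (q : R[i] -> R) : (forall z, `|q z| <= normc z) ->
    (forall z w, q (z - w) = q z - q w) ->
    forall t, q (G n t) @[n --> \oo] --> q (F t).
  move=> qn qB t; apply/cvgrPdist_le => e e0.
  have /cvgrPdist_le/(_ e e0) := @cvg_harmonic R.
  apply: filterS => n; rewrite sub0r normrN ger0_norm ?invr_ge0// => hn.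
  rewrite -qB; apply: le_trans (qn _) _; apply: le_trans hn.
  exact: (hG n).2.
split.
  apply: (@measurable_fun_cvg _ _ R (circle R) (fun n t => complex.Re (G n t))).
    by move=> n; exact: (hG n).1.1.
  move=> t _; apply: (lim (@complex.Re R)); first exact: abs_Re_le.
  by move=> z w; rewrite Re_cD Re_cN.
apply: (@measurable_fun_cvg _ _ R (circle R) (fun n t => complex.Im (G n t))).
  by move=> n; exact: (hG n).1.2.
move=> t _; apply: (lim (@complex.Im R)); first exact: abs_Im_le.
by move=> z w; rewrite Im_cD Im_cN.
Qed.

End ComplexLimits.

(** * The logarithm attached to an outer function *)

Section OuterData.
Context {R : realType}.
Implicit Types (u v : R -> R) (phi : R -> R[i]).

(* [outer phi] restricted to the radii [radius m], with [u] the log of the [f] of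
   its definition, so that [u = log |phi|^2]. *)
Definition outer_log phi u : Prop := rintegrable u /\
  aec (fun t => forall e : R, 0 < e -> \forall m \near \oo,
    normc (phi t - cexp ((2^-1)%:C * herg (radius m) u t)) < e).

Lemma outer_logP phi : outer phi -> exists u, outer_log phi u.
Proof.
move=> [f [f0 ilf hlim]]; exists (fun t => ln (f t)); split.
  (* Where f vanishes the left side is 0 and [lne] is infinite; elsewhere the two logarithms
     agree. *)
  have bnd t : circle R t -> (`|(ln (f t))%:E| <= `|lne (f t)%:E|)%E.
    move=> It; have := f0 t It; rewrite le_eqVlt => /predU1P[<-|ft0].
      by rewrite ln0// abse0 abse_ge0.
    by rewrite lne_EFin.
  apply: (@le_integrable _ _ R lebesgue_measure _ measurable_circle _
    (fun t => lne (f t)%:E)) => //.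
  have := measurable_int _ ilf.
  move=> /(measurableT_comp (@fine_measurable R setT measurableT)) mf.
  apply/measurable_EFinP; apply: eq_measurable_fun mf => t /set_mem It.
  rewrite /comp; have := f0 t It; rewrite le_eqVlt => /predU1P[<-|ft0].
    by rewrite le0_lneNy// ln0.
  by rewrite lne_EFin.
apply: aec_mono hlim => t It ht e e0.
have rl : radius m @[m --> \oo] --> (1 : R)^'-.
  move=> A hA; have : \forall m \near \oo, radius m < 1 -> A (radius m) := cvg_radius hA.
  rewrite /= nbhs_filterE; apply: filterS => m; apply; exact: radius_lt1.
have /cvgC_near/(_ e e0) := cvg_comp _ _ rl ht.
apply: filterS => m; rewrite /= /outer_ext /herg.
by rewrite fmorphV rmorph_nat.
Qed.

(** The tangent of exp at x, the Poisson mean of v, lies below the graph: exp v >= exp x (1 + v -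
    x). Averaged against the kernel, whose mass is 1, the right side becomes exp x. *)
Lemma pconv_jensen m v t : rintegrable v -> rintegrable (fun s => expR (v s)) ->
  expR (pconv m v t) <= pconv m (fun s => expR (v s)) t.
Proof.
move=> iv ie; set x := pconv m v t.
have i1 : rintegrable (fun s => 1 - x + v s) by apply: rintegrableD => //; exact: rintegrable_cst.
have <- : pconv m (fun s => expR x * (1 - x + v s)) t = expR x.
  rewrite /pconv /kconv.
  rewrite (eq_rint (g := fun s => expR x * (poisson (radius m) (s - t) * (1 - x + v s)))).
    rewrite rintZ -/(kconv _ _ _) -/(pconv _ _ _); last exact: rintegrable_poisson.
    rewrite pconvD//; last exact: rintegrable_cst.
    by rewrite pconv_cst -/x subrK mulr1.
  by move=> s _; rewrite mulrCA.
apply: le_pconv => //; first exact: rintegrableZ.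
move=> s _; have -> : expR (v s) = expR x * expR (v s - x) by rewrite -expRD addrC subrK.
rewrite ler_wpM2l ?expR_ge0//; apply: le_trans (expR_ge1Dx _).
by rewrite -addrA [- x + _]addrC.
Qed.

End OuterData.

(** * Modulus, dilations and mean value of an outer function *)

Section OuterFunction.
Context {R : realType}.
Variables (phi : R -> R[i]) (u : R -> R).
Hypotheses (phiH2 : H2 phi) (phiu : outer_log phi u).

Let iu : rintegrable u. Proof. by case: phiu. Qed.
Let L2phi : L2 phi. Proof. by case: phiH2. Qed.

Definition dilation (m : nat) (t : R) : R[i] := cexp ((2^-1)%:C * herg (radius m) u t).

Lemma cmeasurable_herg_exp (v : R -> R) (kappa : R) m : rintegrable v ->
  cmeasurable (fun t => cexp (kappa%:C * herg (radius m) v t)).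
Proof.
move=> iv; apply: cmeasurable_unif_lim => e e0.
have [p [hp _]] := herg_poly kappa (radius01 m) iv e0.
by exists (pol p) => //; exact: cmeasurable_pol.
Qed.

(** The real part of the Herglotz integral is the Poisson integral. The value kappa = 1/2 gives
    dilations of Phi_v, and kappa = - 1/2 those of 1 / Phi_v. *)
Lemma normc_herg_exp (v : R -> R) (kappa : R) m t :
  normc (cexp (kappa%:C * herg (radius m) v t)) ^+ 2 = expR (2 * kappa * pconv m v t).
Proof.
rewrite normc_cexp Re_cM (Re_herg (radius01 m)) -/(pconv m v t) /= mul0r subr0.
by rewrite expr2 -expRD; congr expR; ring.
Qed.

Lemma sqr_normc_dilation m t : normc (dilation m t) ^+ 2 = expR (pconv m u t).
Proof. by rewrite normc_herg_exp mulfV// mul1r. Qed.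

(* [pconv m u] tends to [u] in L^1, hence a.e. along indices depending on the
   point; as [|dilation m|^2 = exp (pconv m u)] converges a.e., that suffices. *)
Lemma sqr_normc_outer : aec (fun t => normc (phi t) ^+ 2 = expR (u t)).
Proof.
have i_ n : rintegrable (fun t => `|pconv n u t - u t|).
  by apply: rintegrable_abs; apply: rintegrableB => //; exact: rintegrable_pconv.
have hl := aec_liminf0 i_ (fun _ _ _ => normr_ge0 _) (poisson_L1 iu).
have [_ hphi] := phiu.
apply: aec_mono (aec_and hl hphi) => t It [lt pt].
apply/eqP; rewrite -subr_eq0 -normr_eq0; apply: contrapT => /negP h0.
have {h0} : 0 < `|normc (phi t) ^+ 2 - expR (u t)| by rewrite lt_def h0 normr_ge0.
set d := `|_| => d0.
have d2 : 0 < d / 2 by rewrite divr_gt0.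
have /cvgrPdist_lt/(_ _ d2) := @continuous_expR R (u t).
move=> [d' /= d'0 hd'].
have [k _ hk] : \forall k \near \oo, k.+1%:R^-1 < d' :> R.
  have /cvgrPdist_lt/(_ _ d'0) := @cvg_harmonic R.
  by apply: filterS => k; rewrite sub0r normrN ger0_norm ?invr_ge0.
have {}hk := hk k (leqnn k).
pose n1 := normc (phi t).
have n10 : 0 <= n1 by exact: normc_ge0.
(* If | |phi| - |dilation| | <= e1, the sum of the two moduli is at most 2 n1 + 1, so their squares
   differ by at most d/2. *)
pose e1 := Num.min 1 (d / 2 / (2 * n1 + 1)).
have e10 : 0 < e1 by rewrite lt_min ltr01 divr_gt0//; lra.
have [N _ hN] := pt _ e10.
have [m Nm hm] := lt N k.
have {}hN := hN m Nm.
have h1 : `|expR (u t) - expR (pconv m u t)| < d / 2.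
  by apply: hd' => /=; rewrite distrC (lt_trans hm).
have h2 : `|n1 ^+ 2 - normc (dilation m t) ^+ 2| <= d / 2.
  set n2 := normc (dilation m t).
  have n12 : `|n1 - n2| <= e1.
    apply: le_trans (ltW hN); rewrite ler_norml; apply/andP; split.
      rewrite lerNl opprB lerBlDr normcBC.
      by apply: le_trans (normcD_le _ _); rewrite subrK.
    by rewrite lerBlDr; apply: le_trans (normcD_le _ _); rewrite subrK.
  have n20 : 0 <= n2 by exact: normc_ge0.
  have /andP[e11 e12] : (e1 <= 1) && (e1 <= d / 2 / (2 * n1 + 1)) by rewrite -le_min.
  rewrite subr_sqr normrM [X in _ * X]ger0_norm ?addr_ge0//.
  have n21 : n1 + n2 <= 2 * n1 + 1 by move: n12; rewrite ler_norml => /andP[? _]; lra.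
  have -> : d / 2 = d / 2 / (2 * n1 + 1) * (2 * n1 + 1).
    by rewrite divfK// gt_eqF//; lra.
  by rewrite ler_pM ?addr_ge0// (le_trans n12).
rewrite sqr_normc_dilation in h2.
have : d <= `|n1 ^+ 2 - expR (pconv m u t)| + `|expR (u t) - expR (pconv m u t)|.
  rewrite /d -/n1; have -> : n1 ^+ 2 - expR (u t) = (n1 ^+ 2 - expR (pconv m u t)) -
    (expR (u t) - expR (pconv m u t)) by ring.
  exact: ler_normB.
by lra.
Qed.

Lemma outer_neq0 : aec (fun t => phi t != 0).
Proof.
apply: aec_mono sqr_normc_outer => t _ h; apply/eqP => p0.
by move: h; rewrite p0 normc0 expr0n/= => /eqP; rewrite eq_sym gt_eqF// expR_gt0.
Qed.

Let meu : rmeas (fun t => expR (u t)).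
Proof. by apply: rmeas_exp; exact: rintegrable_meas. Qed.

Let msq (v : R -> R[i]) : cmeasurable v -> rmeas (fun t => normc (v t) ^+ 2).
Proof. by move=> mv; under eq_fun do rewrite expr2; apply: rmeasM; exact: rmeas_normc. Qed.

Let ieu : rintegrable (fun t => expR (u t)).
Proof. exact: ae_eq_rintegrable meu (L2_sqr L2phi) sqr_normc_outer. Qed.

Let nsq_phi : nsq phi = rint (fun t => expR (u t)).
Proof. exact: ae_eq_rint (msq (L2_meas L2phi)) meu sqr_normc_outer. Qed.

Let cmeasurable_dilation m : cmeasurable (dilation m).
Proof. exact: cmeasurable_herg_exp. Qed.

Let dilation_le m t : normc (dilation m t) ^+ 2 <= pconv m (fun s => expR (u s)) t.
Proof. by rewrite sqr_normc_dilation; exact: pconv_jensen. Qed.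

Let L2_dilation m : L2 (dilation m).
Proof.
exact: (L2_dom (cmeasurable_dilation m) (rintegrable_pconv m ieu) (fun t _ => dilation_le m t)).
Qed.

Let nsq_dilation m : nsq (dilation m) <= nsq phi.
Proof.
rewrite nsq_phi -(rint_pconv m ieu); last by move=> t _; exact: expR_ge0.
apply: le_rint; [exact: L2_sqr|exact: rintegrable_pconv|].
by move=> t _; exact: dilation_le.
Qed.

(* Fatou's lemma for [2 |dilation m|^2 + 2 |phi|^2 - |phi - dilation m|^2]. *)
Lemma dilation_cvg (e : R) : 0 < e -> \forall m \near \oo, nsq (fun t => phi t - dilation m t) <= e.
Proof.
move=> e0.
have id m : rintegrable (fun t => normc (phi t - dilation m t) ^+ 2).
  exact: L2_sqr (L2B L2phi (L2_dilation m)).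
have is1 m := rintegrableZ 2 (L2_sqr (L2_dilation m)).
have is2 := rintegrableZ 2 (L2_sqr L2phi).
have is4 := rintegrableZ 4 (L2_sqr L2phi).
have is12 m := rintegrableD (is1 m) is2.
have i_ m : rintegrable (fun t => 2 * normc (dilation m t) ^+ 2 + 2 * normc (phi t) ^+ 2 -
   normc (phi t - dilation m t) ^+ 2) by exact: rintegrableB.
have := rint_fatou i_ is4 _ _ _ e0.
have n0 t : circle R t -> 0 <= 4 * normc (phi t) ^+ 2 by rewrite mulr_ge0// sqr_ge0.
have n_ m t : circle R t -> 0 <= 2 * normc (dilation m t) ^+ 2 + 2 * normc (phi t) ^+ 2 -
   normc (phi t - dilation m t) ^+ 2.
  move=> _; have := normcB_le (phi t) (dilation m t).
  have := normc_ge0 (phi t - dilation m t).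
  have := normc_ge0 (phi t); have := normc_ge0 (dilation m t).
  have := sqr_ge0 (normc (phi t) - normc (dilation m t)).
  move: (normc _) (normc _) (normc _) => x y z; nra.
have cv : aec (fun t => (2 * normc (dilation m t) ^+ 2 + 2 * normc (phi t) ^+ 2 -
   normc (phi t - dilation m t) ^+ 2) @[m --> \oo] --> 4 * normc (phi t) ^+ 2).
  have [_ hphi] := phiu.
  apply: aec_mono hphi => t It pt.
  have c1 : normc (phi t - dilation m t) @[m --> \oo] --> (0 : R).
    apply/cvgrPdist_lt => d d0; have := pt d d0; apply: filterS => m hm.
    by rewrite sub0r normrN ger0_norm ?normc_ge0.
  have c2 : normc (dilation m t) @[m --> \oo] --> normc (phi t).
    apply/cvgrPdist_lt => d d0; have := pt d d0; apply: filterS => m; apply: le_lt_trans.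
    rewrite ler_norml; apply/andP; split.
      rewrite lerNl opprB lerBlDr normcBC.
      by apply: le_trans (normcD_le _ _); rewrite subrK.
    by rewrite lerBlDr; apply: le_trans (normcD_le _ _); rewrite subrK.
  have -> : 4 * normc (phi t) ^+ 2 = 2 * (normc (phi t) * normc (phi t)) +
    2 * normc (phi t) ^+ 2 - 0 * 0 by ring.
  apply: cvgB; last by apply: cvgM.
  apply: cvgD; last exact: cvg_cst.
  by apply: cvgMr; apply: cvgM.
move=> /(_ n0 n_ cv); apply: filterS => m.
rewrite rintB// rintD// !rintZ; [|exact: L2_sqr..].
rewrite -/(nsq phi) -/(nsq (dilation m)) -/(nsq (fun t => phi t - dilation m t)).
by have := nsq_dilation m; lra.
Qed.

Let one_L2 : L2 (fun=> 1 : R[i]). Proof. exact: L2_cst. Qed.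

(** Cauchy-Schwarz against 1 compares the mean of phi with that of a dilation close to it in L^2;
    the dilation is uniformly close to a polynomial, whose mean is its value at 0. Each of the three
    errors is at most e/3. *)
Lemma cint_outer : cint phi = (expR (2^-1 * rint u))%:C.
Proof.
apply/eqP; rewrite -subr_eq0; apply/eqP/eq0_normc/eqP.
rewrite eq_le normc_ge0 andbT; apply/ler_addgt0Pl => e e0; rewrite addr0.
have e3 : 0 < e / 3 by rewrite divr_gt0.
have e32 : 0 < (e / 3) ^+ 2 by rewrite exprn_gt0.
have [m _ /(_ m (leqnn m)) hm] := dilation_cvg e32.
have [p [hp hp0]] := herg_poly 2^-1 (radius01 m) iu e3.
have h1 : normc (cint phi - cint (dilation m)) <= e / 3.
  rewrite -cintB; [|exact: L2_cint..].
  have hd := L2B L2phi (L2_dilation m).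
  have -> : cint (fun t => phi t - dilation m t) = inner (fun t => phi t - dilation m t) (fun=> 1).
    by apply: eq_cint => t _ /=; rewrite /cconj conjc1 mulr1.
  apply: le_trans (cauchy_schwarz hd one_L2) _.
  have -> : norm2 (fun=> 1 : R[i]) = 1.
    rewrite norm2E /nsq normc1 expr1n rint_cst sqrtr1//.
  by rewrite mulr1 -ler_sqr ?nnegrE ?norm2_ge0 ?(ltW e3)// sqr_norm2.
have h2 : normc (cint (dilation m) - p.[0]) <= e / 3.
  rewrite -cint_pol -cintB; [|exact: L2_cint|exact/L2_cint/L2_pol].
  apply: le_trans (normc_cint _) _.
    exact: L2_cint (L2B (L2_dilation m) (L2_pol p)).
  rewrite -[leRHS]rint_cst; apply: le_rint.
  - exact: rintegrable_normc (L2_cint (L2B (L2_dilation m) (L2_pol p))).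
  - exact: rintegrable_cst.
  - by move=> t _; exact: hp.
have -> : cint phi - (expR (2^-1 * rint u))%:C = (cint phi - cint (dilation m)) +
  (cint (dilation m) - p.[0]) - ((expR (2^-1 * rint u))%:C - p.[0]) by ring.
apply: le_trans (normcB_le _ _) _.
by have := normcD_le (cint phi - cint (dilation m)) (cint (dilation m) - p.[0]); lra.
Qed.

End OuterFunction.

(** * Polynomial multiples of an outer function approximate 1 *)

Section Cyclic.
Context {R : realType}.
Implicit Types (u v : R -> R).

Lemma rint_max_cvg u : rintegrable u ->
  rint (fun t => Num.max (u t) (- n%:R)) @[n --> \oo] --> rint u.
Proof.
move=> iu; apply: (rint_cvg_dom _ _ (rintegrable_abs iu)).
- by move=> n; apply: rmeas_max; [exact: rintegrable_meas|exact: rmeas_cst].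
- exact: rintegrable_meas.
- move=> n t _; have n0 : 0 <= n%:R :> R by [].
  rewrite maxElt; case: ltP => // h.
  rewrite normrN (ger0_norm n0).
  have u0 : u t <= 0 by lra.
  by rewrite ler0_norm//; lra.
- apply: aecW => t _; apply/cvgrPdist_le => e e0; near=> n.
  have h : - n%:R <= u t.
    rewrite lerNl; apply: le_trans (ler_norm _) _; rewrite normrN.
    near: n; exact: nbhs_infty_ger.
  by rewrite max_l// subrr normr0 ltW.
Unshelve. all: by end_near. Qed.

Variables (phi : R -> R[i]) (u : R -> R).
Hypotheses (phiH2 : H2 phi) (phiu : outer_log phi u).

Let iu : rintegrable u. Proof. by case: phiu. Qed.
Let L2phi : L2 phi. Proof. by case: phiH2. Qed.
Let ephi := sqr_normc_outer phiu.
Let meu : rmeas (fun t => expR (u t)).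
Proof. by apply: rmeas_exp; exact: rintegrable_meas. Qed.
Let ieu : rintegrable (fun t => expR (u t)).
Proof. exact: ae_eq_rintegrable meu (L2_sqr L2phi) ephi. Qed.

(* By Jensen the square of the norm is at most the integral of [exp u] against
   [pconv m (exp (- v))]; moving the kernel to [exp u], which [pconv m] approximates
   in L^1, leaves the integral of [exp (u - v) <= 1]. *)
Let small_weight (v : R -> R) (M e : R) : rintegrable v ->
  (forall t, u t <= v t) -> (forall t, - M <= v t) -> 0 < e ->
  \forall m \near \oo,
    L2 (fun t => phi t * cexp ((- 2^-1)%:C * herg (radius m) v t)) /\
    norm2 (fun t => phi t * cexp ((- 2^-1)%:C * herg (radius m) v t)) <= 1 + e.
Proof.
move=> iv uv vM e0.
have iNv := rintegrableN iv.
have mv := rintegrable_meas iv.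
have env_le t : expR (- v t) <= expR M by rewrite ler_expR lerNl.
have ienv : rintegrable (fun t => expR (- v t)).
  apply: (@rintegrable_bdd _ _ (expR M)); first by apply: rmeas_exp; exact: rmeasN.
  by move=> t _; rewrite ger0_norm ?expR_ge0.
(* The L^1 error of the Poisson integral of exp u gets multiplied by exp(- v) <= exp M. *)
have eM : 0 < e / expR M by rewrite divr_gt0// expR_gt0.
have /cvgrPdist_le/(_ _ eM) := poisson_L1 ieu.
apply: filterS => m; rewrite sub0r normrN => hm.
pose H t := cexp ((- 2^-1)%:C * herg (radius m) v t).
have mH : cmeasurable H by exact: cmeasurable_herg_exp.
have HE t : normc (H t) ^+ 2 = expR (pconv m (fun s => - v s) t).
  rewrite normc_herg_exp; congr expR.
  rewrite -[RHS]add0r -(pconv_cst m 0 t) -pconvD//; last exact: rintegrable_cst.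
  rewrite (_ : (fun s => _) = fun s => 0 - v s) ?pconvB//; last exact: rintegrable_cst.
  by rewrite pconv_cst; field.
have H_le t : normc (H t) ^+ 2 <= pconv m (fun s => expR (- v s)) t.
  by rewrite HE; exact: pconv_jensen.
have H_bdd t : normc (H t) ^+ 2 <= expR M.
  apply: le_trans (H_le t) _; rewrite -[leRHS](pconv_cst m _ t).
  by apply: le_pconv => //; exact: rintegrable_cst.
have H_bdd' t : normc (H t) <= Num.sqrt (expR M).
  rewrite -ler_sqr ?nnegrE ?normc_ge0 ?sqrtr_ge0// [leRHS]sqr_sqrtr; last exact: expR_ge0.
  exact: H_bdd.
have L2pH : L2 (fun t => phi t * H t).
  have := L2Mbdd mH L2phi (fun t _ => H_bdd' t).
  by congr L2; apply/funext => t; rewrite mulrC.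
split => //.
have ip := rintegrableMpconv m ieu ienv.
have iq := rintegrableMpconv m ienv ieu.
have ix : rintegrable (fun t => expR (- v t) * expR (u t)).
  apply: (rintegrableMbdd _ ieu); first by apply: rmeas_exp; exact: rmeasN.
  by move=> t _; rewrite ger0_norm ?expR_ge0//; exact: env_le.
have iy : rintegrable (fun t => expR M * `|pconv m (fun s => expR (u s)) t - expR (u t)|).
  apply: rintegrableZ; apply: rintegrable_abs; apply: rintegrableB => //.
  exact: rintegrable_pconv.
have : nsq (fun t => phi t * H t) <= 1 + e.
  have imid : rintegrable (fun t => expR (u t) * normc (H t) ^+ 2).
    apply: ae_eq_rintegrable (L2_sqr L2pH) _.
      apply: rmeasM => //; under eq_fun do rewrite expr2.
      by apply: rmeasM; exact: rmeas_normc.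
    by apply: aec_mono ephi => t _ h; rewrite normcM exprMn h.
  have -> : nsq (fun t => phi t * H t) = rint (fun t => expR (u t) * normc (H t) ^+ 2).
    apply: ae_eq_rint (rintegrable_meas (L2_sqr L2pH)) (rintegrable_meas imid) _.
    by apply: aec_mono ephi => t _ h; rewrite normcM exprMn h.
  apply: (@le_trans _ _ (rint (fun t => expR (u t) * pconv m (fun s => expR (- v s)) t))).
    by apply: le_rint => // t _; rewrite ler_wpM2l ?expR_ge0.
  rewrite pconv_sym//; [|by move=> t _; exact: expR_ge0..].
  apply: (@le_trans _ _ (rint (fun t => expR (- v t) * expR (u t) +
      expR M * `|pconv m (fun s => expR (u s)) t - expR (u t)|))).
    apply: le_rint => //; first exact: rintegrableD.
    move=> t _; rewrite -lerBlDl -mulrBr.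
    apply: le_trans (ler_norm _) _; rewrite normrM ler_wpM2r// ger0_norm ?expR_ge0//.
  rewrite rintD// rintZ; last first.
    by apply: rintegrable_abs; apply: rintegrableB => //; exact: rintegrable_pconv.
  apply: lerD.
    rewrite -[leRHS]rint_cst; apply: le_rint => //; first exact: rintegrable_cst.
    by move=> t _; rewrite -expRD -[leRHS]expR0 ler_expR addrC subr_le0.
  rewrite mulrC -ler_pdivlMr ?expR_gt0//.
  by apply: le_trans hm; exact: ler_norm.
rewrite -sqr_norm2; have := norm2_ge0 (fun t => phi t * H t); move=> n0 h.
by rewrite -/(H _); nra.
Qed.

(** From |phi p|_2 <= 1 + 2 d and Re int phi p >= 1 - 3 d / 2, expanding the square gives |phi p -
    1|_2^2 <= (1 + 2 d)^2 + 1 - 2 (1 - 3 d / 2) = 7 d + 4 d^2 <= 11 d, since d <= 1; hence the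
    11. *)
Lemma outer_cyclic (e : R) : 0 < e ->
  exists p : {poly R[i]}, nsq (fun t => phi t * pol p t - 1) <= e.
Proof.
move=> e0; pose d := Num.min 1 (e / 11).
have d0 : 0 < d by rewrite lt_min ltr01 divr_gt0.
have /andP[d1 de] : (d <= 1) && (d <= e / 11) by rewrite -le_min.
have /cvgrPdist_le/(_ _ d0)[K _ /(_ K (leqnn K)) hK] := rint_max_cvg iu.
pose v t := Num.max (u t) (- K%:R).
have iv : rintegrable v.
  apply: (rintegrable_dom _ (rintegrableD (rintegrable_abs iu) (rintegrable_cst K%:R))).
    by apply: rmeas_max; [exact: rintegrable_meas|exact: rmeas_cst].
  move=> t _; rewrite /v maxElt; case: ltP => _.
    by rewrite normrN ger0_norm ?lerDr.
  by rewrite lerDl.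
have uv t : u t <= v t by rewrite /v le_max lexx.
have vK t : - K%:R <= v t by rewrite /v le_max lexx orbT.
have [m _ /(_ m (leqnn m)) [L2pH hm]] := small_weight iv uv vK d0.
set H := fun t => cexp ((- 2^-1)%:C * herg (radius m) v t) in L2pH hm *.
pose E := expR (2^-1 * rint u).
have E0 : 0 < E by exact: expR_gt0.
have np0 : 0 < norm2 phi + 1 by have := norm2_ge0 phi; lra.
(* The first bound makes the replacement of H by p cost at most d in norm, the second keeps the
   error of p(0) E below d. *)
pose d' := Num.min (d / (norm2 phi + 1)) (d / E).
have d'0 : 0 < d' by rewrite lt_min !divr_gt0.
have /andP[d'1 d'2] : (d' <= d / (norm2 phi + 1)) && (d' <= d / E) by rewrite -le_min.
have [p [hp hp0]] := herg_poly (- 2^-1) (radius01 m) iv d'0.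
exists p.
have L2pp := L2Mpol p L2phi.
have h1 : norm2 (fun t => phi t * pol p t) <= 1 + 2 * d.
  have mHp : cmeasurable (fun t => H t - pol p t).
    apply: (cmeasurableD (cmeasurable_herg_exp _ _ iv)).
    by apply: cmeasurableN; exact: cmeasurable_pol.
  have hHp : forall t, circle R t -> normc (H t - pol p t) <= d' by move=> t _; exact: hp.
  have L2d := L2Mbdd mHp L2phi hHp.
  have nd := norm2Mbdd (ltW d'0) mHp L2phi hHp.
  rewrite (eq_norm2 (v := fun t => phi t * H t - (H t - pol p t) * phi t)); last first.
    by move=> t _; congr normc; ring.
  apply: le_trans (norm2B L2pH L2d) _.
  have : d' * norm2 phi <= d.
    have -> : d = d / (norm2 phi + 1) * (norm2 phi + 1) by rewrite divfK// gt_eqF.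
    by rewrite ler_pM ?norm2_ge0 ?(ltW d'0)// lerDl.
  by rewrite /H in hm nd *; lra.
have h2 : nsq (fun t => phi t * pol p t) <= (1 + 2 * d) ^+ 2.
  by rewrite -sqr_norm2 lerXn2r ?nnegrE ?norm2_ge0//; lra.
have h3 : cint (fun t => phi t * pol p t) = p.[0] * E%:C.
  by rewrite cint_H2Mpol// (cint_outer phiH2 phiu).
(* Truncation raises the integral of u by at most d, so exp((int u - int v) / 2) >= 1 - d / 2; the
   remaining d is the error of p(0) E. *)
have h4 : 1 - 3 / 2 * d <= complex.Re (p.[0] * E%:C).
  rewrite Re_cM /= mulr0 subr0.
  have : expR (- 2^-1 * rint v) - d' <= complex.Re p.[0].
    rewrite lerBlDr -lerBlDl; apply: le_trans hp0.
    apply: le_trans (abs_Re_le _); rewrite Re_cD Re_cN /=; exact: ler_norm.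
  move=> /(ler_wpM2r (ltW E0)); apply: le_trans.
  rewrite mulrBl /E -expRD -/E.
  have hd : d' * E <= d by rewrite -ler_pdivlMr.
  have := expR_ge1Dx (- 2^-1 * rint v + 2^-1 * rint u).
  have : rint v - rint u <= d.
    by apply: le_trans hK; rewrite distrC; exact: ler_norm.
  lra.
have := nsqD L2pp (L2N (L2_cst (1 : R[i]))).
have -> : nsq (fun=> - (1 : R[i])) = 1.
  by rewrite nsqN /nsq normc1 expr1n rint_cst.
have -> : inner (fun t => phi t * pol p t) (fun=> - (1 : R[i])) =
    - cint (fun t => phi t * pol p t).
  rewrite -cintN; last exact: L2_cint.
  apply: eq_cint => t _; rewrite -[LHS]/(phi t * pol p t * conjc (- 1)).
  by rewrite rmorphN rmorph1 mulrN1.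
move=> ->; rewrite h3 Re_cN.
by have : d * d <= d; nra.
Qed.

End Cyclic.

(** * Density of coanalytic polynomials *)

Section TrigDensity.
Context {R : realType}.
Implicit Types (p q : {poly R[i]}) (w : R -> R[i]) (b : R -> R).

Lemma nsq_real b : nsq (fun t => (b t)%:C) = rint (fun t => b t ^+ 2).
Proof. by apply: eq_rint => t _; rewrite normc_real real_normK ?num_real. Qed.

Lemma L2_real b : rmeas b -> rintegrable (fun t => b t ^+ 2) -> L2 (fun t => (b t)%:C).
Proof.
move=> mb ib; apply: (L2_dom (cmeasurable_real mb) ib) => t _.
by rewrite normc_real real_normK ?num_real.
Qed.

Lemma norm2_le_of_nsq w (e : R) : 0 <= e -> nsq w <= e ^+ 2 -> norm2 w <= e.
Proof. by move=> e0 h; rewrite -ler_sqr ?nnegrE ?norm2_ge0// sqr_norm2. Qed.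

(** For bounded b the L^1 convergence of Poisson integrals upgrades to L^2, as |b - P b|^2 <= (2 M +
    1) |b - P b|. The Poisson integral is the real part of a Herglotz integral, hence uniformly
    close to that of a partial sum, and half of this sum is the p sought. *)
Lemma trig_dense_real_bdd b (M e : R) : rmeas b -> (forall t, `|b t| <= M) -> 0 < e ->
  exists p, norm2 (fun t => (b t)%:C - (pol p t + conjc (pol p t))) <= e.
Proof.
move=> mb bM e0.
have ib : rintegrable b by exact: (rintegrable_bdd mb (fun t _ => bM t)).
have M0 : 0 <= M by exact: le_trans (normr_ge0 _) (bM 0).
pose d := (e / 2) ^+ 2 / (2 * M + 1).
have d0 : 0 < d by rewrite divr_gt0 ?exprn_gt0 ?divr_gt0//; lra.
have /cvgrPdist_le/(_ _ d0)[m _ /(_ m (leqnn m))] := poisson_L1 ib.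
rewrite sub0r normrN => /(le_trans (ler_norm _)) hm.
have mP := rmeas_pconv m ib.
have PM t : `|pconv m b t| <= M.
  apply: le_trans (pconv_abs _ _ ib) _; rewrite -[leRHS](pconv_cst m M t).
  by apply: le_pconv => //; [exact: rintegrable_abs|exact: rintegrable_cst].
have iPb : rintegrable (fun t => `|pconv m b t - b t|).
  by apply: rintegrable_abs; apply: rintegrableB => //; exact: rintegrable_pconv.
have sq_le t : (b t - pconv m b t) ^+ 2 <= (2 * M + 1) * `|pconv m b t - b t|.
  rewrite -[leLHS]real_normK ?num_real// expr2 distrC ler_wpM2r//.
  by apply: le_trans (ler_normB _ _) _; have := PM t; have := bM t; lra.
have mbP : rmeas (fun t => b t - pconv m b t) by exact: rmeasB.
have isq : rintegrable (fun t => (b t - pconv m b t) ^+ 2).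
  apply: (rintegrable_dom _ (rintegrableZ (2 * M + 1) iPb)).
    by under eq_fun do rewrite expr2; apply: rmeasM.
  by move=> t _; rewrite ger0_norm ?sqr_ge0.
have L2bP := L2_real mbP isq.
have h1 : norm2 (fun t => (b t - pconv m b t)%:C) <= e / 2.
  apply: norm2_le_of_nsq; first by rewrite divr_ge0// ltW.
  rewrite nsq_real; apply: (@le_trans _ _ (rint (fun t => (2 * M + 1) * `|pconv m b t - b t|))).
    by apply: le_rint => //; exact: rintegrableZ.
  rewrite rintZ// mulrC -ler_pdivlMr//; lra.
have [N hN] := exists_geom_lt (2 / (1 - radius m) * rint (fun s => `|b s|)) (radius01 m)
  (divr_gt0 e0 (ltr0n R 2)).
pose P := \poly_(k < N.+1) herg_coef (radius m) b k.
have PE t : pol P t = herg_sum (radius m) b N t.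
  by rewrite /pol horner_poly; apply: eq_bigr => k _; rewrite efunX.
pose p := (2^-1)%:C *: P; exists p.
have pE t : pol p t + conjc (pol p t) = (complex.Re (herg_sum (radius m) b N t))%:C.
  rewrite /pol hornerZ -/(pol P t) PE; case: (herg_sum _ _ _ _) => x y.
  by apply: eq_ReIm => /=; field.
have h2 t : normc ((pconv m b t)%:C - (pol p t + conjc (pol p t))) <= e / 2.
  rewrite pE /pconv -(Re_herg (radius01 m)) -rmorphB/= normc_real.
  have -> : complex.Re (herg (radius m) b t) - complex.Re (herg_sum (radius m) b N t) =
    complex.Re (herg (radius m) b t - herg_sum (radius m) b N t) by rewrite Re_cD Re_cN.
  apply: le_trans (abs_Re_le _) _.
  exact: le_trans (herg_err (radius01 m) N t ib) (ltW hN).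
have mq : cmeasurable (fun t => pol p t + conjc (pol p t)).
  by apply: cmeasurableD; [exact: cmeasurable_pol|exact/cmeasurableJ/cmeasurable_pol].
have mr : cmeasurable (fun t => (pconv m b t)%:C - (pol p t + conjc (pol p t))).
  by apply: (cmeasurableD (cmeasurable_real mP)); exact: cmeasurableN.
rewrite (eq_norm2 (v := fun t => (b t - pconv m b t)%:C +
   ((pconv m b t)%:C - (pol p t + conjc (pol p t))))); last first.
  by move=> t _; congr normc; rewrite rmorphB/=; ring.
apply: le_trans (norm2D L2bP (L2_bdd mr (fun t _ => h2 t))) _.
have := norm2_bdd (_ : 0 <= e / 2) (fun t _ => h2 t) mr.
by rewrite divr_ge0 ?(ltW e0)// => /(_ isT); lra.
Qed.

(** Truncation at height n reduces to the bounded case, with dominated convergence of the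
    squares. *)
Lemma trig_dense_real b (e : R) : rmeas b -> rintegrable (fun t => b t ^+ 2) -> 0 < e ->
  exists p, norm2 (fun t => (b t)%:C - (pol p t + conjc (pol p t))) <= e.
Proof.
move=> mb ib e0.
pose bn (n : nat) t := Num.max (Num.min (b t) n%:R) (- n%:R).
have bn_abs n t : `|bn n t| <= n%:R.
  have n0 : 0 <= n%:R :> R by [].
  rewrite ler_norml /bn le_max lexx orbT/= ge_max ge_min lexx orbT/=; lra.
have bn_sub n t : `|b t - bn n t| <= `|b t|.
  have n0 : 0 <= n%:R :> R by [].
  rewrite /bn minElt maxElt.
  case: (ltP (b t)) => h1; case: ltP => h2; case: (ger0P (b t)) => h3;
    rewrite ?subrr ?normr0//; try lra.
  - by rewrite ler0_norm; lra.
  - by rewrite ger0_norm; lra.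
have mbn n : rmeas (bn n).
  by apply: rmeas_max; [apply: rmeas_min => //; exact: rmeas_cst|exact: rmeas_cst].
have e2 : 0 < e / 2 by rewrite divr_gt0.
have e22 : 0 < (e / 2) ^+ 2 by rewrite exprn_gt0.
have sq_le n t : (b t - bn n t) ^+ 2 <= b t ^+ 2.
  by rewrite -[leLHS]real_normK ?num_real// -[leRHS]real_normK ?num_real// lerXn2r ?nnegrE.
have msq n : rmeas (fun t => (b t - bn n t) ^+ 2).
  by under eq_fun do rewrite expr2; apply: rmeasM; exact: rmeasB.
have isq n : rintegrable (fun t => (b t - bn n t) ^+ 2).
  by apply: (rintegrable_dom _ ib) => // t _; rewrite ger0_norm ?sqr_ge0.
have : rint (fun t => (b t - bn n t) ^+ 2) @[n --> \oo] --> rint (fun=> 0 : R).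
  apply: (rint_cvg_dom _ _ ib) => //; first exact: rmeas_cst.
    by move=> n t _; rewrite ger0_norm ?sqr_ge0.
  apply: aecW => t _; apply/cvgrPdist_le => d d0; near=> n.
  have h : `|b t| <= n%:R by near: n; exact: nbhs_infty_ger.
  have -> : bn n t = b t.
    move: h; rewrite ler_norml => /andP[h1 h2].
    by rewrite /bn min_l// max_l.
  by rewrite subrr expr2 mul0r subrr normr0 ltW.
rewrite rint_cst => /cvgrPdist_le/(_ _ e22)[n _ /(_ n (leqnn n))].
rewrite sub0r normrN => /(le_trans (ler_norm _)) hn.
have [p hp] := trig_dense_real_bdd (mbn n) (bn_abs n) e2.
exists p.
have L2a := L2_real (rmeasB mb (mbn n)) (isq n).
have L2b : L2 (fun t => (bn n t)%:C - (pol p t + conjc (pol p t))).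
  apply: L2B; last by apply: L2D; [exact: L2_pol|exact/L2J/L2_pol].
  by apply: (@L2_bdd _ _ n%:R); [exact: cmeasurable_real|move=> t _; rewrite normc_real].
rewrite (eq_norm2 (v := fun t => (b t - bn n t)%:C +
   ((bn n t)%:C - (pol p t + conjc (pol p t))))); last first.
  by move=> t _; congr normc; rewrite rmorphB/=; ring.
apply: le_trans (norm2D L2a L2b) _.
have : norm2 (fun t => (b t - bn n t)%:C) <= e / 2.
  by apply: norm2_le_of_nsq; [exact: ltW|rewrite nsq_real].
lra.
Unshelve. all: by end_near. Qed.

Lemma trig_dense w (e : R) : L2 w -> 0 < e ->
  exists p q, norm2 (fun t => w t - (pol p t + conjc (pol q t))) <= e.
Proof.
move=> hw e0.
have [mw1 mw2] := L2_meas hw.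
have e2 : 0 < e / 2 by rewrite divr_gt0.
have i1 : rintegrable (fun t => complex.Re (w t) ^+ 2).
  apply: (rintegrable_dom _ (L2_sqr hw)).
    by under eq_fun do rewrite expr2; apply: rmeasM.
  by move=> t _; rewrite ger0_norm ?sqr_ge0// sqr_normc_ReIm lerDl sqr_ge0.
have i2 : rintegrable (fun t => complex.Im (w t) ^+ 2).
  apply: (rintegrable_dom _ (L2_sqr hw)).
    by under eq_fun do rewrite expr2; apply: rmeasM.
  by move=> t _; rewrite ger0_norm ?sqr_ge0// sqr_normc_ReIm lerDr sqr_ge0.
have [p1 h1] := trig_dense_real mw1 i1 e2.
have [p2 h2] := trig_dense_real mw2 i2 e2.
(* The sign changes in the second polynomial because it enters conjugated. *)
exists (p1 + 'i%C *: p2), (p1 - 'i%C *: p2).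
have L2p p : L2 (fun t => pol p t + conjc (pol p t)).
  by apply: L2D; [exact: L2_pol|exact/L2J/L2_pol].
have L2a := L2B (L2_real mw1 i1) (L2p p1).
have L2b := L2B (L2_real mw2 i2) (L2p p2).
rewrite (eq_norm2 (v := fun t =>
   ((complex.Re (w t))%:C - (pol p1 t + conjc (pol p1 t))) +
   'i%C * ((complex.Im (w t))%:C - (pol p2 t + conjc (pol p2 t))))); last first.
  move=> t _; congr normc; rewrite /pol hornerD hornerD hornerN !hornerZ.
  rewrite -/(pol p1 t) -/(pol p2 t).
  case: (w t) => a b; case: (pol p1 t) => c d; case: (pol p2 t) => x y.
  by apply: eq_ReIm => /=; ring.
apply: le_trans (norm2D L2a (L2Z _ L2b)) _; rewrite norm2Z//.
have -> : normc ('i%C : R[i]) = 1 by rewrite /normc expr1n expr0n add0r sqrtr1.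
lra.
Qed.

End TrigDensity.

(** * Approximation in the orthogonal complement of H^2 *)

Section CoanalyticDensity.
Context {R : realType}.
Implicit Types (p q s : {poly R[i]}) (w : R -> R[i]).

Lemma polM p q t : pol (p * q) t = pol p t * pol q t :> R[i].
Proof. exact: hornerM. Qed.

Lemma polD p q t : pol (p + q) t = pol p t + pol q t :> R[i].
Proof. exact: hornerD. Qed.

Lemma polX t : pol 'X t = efun 1 t :> R[i].
Proof. exact: hornerX. Qed.

Lemma polC c t : pol c%:P t = c :> R[i].
Proof. exact: hornerC. Qed.

Lemma inner_pol_eq0 w p : L2 w -> (forall k : nat, inner w (efun k%:Z) = 0) ->
  inner w (pol p) = 0.
Proof.
move=> hw w0; rewrite (_ : pol p = fun t => \sum_(k < size p) p`_k * efun (k : nat)%:Z t).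
  rewrite inner_sumr//; last by move=> k _; apply: L2Z; exact: L2_efun.
  by apply: big1 => k _; rewrite innerZr ?w0 ?mulr0//; exact: L2_efun.
by apply/funext => t; exact: polE.
Qed.

(** In an approximation p + conj(q), split q = X s + q(0). The analytic part p + conj(q(0)) is
    orthogonal to w - conj(X s), so by Pythagoras dropping it does not increase the distance. *)
Lemma coanalytic_dense w (e : R) : L2 w -> (forall k : nat, inner w (efun k%:Z) = 0) ->
  0 < e -> exists s, norm2 (fun t => w t - conjc (pol ('X * s) t)) <= e.
Proof.
move=> hw w0 e0; have [p [q h]] := trig_dense hw e0.
have [s qE] : exists s, q = 'X * s + (q.[0])%:P.
  have /factor_theorem [s qs] : root (q - (q.[0])%:P) 0 by rewrite /root !hornerE subrr.
  by exists s; rewrite mulrC -['X]subr0 -[X in 'X - X]polyC0 -qs subrK.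
exists s; apply: le_trans h.
pose pp := p + (conjc q.[0])%:P.
have L2N' : L2 (fun t => w t - conjc (pol ('X * s) t)).
  by apply: L2B => //; apply: L2J; exact: L2_pol.
have L2P' := L2N (L2_pol pp).
rewrite -ler_sqr ?nnegrE ?norm2_ge0// !sqr_norm2.
rewrite [leRHS](eq_nsq (v := fun t => (w t - conjc (pol ('X * s) t)) + (- pol pp t))); last first.
  move=> t _; congr normc; rewrite {1}qE /pp !polD !polC conjcD opprD; ring.
rewrite [leRHS](nsqD L2N' L2P') [nsq (fun t => - pol pp t)]nsqN.
have -> : inner (fun t => w t - conjc (pol ('X * s) t)) (fun t => - pol pp t) = 0.
  rewrite (eq_inner (u' := fun t => w t - conjc (pol ('X * s) t))
    (v' := fun t => (-1) * pol pp t))//; last by move=> t _; rewrite mulN1r.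
  rewrite innerZr//; last exact: L2_pol.
  rewrite innerBl//; [|exact/L2J/L2_pol|exact: L2_pol].
  rewrite inner_pol_eq0// sub0r.
  have -> : inner (fun t => conjc (pol ('X * s) t)) (pol pp) =
      cint (cconj (pol ('X * s * pp))).
    by apply: eq_cint => t _; rewrite /= /cconj (polM ('X * s) pp) conjcM.
  rewrite cintJ; last exact/L2_cint/L2_pol.
  by rewrite cint_pol !hornerM hornerX !mul0r conjc0 oppr0 mulr0.
by rewrite mulr0 addr0 lerDl nsq_ge0.
Qed.

(** Replacing s by s p with phi p close to 1 changes conj(X s) by at most sup |X s| times |phi p -
    1|_2. *)
Lemma outer_coanalytic_dense (phi : R -> R[i]) u w (e : R) :
  H2 phi -> outer_log phi u -> L2 w ->
  (forall k : nat, inner w (efun k%:Z) = 0) -> 0 < e ->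
  exists s, norm2 (fun t => w t - conjc (phi t * pol ('X * s) t)) <= e.
Proof.
move=> phiH2 phiu hw w0 e0.
have e2 : 0 < e / 2 by rewrite divr_gt0.
have [s hs] := coanalytic_dense hw w0 e2.
have [M M0 hM] := pol_bdd ('X * s).
have d0 : 0 < e / 2 / (M + 1) by rewrite divr_gt0//; lra.
have d20 : 0 < (e / 2 / (M + 1)) ^+ 2 by rewrite exprn_gt0.
have [p hp] := outer_cyclic phiH2 phiu d20.
exists (s * p).
have L2phi : L2 phi by case: phiH2.
have L2d : L2 (fun t => phi t * pol p t - 1) by apply: L2B; [exact: L2Mpol|exact: L2_cst].
have nd : norm2 (fun t => phi t * pol p t - 1) <= e / 2 / (M + 1).
  by apply: norm2_le_of_nsq => //; exact: ltW.
have L2a : L2 (fun t => w t - conjc (pol ('X * s) t)).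
  by apply: L2B => //; apply: L2J; exact: L2_pol.
have hM' : forall t, circle R t -> normc (pol ('X * s) t) <= M by move=> t _; exact: hM.
have L2b := L2Mbdd (cmeasurable_pol ('X * s)) L2d hM'.
have nb := norm2Mbdd M0 (cmeasurable_pol ('X * s)) L2d hM'.
rewrite (eq_norm2 (v := fun t => (w t - conjc (pol ('X * s) t)) -
   cconj (fun t => pol ('X * s) t * (phi t * pol p t - 1)) t)); last first.
  move=> t _; congr normc; rewrite /cconj mulrA (polM ('X * s) p).
  have -> : phi t * (pol ('X * s) t * pol p t) =
    pol ('X * s) t + pol ('X * s) t * (phi t * pol p t - 1) by ring.
  by rewrite conjcD opprD addrA.
apply: le_trans (norm2B L2a (L2J L2b)) _; rewrite norm2J.
have : M * norm2 (fun t => phi t * pol p t - 1) <= e / 2.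
  have -> : e / 2 = (M + 1) * (e / 2 / (M + 1)) by field; rewrite gt_eqF//; lra.
  by rewrite ler_pM ?norm2_ge0// lerDl.
lra.
Qed.

End CoanalyticDensity.

(** * Gram determinants *)

Section CoanalyticFamily.
Context {R : realType}.
Implicit Types (p q : {poly R[i]}) (chi : R -> R[i]).

(* Position [l] of the family e_{-(n+1)}, ..., e_{-1}. *)
Definition negexp (n : nat) (l : 'I_n.+1) (t : R) : R[i] := efun ((l : nat)%:Z - n.+1%:Z) t.

Lemma conjc_pol_negexp n q chi t : (size q <= n.+1)%N ->
  conjc (chi t * pol ('X * q) t) =
  \sum_(l < n.+1) conjc q`_(n - l) * (negexp l t * conjc (chi t)).
Proof.
move=> sq; rewrite polM polX conjcM /pol (horner_coef_wide _ sq).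
rewrite [conjc (efun 1 t * _)]conjcM; set e1 := conjc (efun 1 t).
rewrite rmorph_sum/= !mulr_sumr (reindex_inj rev_ord_inj)/=.
apply: eq_bigr => l _; rewrite subSS efunX conjcM.
have -> : negexp l t = conjc (efun 1 t) * conjc (efun (n - l)%N t).
  have ln : (l <= n)%N by rewrite -ltnS.
  rewrite -!efunN -efunD /negexp; congr efun.
  by rewrite -subzn// (intS n); ring.
by rewrite -/e1; ring.
Qed.

(* Conjugating e_{l-(n+1)} = conj(e_1 e_{n-l}) reverses the order of the
   coefficients. *)
Definition negpoly n (c : 'I_n.+1 -> R[i]) : {poly R[i]} :=
  \poly_(k < n.+1) conjc (c (inord (n - k))).

Lemma size_negpoly n (c : 'I_n.+1 -> R[i]) : (size (negpoly c) <= n.+1)%N.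
Proof. exact: size_poly. Qed.

Lemma coef_negpoly n (c : 'I_n.+1 -> R[i]) (l : 'I_n.+1) :
  conjc (negpoly c)`_(n - l) = c l.
Proof.
rewrite coef_poly ltnS leq_subr conjcK subKn ?inord_val//.
by rewrite -ltnS.
Qed.

Lemma sum_negexp n (c : 'I_n.+1 -> R[i]) chi t :
  \sum_(l < n.+1) c l * (negexp l t * conjc (chi t)) =
  conjc (chi t * pol ('X * negpoly c) t).
Proof.
rewrite (conjc_pol_negexp _ _ (size_negpoly c)).
by apply: eq_bigr => l _; rewrite coef_negpoly.
Qed.

Lemma trigpoly_pol n q : (size q <= n.+1)%N -> trigpoly n (pol q).
Proof.
move=> sq; exists (fun k => q`_k); apply/funext => t.
by rewrite /pol (horner_coef_wide _ sq); apply: eq_bigr => k _; rewrite efunX.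
Qed.

Lemma trigpolyP n (T : R -> R[i]) : trigpoly n T ->
  exists2 q : {poly R[i]}, (size q <= n.+1)%N & T = pol q.
Proof.
move=> [c ->]; exists (\poly_(k < n.+1) c (inord k)); first exact: size_poly.
apply/funext => t; rewrite /pol horner_poly; apply: eq_bigr => k _.
by rewrite efunX inord_val.
Qed.

(** The polynomial vanishes a.e. on the circle since chi does not, and its coefficients are inner
    products with the e_k. *)
Lemma pol_eq0 q chi : L2 chi -> aec (fun t => chi t != 0) ->
  norm2 (fun t => chi t * pol q t) = 0 -> q = 0.
Proof.
move=> hchi chi0 n0.
have L2q := L2_pol q.
have q0 : norm2 (pol q) = 0.
  have : nsq (fun t => chi t * pol q t) = 0 by rewrite -sqr_norm2 n0 expr2 mul0r.
  move=> /(nsq_eq0 (L2Mpol q hchi)) h.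
  have -> : norm2 (pol q) = Num.sqrt (rint (fun=> 0 : R)).
    congr Num.sqrt; apply: ae_eq_rint; [exact: rintegrable_meas (L2_sqr L2q)|exact: rmeas_cst|].
    apply: aec_mono (aec_and chi0 h) => t _ [c0 /eqP].
    by rewrite mulf_eq0 (negbTE c0)/= => /eqP ->; rewrite normc0 expr2 mul0r.
  by rewrite rint_cst sqrtr0.
apply/polyP => k; rewrite coef0.
have [sk|ks] := leqP (size q) k; first by rewrite nth_default.
have : inner (pol q) (efun k%:Z) = 0.
  apply/eq0_normc/eqP; rewrite eq_le normc_ge0 andbT.
  by apply: le_trans (cauchy_schwarz L2q (L2_efun _)) _; rewrite q0 mul0r.
rewrite (eq_inner (u' := fun t => \sum_(l < size q) q`_l * efun (l : nat)%:Z t)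
  (v' := efun k%:Z))//; last by move=> t _; exact: polE.
rewrite inner_suml; [|by move=> l _; apply: L2Z; exact: L2_efun|exact: L2_efun].
have E (l : nat) : inner (efun l%:Z) (efun k%:Z) = (l == k)%:R :> R[i].
  rewrite /inner (eq_cint (v := efun (l%:Z - k%:Z))).
    by rewrite cint_efun subr_eq0.
  by move=> t _; rewrite /= /cconj -efunN -efunD.
rewrite (bigD1 (Ordinal ks))//= innerZl ?E ?eqxx ?mulr1; [|exact: L2_efun..].
rewrite big1 ?addr0// => l lk; rewrite innerZl ?E; [|exact: L2_efun..].
by rewrite -(inj_eq val_inj)/= in lk; rewrite (negbTE lk) mulr0.
Qed.

End CoanalyticFamily.

(** * Schur complements and continuity of the determinant *)

Section Determinants.

Lemma det_schur (K : comUnitRingType) (n1 n2 : nat) (A : 'M[K]_n1) (B : 'M[K]_(n1, n2))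
  (C : 'M[K]_(n2, n1)) (D : 'M[K]_n2) : A \in unitmx ->
  \det (block_mx A B C D) = \det A * \det (D - C *m invmx A *m B).
Proof.
move=> uA.
have -> : block_mx A B C D =
    block_mx 1%:M 0 (C *m invmx A) 1%:M *m block_mx A B 0 (D - C *m invmx A *m B).
  by rewrite mulmx_block !mul1mx !mul0mx !addr0 mulmxKV// addrC subrK.
by rewrite det_mulmx det_lblock det_ublock !det1 !mul1r.
Qed.

Lemma cvg_det (K : numFieldType) (n : nat) (E : nat -> 'I_n -> 'I_n -> K)
    (L : 'I_n -> 'I_n -> K) :
  (forall j k, (E m j k : K^o) @[m --> \oo] --> (L j k : K^o)) ->
  (\det (\matrix_(j, k) E m j k) : K^o) @[m --> \oo] -->
    (\det (\matrix_(j, k) L j k) : K^o).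
Proof.
move=> EL; rewrite /determinant.
have cprod (s : {perm 'I_n}) (l : seq 'I_n) :
    (\prod_(i <- l) (\matrix_(j, k) E m j k) i (s i) : K^o) @[m --> \oo] -->
    (\prod_(i <- l) (\matrix_(j, k) L j k) i (s i) : K^o).
  elim: l => [|i l IH].
    under eq_fun do rewrite big_nil; rewrite big_nil; exact: cvg_cst.
  under eq_fun do rewrite big_cons mxE; rewrite big_cons mxE.
  exact: (cvgM (EL i (s i)) IH).
elim: (index_enum _) => [|s l IH].
  under eq_fun do rewrite big_nil; rewrite big_nil; exact: cvg_cst.
under eq_fun do rewrite big_cons; rewrite big_cons.
exact: (cvgD (cvgM (cvg_cst _) (cprod s _)) IH).
Qed.

End Determinants.

(** * The oblique projection and its convergence *)

Section Main.
Context {R : realType}.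
Implicit Types (q : {poly R[i]}) (chi : R -> R[i]).
Variables (phi psi : R -> R[i]) (uphi upsi : R -> R).
Hypotheses (phiH2 : H2 phi) (psiH2 : H2 psi)
  (phiu : outer_log phi uphi) (psiu : outer_log psi upsi).

Let L2phi : L2 phi. Proof. by case: phiH2. Qed.
Let L2psi : L2 psi. Proof. by case: psiH2. Qed.

Variables (eps : R) (n0 : nat).
Hypotheses (eps0 : 0 < eps) (angle : forall n : nat, (n0 <= n)%N ->
     forall S : R -> R[i], trigpoly n S ->
     exists T : R -> R[i],
       [/\ trigpoly n T, T <> (fun=> 0) &
           (eps * norm2 (phi \* S) * norm2 (psi \* T))%:C
             <= inner (phi \* S) (psi \* T)]).

(* The elements of conj(chi) span(e_{-n}, ..., e_{-1}) are these with [size q <= n]. *)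
Definition coanalytic (chi : R -> R[i]) (q : {poly R[i]}) (t : R) : R[i] :=
  conjc (chi t * pol ('X * q) t).

Let L2_coanalytic chi q : L2 chi -> L2 (coanalytic chi q).
Proof. by move=> h; apply: L2J; exact: L2Mpol. Qed.

Let norm2_coanalytic chi q : norm2 (coanalytic chi q) = norm2 (fun t => chi t * pol q t).
Proof.
apply: eq_norm2 => t _; rewrite /coanalytic normc_conjc polM polX.
by rewrite normcM [normc (efun 1 t * _)]normcM normc_efun mul1r normcM.
Qed.

(** Multiplication by e_1 followed by conjugation preserves norms, conjugates inner products, and
    carries phi Poly_n onto conj(phi) span(e_{-(n+1)}, ..., e_{-1}), likewise for psi. *)
Lemma angle_coanalytic n q : (n0 <= n)%N -> (size q <= n.+1)%N ->
  exists q' : {poly R[i]}, [/\ (size q' <= n.+1)%N, 0 < norm2 (coanalytic psi q') &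
    eps * norm2 (coanalytic phi q) * norm2 (coanalytic psi q') <=
    normc (inner (coanalytic phi q) (coanalytic psi q'))].
Proof.
move=> n0n sq; have [T [/trigpolyP [q' sq' ->] T0 h]] := angle n0n (trigpoly_pol sq).
exists q'; split => //.
  (* T is nonzero as a function; as psi is nonzero a.e., psi T is also nonzero in L^2, which allows
     division by its norm. *)
  rewrite lt_def norm2_ge0 andbT; apply/eqP; rewrite norm2_coanalytic => h0.
  apply: T0; rewrite (pol_eq0 L2psi (outer_neq0 psiu) h0).
  by apply/funext => t; rewrite /pol horner0.
have -> : normc (inner (coanalytic phi q) (coanalytic psi q')) =
   normc (inner (phi \* pol q) (psi \* pol q')).
  rewrite -[RHS]normc_conjc -innerJ; [|exact: L2Mpol..]; congr normc.
  apply: eq_cint => t _; rewrite /cconj /coanalytic /= !polM !polX conjcK.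
  have e1 := efun_conjM 1 t.
  move: (phi t) (psi t) (pol q t) (pol q' t) (efun 1 t) e1 => a b c d e e1.
  by rewrite !conjcM -[RHS]mulr1 -e1; ring.
rewrite !norm2_coanalytic; apply: le_trans (le_trans (ler_norm _) (abs_Re_le _)).
by move: h; rewrite lecE /= => /andP[_].
Qed.

Lemma L2_negexp n (l : 'I_n.+1) chi : L2 chi -> L2 (fun t => negexp l t * conjc (chi t)).
Proof.
move=> h; apply: (@L2Mbdd _ _ _ 1); [exact: cmeasurable_efun|exact: L2J|].
by move=> t _; rewrite normc_efun.
Qed.

Lemma coanalytic_negpoly n (c : 'I_n.+1 -> R[i]) chi t :
  coanalytic chi (negpoly c) t = \sum_(l < n.+1) c l * (negexp l t * conjc (chi t)).
Proof. by rewrite /coanalytic -sum_negexp. Qed.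

Lemma inner_coanalytic_eq0 n q (z : R -> R[i]) : L2 z -> (size q <= n.+1)%N ->
  (forall l : 'I_n.+1, inner z (fun t => negexp l t * conjc (psi t)) = 0) ->
  inner z (coanalytic psi q) = 0.
Proof.
move=> hz sq z0.
rewrite (eq_inner (u' := z) (v' := fun t =>
  \sum_(l < n.+1) conjc q`_(n - l) * (negexp l t * conjc (psi t))))//; last first.
  by move=> t _; rewrite /coanalytic (conjc_pol_negexp _ _ sq).
rewrite inner_sumr//; last by move=> l _; exact/L2Z/L2_negexp.
by apply: big1 => l _; rewrite innerZr ?z0 ?mulr0//; exact: L2_negexp.
Qed.

Lemma H2_efun (k : nat) : H2 (efun k%:Z : R -> R[i]).
Proof.
split; first exact: L2_efun.
move=> n n_lt0; rewrite /inner (eq_cint (v := efun (k%:Z - n))); last first.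
  by move=> t _; rewrite /= /cconj -efunN -efunD.
rewrite cint_efun subr_eq0; case: eqP => // kn.
by move: n_lt0; rewrite -kn.
Qed.

(** Such a w is an L^2 limit of functions conj(X s), and these are orthogonal to F because F X s has
    mean zero. *)
Lemma H2_perp (F w : R -> R[i]) : H2 F -> L2 w -> (forall k : nat, inner w (efun k%:Z) = 0) ->
  inner F w = 0.
Proof.
move=> hF hw w0; have L2F : L2 F by case: hF.
apply/eq0_normc/eqP; rewrite eq_le normc_ge0 andbT; apply/ler_addgt0Pl => e e0.
rewrite addr0.
have nF : 0 < norm2 F + 1 by have := norm2_ge0 F; lra.
have [s hs] := coanalytic_dense hw w0 (divr_gt0 e0 nF).
have L2s : L2 (fun t => conjc (pol ('X * s) t)) by exact/L2J/L2_pol.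
have L2d := L2B hw L2s.
rewrite (eq_inner (u' := F) (v' := fun t => (w t - conjc (pol ('X * s) t)) +
  conjc (pol ('X * s) t)))//; last by move=> t _; rewrite subrK.
rewrite innerDr//.
have -> : inner F (fun t => conjc (pol ('X * s) t)) = 0.
  rewrite /inner (eq_cint (v := fun t => F t * pol ('X * s) t)); last first.
    by move=> t _; rewrite /= /cconj conjcK.
  by rewrite cint_H2Mpol// hornerM hornerX !mul0r.
rewrite addr0; apply: le_trans (cauchy_schwarz L2F L2d) _.
have -> : e = (norm2 F + 1) * (e / (norm2 F + 1)) by field; rewrite gt_eqF.
by rewrite ler_pM ?norm2_ge0// lerDl.
Qed.

(** The product psi X q e_k has mean zero for k >= 0 since psi is in H^2. This is the vanishing of
    Q_n on H^2. *)
Lemma H2_perp_coanalytic (F : R -> R[i]) q : H2 F -> inner F (coanalytic psi q) = 0.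
Proof.
move=> hF; apply: H2_perp => //; first exact: L2_coanalytic.
move=> k; have -> : inner (coanalytic psi q) (efun k%:Z) =
    cint (cconj (fun t => psi t * pol ('X * q * 'X^k) t)).
  apply: eq_cint => t _; rewrite /= /cconj /coanalytic -conjcM; congr conjc.
  by rewrite (polM ('X * q)) {3}/pol hornerXn efunX mulrA.
rewrite cintJ; last exact/L2_cint/L2Mpol.
by rewrite cint_H2Mpol// !hornerM hornerX !mul0r conjc0.
Qed.

(** The matrix of D_n(mu), of size n + 1: it belongs to the indices -(n+1), ..., -1. *)
Definition gram (n : nat) : 'M[R[i]]_n.+1 := \matrix_(j, k)
  inner (fun t => negexp j t * conjc (phi t)) (fun t => negexp k t * conjc (psi t)).

(** A left kernel vector y gives an element of conj(phi) span(e_{-(n+1)}, ..., e_{-1}) orthogonal to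
    the whole span with psi, in particular to its partner from the angle condition; so its norm is
    0, and y = 0 because phi is nonzero a.e. *)
Lemma gram_unit n : (n0 <= n)%N -> gram n \in unitmx.
Proof.
move=> n0n; rewrite unitmxE unitfE; apply/negP => /det0P [y /negP y0 yA]; apply: y0.
pose q := negpoly (y 0).
have sq : (size q <= n.+1)%N := size_negpoly _.
have [q' [sq' w0 h]] := angle_coanalytic n0n sq.
have x0 (l : 'I_n.+1) : inner (coanalytic phi q) (fun t => negexp l t * conjc (psi t)) = 0.
  rewrite (eq_inner (u' := fun t => \sum_(j < n.+1) y 0 j * (negexp j t * conjc (phi t)))
    (v' := fun t => negexp l t * conjc (psi t)))//; last by move=> t _; rewrite coanalytic_negpoly.
  rewrite inner_suml; [|by move=> j _; exact/L2Z/L2_negexp|exact: L2_negexp].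
  have hy := congr1 (fun M : 'rV_n.+1 => M 0 l) yA; rewrite !mxE in hy.
  rewrite -[RHS]hy.
  by apply: eq_bigr => j _; rewrite innerZl ?mxE//; exact: L2_negexp.
rewrite (inner_coanalytic_eq0 (L2_coanalytic q L2phi) sq' x0) normc0 in h.
have nx : norm2 (coanalytic phi q) = 0.
  apply/eqP; rewrite eq_le norm2_ge0 andbT.
  by move: h; rewrite pmulr_lle0// pmulr_rle0.
rewrite norm2_coanalytic in nx.
have q0 := pol_eq0 L2phi (outer_neq0 phiu) nx.
apply/eqP/rowP => l; rewrite mxE -(coef_negpoly (y 0) l) -/q q0 coef0.
exact: conjc0.
Qed.

(* Cea's argument: [coanalytic phi q] is the oblique projection of [z], [q1] any
   competitor. *)
Lemma oblique_bound n (z F : R -> R[i]) (q q1 : {poly R[i]}) : (n0 <= n)%N -> L2 z -> H2 F ->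
  (size q <= n.+1)%N -> (size q1 <= n.+1)%N ->
  (forall l : 'I_n.+1,
    inner (fun t => z t - coanalytic phi q t) (fun t => negexp l t * conjc (psi t)) = 0) ->
  norm2 (fun t => (z t - F t) - coanalytic phi q t) <=
    (1 + eps^-1) * norm2 (fun t => (z t - F t) - coanalytic phi q1 t).
Proof.
move=> n0n hz hF sq sq1 z0; have L2F : L2 F by case: hF.
have sd : (size (q - q1)%R <= n.+1)%N.
  by apply: leq_trans (size_polyD _ _) _; rewrite size_polyN geq_max sq sq1.
have [q' [sq' w0 h]] := angle_coanalytic n0n sd.
have xB t : coanalytic phi (q - q1) t = coanalytic phi q t - coanalytic phi q1 t.
  by rewrite /coanalytic /pol mulrBr hornerD hornerN mulrBr conjcB.
have L2q := L2_coanalytic q L2phi; have L2q1 := L2_coanalytic q1 L2phi.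
have L2w := L2_coanalytic q' L2psi.
have L2zF := L2B hz L2F.
have L2d := L2B L2zF L2q1.
(* The two arguments on the left differ by z - F minus the projection; against the partner, the
   residual of z vanishes by [z0] and F vanishes as an element of H^2. *)
have E : inner (coanalytic phi (q - q1)) (coanalytic psi q') =
    inner (fun t => (z t - F t) - coanalytic phi q1 t) (coanalytic psi q').
  rewrite (eq_inner (u' := fun t => ((z t - F t) - coanalytic phi q1 t) -
    ((z t - coanalytic phi q t) - F t)) (v' := coanalytic psi q'))//; last by move=> t _; rewrite xB; ring.
  rewrite innerBl//; last by apply: L2B => //; exact: L2B.
  rewrite [X in _ - X]innerBl//; last exact: L2B.
  rewrite (inner_coanalytic_eq0 (L2B hz L2q) sq' z0) (H2_perp_coanalytic q' hF).
  by rewrite subrr subr0.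
have h' : eps * norm2 (coanalytic phi (q - q1)) <= norm2 (fun t => (z t - F t) - coanalytic phi q1 t).
  rewrite -(ler_pM2r w0); apply: le_trans h _; rewrite E.
  exact: cauchy_schwarz.
rewrite (eq_norm2 (v := fun t => ((z t - F t) - coanalytic phi q1 t) -
  coanalytic phi (q - q1) t)); last first.
  by move=> t _; congr normc; rewrite xB; ring.
apply: le_trans (norm2B L2d (L2_coanalytic (q - q1) L2phi)) _.
by rewrite mulrDl mul1r lerD2l mulrC ler_pdivlMr// mulrC.
Qed.

Variables (r : nat) (u v F G : 'I_r.+1 -> R -> R[i]).
Hypotheses (uL2 : forall j, L2 (u j)) (vL2 : forall j, L2 (v j))
  (uF : forall j, is_projH2 (u j) (F j)) (vG : forall j, is_projH2 (v j) (G j)).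

Definition gram_ur n : 'M[R[i]]_(n.+1, r.+1) := \matrix_(j, k)
  inner (fun t => negexp j t * conjc (phi t)) (v k).
Definition gram_dl n : 'M[R[i]]_(r.+1, n.+1) := \matrix_(j, k)
  inner (u j) (fun t => negexp k t * conjc (psi t)).
Definition gram_dr : 'M[R[i]]_(r.+1, r.+1) := \matrix_(j, k) inner (u j) (v k).

(** The polynomial that represents the oblique projection of u_j: its coordinates form row j of the
    lower left block times the inverse Gram matrix. *)
Let schur_poly n (j : 'I_r.+1) : {poly R[i]} :=
  negpoly (fun l : 'I_n.+1 => (gram_dl n *m invmx (gram n)) j l).

Lemma schur_entry n j k :
  (gram_dr - gram_dl n *m invmx (gram n) *m gram_ur n) j k =
  inner (fun t => u j t - coanalytic phi (schur_poly n j) t) (v k).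
Proof.
rewrite innerBl//; last exact: L2_coanalytic.
rewrite !mxE; congr (_ - _).
rewrite (eq_inner (u' := fun t => \sum_(l < n.+1)
   (gram_dl n *m invmx (gram n)) j l * (negexp l t * conjc (phi t)))
   (v' := v k))//; last by move=> t _; rewrite /schur_poly coanalytic_negpoly.
rewrite inner_suml//; last by move=> l _; exact/L2Z/L2_negexp.
by apply: eq_bigr => l _; rewrite innerZl ?mxE//; exact: L2_negexp.
Qed.

(** Entrywise reading of C A^{-1} A = C: the residual is orthogonal to the span with psi, which is
    the hypothesis of [oblique_bound]. *)
Lemma schur_orth n j (l : 'I_n.+1) : gram n \in unitmx ->
  inner (fun t => u j t - coanalytic phi (schur_poly n j) t) (fun t => negexp l t * conjc (psi t)) = 0.
Proof.
move=> un; have L2l := L2_negexp l L2psi.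
rewrite innerBl//; last exact: L2_coanalytic.
have /matrixP/(_ j l) hc := mulmxKV un (gram_dl n).
rewrite [LHS]mxE [RHS]mxE in hc; rewrite -hc.
apply/eqP; rewrite subr_eq0 eq_sym; apply/eqP.
rewrite (eq_inner (u' := fun t => \sum_(l < n.+1)
   (gram_dl n *m invmx (gram n)) j l * (negexp l t * conjc (phi t)))
   (v' := fun t => negexp l t * conjc (psi t)))//;
  last by move=> t _; rewrite /schur_poly coanalytic_negpoly.
rewrite inner_suml//; last by move=> k _; exact/L2Z/L2_negexp.
by apply: eq_bigr => k _; rewrite innerZl ?[gram n _ _]mxE//; exact: L2_negexp.
Qed.

(** As F_j is in H^2, (F_j, G_k) = (F_j, v_k), so it suffices that (u_j - F_j) - Q u_j tends to 0 in
    norm. By [oblique_bound] this norm is at most 1 + 1/eps times the distance from u_j - F_j to any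
    competitor, and one approximant s is a competitor for all n >= size s. *)
Lemma schur_cvg j k :
  ((gram_dr - gram_dl n *m invmx (gram n) *m gram_ur n) j k : R[i]^o) @[n --> \oo] -->
  (inner (F j) (G k) : R[i]^o).
Proof.
have [hF uF0] := uF j; have [hG vG0] := vG k.
have L2F : L2 (F j) by case: hF.
have L2G : L2 (G k) by case: hG.
have FG : inner (F j) (G k) = inner (F j) (v k).
  have := vG0 _ hF; rewrite (innerBl (vL2 k) L2G L2F) => /eqP; rewrite subr_eq0 => /eqP h.
  by rewrite (innerJ L2G L2F) (innerJ (vL2 k) L2F) h.
apply/cvgC_near => e e0.
have L2uF := L2B (uL2 j) L2F.
have perp (m : nat) : inner (fun t => u j t - F j t) (efun m%:Z) = 0.
  exact: (uF0 _ (H2_efun m)).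
(* An approximation within e / (2 c) leaves e/2 after the quasi-optimality constant and
   Cauchy-Schwarz against v_k; the + 1 keeps c positive. *)
pose c := (1 + eps^-1) * (norm2 (v k) + 1).
have eV : 0 < eps^-1 by rewrite invr_gt0.
have c0 : 0 < c by rewrite mulr_gt0//; have := norm2_ge0 (v k); lra.
have [s hs] := outer_coanalytic_dense phiH2 phiu L2uF perp
  (divr_gt0 e0 (mulr_gt0 (ltr0n R 2) c0)).
near=> n.
have n0n : (n0 <= n)%N by near: n; exact: nbhs_infty_ge.
have sn : (size s <= n.+1)%N.
  by apply: (@leq_trans n) => //; near: n; exact: nbhs_infty_ge.
have ob := oblique_bound n0n (uL2 j) hF (size_negpoly _) sn
  (fun l => schur_orth j l (gram_unit n0n)).
have L2x : L2 (fun t => u j t - coanalytic phi (schur_poly n j) t).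
  by apply: L2B => //; exact: L2_coanalytic.
rewrite schur_entry FG -innerBl//.
rewrite (eq_inner (u' := fun t => - ((u j t - F j t) - coanalytic phi (schur_poly n j) t))
  (v' := v k))//;
  last by move=> t _; ring.
have L2y : L2 (fun t => (u j t - F j t) - coanalytic phi (schur_poly n j) t).
  by apply: L2B => //; exact: L2_coanalytic.
apply: le_lt_trans (cauchy_schwarz (L2N L2y) (vL2 k)) _; rewrite norm2N.
apply: (@le_lt_trans _ _ (e / 2)); last by lra.
apply: (@le_trans _ _ ((1 + eps^-1) * (e / (2 * c)) * (norm2 (v k) + 1))).
  rewrite ler_pM ?norm2_ge0//; last by rewrite lerDl.
  by apply: le_trans ob _; rewrite ler_wpM2l//; lra.
rewrite le_eqVlt; apply/orP; left; apply/eqP.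
by rewrite mulrAC -/c; field; rewrite gt_eqF.
Unshelve. all: by end_near. Qed.

Lemma gram_det_cvg :
  ((\det (gram n))^-1 * \det (block_mx (gram n) (gram_ur n) (gram_dl n) gram_dr) : R[i]^o)
    @[n --> \oo] --> (\det (\matrix_(j, k) inner (F j) (G k)) : R[i]^o).
Proof.
have c := cvg_det schur_cvg.
apply: cvg_trans c; apply: near_eq_cvg; near=> n.
have n0n : (n0 <= n)%N by near: n; exact: nbhs_infty_ge.
have un := gram_unit n0n.
rewrite det_schur// mulKf; last by move: un; rewrite unitmxE unitfE.
by congr (\det _); apply/matrixP => j k; rewrite [LHS]mxE.
Unshelve. all: by end_near. Qed.

End Main.

(** The weight dominates both |phi|^2 and |psi|^2; the first conclusion serves the f_j, the second
    the g_k. *)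
Lemma L2_weighted (R : realType) (f phi psi : R -> R[i]) :
  L2 phi -> L2 psi -> L2w (fun t => normc (phi t) ^+ 2 + normc (psi t) ^+ 2) f ->
  L2 (fun t => f t * conjc (phi t)) /\ L2 (fun t => f t * conjc (psi t)).
Proof.
move=> hphi hpsi [mf ifw].
have key chi : L2 chi -> (forall t, normc (chi t) ^+ 2 <=
    normc (phi t) ^+ 2 + normc (psi t) ^+ 2) -> L2 (fun t => f t * conjc (chi t)).
  move=> hchi le; apply: (L2_dom (cmeasurableM mf (cmeasurableJ (L2_meas hchi))) ifw).
  by move=> t _; rewrite normcM normc_conjc exprMn ler_wpM2l ?sqr_ge0.
by split; apply: key => // t; rewrite ?lerDl ?lerDr sqr_ge0.
Qed.

Theorem theorem4p2 (R : realType) (phi psi : R -> R[i])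
  (phi_H2 : H2 phi) (psi_H2 : H2 psi)
  (phi_outer : outer phi) (psi_outer : outer psi)
  (angle : exists (eps : R) (n0 : nat), 0 < eps /\
     forall n : nat, (n0 <= n)%N ->
     forall S : R -> R[i], trigpoly n S ->
     exists T : R -> R[i],
       [/\ trigpoly n T, T <> (fun=> 0) &
           (eps * norm2 (phi \* S) * norm2 (psi \* T))%:C
             <= inner (phi \* S) (psi \* T)])
  (r : nat) (f g F G : 'I_r.+1 -> R -> R[i])
  (f_L2 : forall j,
     L2w (fun t => normc (phi t) ^+ 2 + normc (psi t) ^+ 2) (f j))
  (g_L2 : forall j,
     L2w (fun t => normc (phi t) ^+ 2 + normc (psi t) ^+ 2) (g j))
  (F_proj : forall j, is_projH2 (f j \* cconj phi) (F j))
  (G_proj : forall j, is_projH2 (g j \* cconj psi) (G j)) :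
  let mu := psi \* cconj phi in
  (\forall n \near \oo, toeplitz_det mu n.-1 != 0) /\
  (((toeplitz_det mu n.-1)^-1 *
     \det (\matrix_(j < n + r.+1, k < n + r.+1)
             dint mu (extfam f j \* cconj (extfam g k))) : R[i]^o)
    @[n --> \oo] -->
    (\det (\matrix_(j < r.+1, k < r.+1)
             cint (F j \* cconj (G k))) : R[i]^o)).
Proof.
move=> mu.
have [uphi phiu] := outer_logP phi_outer; have [upsi psiu] := outer_logP psi_outer.
have [eps [n0 [eps0 {}angle]]] := angle.
have L2phi : L2 phi by case: phi_H2.
have L2psi : L2 psi by case: psi_H2.
have uL2 j := (L2_weighted L2phi L2psi (f_L2 j)).1.
have vL2 j := (L2_weighted L2phi L2psi (g_L2 j)).2.
have toepE n : toeplitz_det mu n = \det (gram phi psi n).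
  congr (\det _); apply/matrixP => j k; rewrite !mxE.
  apply: eq_cint => t _; rewrite /mu /= /cconj opprB conjcM conjcK.
  (* Toeplitz structure: only the difference of the indices counts, so their shift by n + 1
     cancels. *)
  have -> : efun ((j : nat)%:Z - (k : nat)%:Z) t = negexp j t * conjc (negexp k t) :> R[i].
    rewrite /negexp -efunN -efunD; congr efun; ring.
  by ring.
have bigE n : \det (\matrix_(j < n.+1 + r.+1, k < n.+1 + r.+1)
      dint mu (extfam f j \* cconj (extfam g k))) =
    \det (block_mx (gram phi psi n) (gram_ur phi (fun j t => g j t * conjc (psi t)) n)
      (gram_dl psi (fun j t => f j t * conjc (phi t)) n)
      (gram_dr (fun j t => f j t * conjc (phi t)) (fun j t => g j t * conjc (psi t)))).
  (* [extfam] and [block_mx] split the index in the same way, so the blocks match case by case. *)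
  congr (\det _); apply/matrixP => j k; rewrite [LHS]mxE /block_mx mxE /extfam.
  have E p q : dint mu (p \* cconj q) =
      inner (fun t => p t * conjc (phi t)) (fun t => q t * conjc (psi t)).
    by apply: eq_cint => t _; rewrite /mu /= /cconj conjcM conjcK; ring.
  by case: (fintype.split j) => a; rewrite mxE; case: (fintype.split k) => b;
    rewrite mxE E.
split.
  (* D_{n-1} is handled by [gram] at n - 1, which has to be at least n0. *)
  exists n0.+1 => // -[|n]; first by rewrite /= ltn0.
  rewrite /= ltnS => n0n; rewrite toepE.
  by have := gram_unit phi_H2 psi_H2 phiu psiu eps0 angle n0n; rewrite unitmxE unitfE.
set D := fun n => _ : R[i]^o.
(* After the shift, n + 1 negative indices are paired with D_n, the determinant of [gram] at n. *)
rewrite -(cvg_shiftS D) /D.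
under eq_fun do rewrite /= toepE bigE.
exact: (gram_det_cvg phi_H2 psi_H2 phiu psiu eps0 angle uL2 vL2 F_proj G_proj).
Qed.
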